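(* Let $H=\sum_{X\in S}\lambda_X h_X$ be a local Hamiltonian whose interaction graph has maximum degree $\mathfrak{d}\ge1$, let $\rho$ be a product state, and let $L(t)=\mathrm{tr}(e^{-iHt}\rho)$ for $t\in\mathbb{C}$. Let $t_L^*=1/[2e^2\mathfrak{d}(\mathfrak{d}+1)]$. Then $\log L(t)$ is analytic for $|t|<t_L^*$ (that is, $L$ has no zeros there and $\log L$ is the analytic branch with $\log L(0)=0$), and for every such $t$ and every integer $M\ge0$ the truncation error of the cluster expansion is bounded by $$\left|\log L(t)-\sum_{m=1}^M\sum_{\mathbf{W}\in\mathcal{G}_m}\frac{\lambda^{\mathbf{W}}}{\mathbf{W}!}\,\mathcal{D}_{\mathbf{W}}\log L(t)\right|\le|S|\,\frac{(|t|/t_L^* )^{M+1}}{1-|t|/t_L^*}.$$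
   Context: Setting. $V$ is a set of $n$ spins; each $v\in V$ carries a Hilbert space $\mathcal{H}^v$ of dimension $d$, and $\mathcal{H}=\bigotimes_{v\in V}\mathcal{H}^v$. A subsystem is a subset $X\subseteq V$. The support $\mathrm{supp}(B)$ of a linear operator $B$ on $\mathcal{H}$ is the smallest subsystem on which $B$ acts nontrivially. $S$ is a set of subsystems and $H=\sum_{X\in S}\lambda_X h_X$, where $\lambda_X\in\mathbb{R}$, $|\lambda_X|\le1$, and $h_X$ is Hermitian with $\mathrm{supp}(h_X)=X$ and operator norm $\|h_X\|=1$; $H$ is $k$-local, i.e. $|X|\le k$ for all $X\in S$, for some fixed $k$. The interaction graph is the simple graph with vertex set $S$ in which two distinct $X,Y\in S$ are joined by an edge iff $X\cap Y\ne\emptyset$; $\mathfrak{d}$ is its maximum degree. A product state is $\rho=\bigotimes_{v\in V}\rho_v$ with each $\rho_v$ a density operator on $\mathcal{H}^v$. Clusters. A cluster $\mathbf{W}$ is a nonempty finite multiset of elements of $S$; $\mu_{\mathbf{W}}(X)$ is the multiplicity of $X\in S$ in $\mathbf{W}$, and $|\mathbf{W}|=\sum_X\mu_{\mathbf{W}}(X)$. The cluster graph $G_{\mathbf{W}}$ has one vertex for each element of $\mathbf{W}$, counted with multiplicity, and two distinct vertices are adjacent iff their subsystems intersect (so copies of the same subsystem are adjacent). $\mathbf{W}$ is connected if $G_{\mathbf{W}}$ is connected. $\mathcal{G}_m$ is the set of connected clusters with $|\mathbf{W}|=m$. Put $\lambda^{\mathbf{W}}=\prod_{X\in S}\lambda_X^{\mu_{\mathbf{W}}(X)}$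 and $\mathbf{W}!=\prod_{X\in S}\mu_{\mathbf{W}}(X)!$. For a function $f$ of the parameters $\lambda=(\lambda_X)_{X\in S}$ (analytic near $\lambda=0$), the cluster derivative is $$\mathcal{D}_{\mathbf{W}}f=\left.\left[\prod_{X\in S}\left(\frac{\partial}{\partial\lambda_X}\right)^{\mu_{\mathbf{W}}(X)}\right]f(\lambda)\right|_{\lambda=0}.$$ In $\mathcal{D}_{\mathbf{W}}\log L(t)$, $L(t)$ is regarded as a function of $\lambda$ for fixed $t$; at $\lambda=0$ one has $L(t)=1$, and $\log$ is the branch with $\log1=0$. *)

(* Defs.v *)
(* MathComp + MathComp-Analysis, with complex numbers R[i] over R : realType. *)
From HB Require Import structures.
From mathcomp Require Import all_boot all_order all_algebra.
From mathcomp Require Import all_classical all_reals all_analysis.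
From mathcomp Require Export complex.

Set Implicit Arguments.
Unset Strict Implicit.
Unset Printing Implicit Defensive.

Import Order.TTheory GRing.Theory Num.Theory numFieldNormedType.Exports.
Local Open Scope classical_set_scope.
Local Open Scope ring_scope.
Local Open Scope complex_scope.

(* The Hilbert space of the spins V has as its orthonormal basis the
   configurations s : {ffun V -> 'I_d}; an operator is its matrix in that basis,
   row and column indices being numbered by enum_rank / enum_val. *)
Notation config V d := {ffun V -> 'I_d}.
Notation operator R V d := 'M[R[i]]_(#|{ffun V -> 'I_d}|).

Section ComplexFunctions.
Variable R : realType.

Definition cexp (z : R[i]) : R[i] :=
  (expR (complex.Re z))%:C *
  (cos (complex.Im z) +i* sin (complex.Im z)).

(* Principal branch, the w with e^w = z and -pi < Im w <= pi. *)
Definition clog (z : R[i]) : R[i] :=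
  xget 0 [set w | cexp w = z /\ - pi < complex.Im w <= pi].

(* Complex differentiability at every point of the open disc |z| < r;
   R[i]^o is R[i] as a normed module over itself. *)
Definition analytic_on_disc (r : R) (f : R[i] -> R[i]) : Prop :=
  forall z : R[i], Normc.normc z < r -> derivable (f : R[i]^o -> R[i]^o) z 1.

Definition mexp n (A : 'M[R[i]]_n) : 'M[R[i]]_n :=
  limn (series (fun k => (k`!%:R^-1 *: A ^+ k : 'M[R[i]^o]_n))).

Definition vnorm n (v : 'cV[R[i]]_n) : R :=
  Num.sqrt (\sum_i Normc.normc (v i 0) ^+ 2).

Definition op_norm n (A : 'M[R[i]]_n) : R :=
  sup [set vnorm (A *m v) | v in [set v | vnorm v = 1]].

(* In the order of R[i], 0 <= z says that z is a nonnegative real. *)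
Definition density_operator n (A : 'M[R[i]]_n) : Prop :=
  [/\ A \is hermsymmx,
      forall v : 'cV[R[i]]_n, 0 <= ((map_mx conjc v)^T *m A *m v) 0 0
    & \tr A = 1].

End ComplexFunctions.

Section Spins.
Variables (R : realType) (V : finType) (d : nat).
Implicit Types (X Y : {set V}) (S : {set {set V}}).

Definition restrict_config X (s : config V d) : config {v : V | v \in X} d :=
  [ffun v => s (val v)].

(* A (x) 1, where A acts on the spins in X and 1 on those outside X. *)
Definition extend X (A : operator R {v : V | v \in X} d) : operator R V d :=
  \matrix_(i, j)
    let s : config V d := enum_val i in let s' : config V d := enum_val j in
    A (enum_rank (restrict_config X s)) (enum_rank (restrict_config X s')) *
    [forall v in ~: X, s v == s' v]%:R.

Definition acts_within (B : operator R V d) X : Prop :=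
  exists A : operator R {v : V | v \in X} d, B = extend A.

Definition has_support (B : operator R V d) X : Prop :=
  acts_within B X /\ forall Y, acts_within B Y -> X \subset Y.

Definition product_state (rho : operator R V d) : Prop :=
  exists r : V -> 'M[R[i]]_d,
    (forall v, density_operator (r v)) /\
    rho = \matrix_(i, j)
      let s : config V d := enum_val i in let s' : config V d := enum_val j in
      \prod_v r v (s v) (s' v).

Definition max_degree S : nat :=
  \max_(X in S) #|[set Y in S | (Y != X) && (X :&: Y != finset.set0)]|.

(* The parameters lambda and the terms h are total functions on subsets of V
   of which only the values on S are used. *)
Definition hamiltonian S (lam : {set V} -> R) (h : {set V} -> operator R V d) :
    operator R V d :=
  \sum_(X in S) (lam X)%:C *: h X.

Definition loschmidt S (h : {set V} -> operator R V d) (rho : operator R V d)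
    (lam : {set V} -> R) (t : R[i]) : R[i] :=
  \tr (mexp ((- 'i * t) *: hamiltonian S lam h) *m rho).

End Spins.

Section Clusters.
Variables (R : realType) (V : finType).
Implicit Types (X Y : {set V}) (S : {set {set V}}).

(* A multiset of subsystems is given by its multiplicities mu; the vertices of
   its cluster graph are the pairs (X, i) with i < mu X. *)
Definition cluster_vertex (mu : {set V} -> nat) : finType :=
  {X : {set V} & 'I_(mu X)}.

Definition cluster_edge (mu : {set V} -> nat) : rel (cluster_vertex mu) :=
  [rel u v | (u != v) && (tag u :&: tag v != finset.set0)].

Definition connected_cluster (mu : {set V} -> nat) : bool :=
  [forall u : cluster_vertex mu, forall v : cluster_vertex mu,
    connect (@cluster_edge mu) u v].

(* Multisets of elements of S of size m; for m > 0 these are nonempty.  Since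
   no multiplicity exceeds the size, 'I_m.+1 loses none of them. *)
Definition connected_clusters S m : {set {ffun {set V} -> 'I_m.+1}} :=
  [set W in {: {ffun {set V} -> 'I_m.+1}} |
    [&& [forall X, (X \notin S) ==> (W X == 0 :> nat)],
        (\sum_(X in S) W X)%N == m
      & connected_cluster (fun X => W X : nat)]].

(* d/d lambda_X of a complex-valued function of real parameters. *)
Definition partial X (f : ({set V} -> R) -> R[i]) (lam : {set V} -> R) : R[i] :=
  let slice s := f (fun Y => if Y == X then s else lam Y) in
  (derive1 (fun s => complex.Re (slice s)) (lam X)) +i*
  (derive1 (fun s => complex.Im (slice s)) (lam X)).

Definition cluster_derivative S (mu : {set V} -> nat)
    (f : ({set V} -> R) -> R[i]) : R[i] :=
  foldr (fun X => iter (mu X) (partial X)) f (enum S) (fun=> 0).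

Definition cluster_monomial S (mu : {set V} -> nat) (lam : {set V} -> R) : R :=
  \prod_(X in S) lam X ^+ mu X.

Definition cluster_factorial S (mu : {set V} -> nat) : nat :=
  (\prod_(X in S) (mu X)`!)%N.

(* The sum of lambda^W / W! D_W f over connected W of size 1, ..., M. *)
Definition cluster_expansion S (lam : {set V} -> R) (M : nat)
    (f : ({set V} -> R) -> R[i]) : R[i] :=
  \sum_(1 <= m < M.+1) \sum_(W in connected_clusters S m)
    (cluster_monomial S (fun X => W X) lam /
     (cluster_factorial S (fun X => W X))%:R)%:C *
    cluster_derivative S (fun X => W X) f.

End Clusters.

(* Main.v *)
(* Idea.  L(t) is the generating function of the traces tr(h_w rho) of words w in
   the letters S.  Grouping the words by their set of letters T gives
   Z_A = sum_(T <= A) xi(T), where xi factorizes over subsets of S that do not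
   touch each other (rho is a product state) and, in the norm sum |a_n| r^n of
   power series in t, is bounded by (r e^r)^|T| (the letters are contractions).
   A Dobrushin-type induction then shows Z_A = (1 + E) Z_(A \ Y) with |E| small
   in that norm, for r the radius t_L.  Adding up the series log(1 + E) bounds the
   norm of log L by |S|, so no complex analysis is needed: the Taylor
   coefficients c_m of log L satisfy sum |c_m| r^m <= |S|, and exp (log L) = L
   because both sides solve the same linear differential equation on every ray.
   Finally c_m t^m is the degree m part of log L as a power series in lambda, that
   is, the sum of lambda^W / W! D_W log L over all clusters W of size m; the
   disconnected ones contribute 0 because log L is then a sum of two functions of
   disjoint sets of parameters (or, for several copies of the empty subsystem,
   linear in its parameter). *)
Require Import Defs.
From mathcomp Require Import all_boot all_order all_algebra.
From mathcomp Require Import all_classical all_reals all_analysis.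
From mathcomp Require Import ring lra zify.
Import Order.TTheory GRing.Theory Num.Theory numFieldNormedType.Exports.
Set Implicit Arguments.
Unset Strict Implicit.
Unset Printing Implicit Defensive.
Local Open Scope ring_scope.
Local Open Scope complex_scope.

(** * Polynomials over R[i] modulo 'X^N and their weighted l1 norm *)

(** Two convergence domains of very different quality meet. In t, the radius has to serve all
    couplings of modulus at most 1; it comes from the recursion, whose bounds are uniform in the
    truncation order. In the couplings, derivatives at 0 only require some neighbourhood of 0, for
    which crude entrywise norms and geometric growth suffice. The principal logarithm inside the
    cluster derivatives has to agree with the power series only there, where |log L| < pi. Working
    with formal series avoids a circularity: every Z_A has constant term 1 and is invertible, so the
    absence of zeros is never assumed in the induction but follows from the convergence of log L.
    The norm is submultiplicative, hence 1 / (1 + E) and log (1 + E) are controlled by geometric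
    series. The induction charges a price b for each element that touches the root. It closes if (1
    + delta) / (1 - delta) <= b, where delta = r e^r b^deg; with b = 1 + 1/deg the power b^deg stays
    bounded for every degree. *)

Section Normc.
Variable R : realType.
Implicit Types (x y : R[i]).
Local Notation nc := (@Normc.normc R).

Lemma normc_ge0 x : 0 <= nc x.
Proof. by case: x => a b /=; exact: sqrtr_ge0. Qed.

Lemma normcD x y : nc (x + y) <= nc x + nc y.
Proof. exact: le_normcD. Qed.

Lemma normcN x : nc (- x) = nc x.
Proof. exact: normcN. Qed.

Lemma normcM x y : nc (x * y) = nc x * nc y.
Proof. exact: Normc.normcM. Qed.

Lemma normcB x y : nc (x - y) = nc (y - x).
Proof. by rewrite -normcN opprB. Qed.

Lemma normcX x n : nc (x ^+ n) = nc x ^+ n.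
Proof.
by elim: n => [|n IH]; [rewrite !expr0 Normc.normc1|rewrite !exprS normcM IH].
Qed.

Lemma normcV x : nc x^-1 = (nc x)^-1.
Proof. exact: Normc.normcV. Qed.

Lemma normcC (a : R) : nc a%:C = `|a|.
Proof. by rewrite /= expr0n /= addr0 sqrtr_sqr. Qed.

Lemma normc_natr n : nc n%:R = n%:R.
Proof. by rewrite -(rmorph_nat (real_complex R)) normcC normr_nat. Qed.

Lemma normc_sum (I : Type) (s : seq I) (P : pred I) (F : I -> R[i]) :
  nc (\sum_(i <- s | P i) F i) <= \sum_(i <- s | P i) nc (F i).
Proof.
elim/big_rec2: _ => [|i u v _ IH]; first by rewrite Normc.normc0.
by apply: le_trans (normcD _ _) _; rewrite lerD2l.
Qed.

Lemma normc_prod (I : Type) (s : seq I) (P : pred I) (F : I -> R[i]) :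
  nc (\prod_(i <- s | P i) F i) = \prod_(i <- s | P i) nc (F i).
Proof. by elim/big_rec2: _ => [|i u v _ <-]; rewrite ?Normc.normc1 ?normcM. Qed.

Lemma normc_eq0 x : (nc x == 0) = (x == 0).
Proof.
by apply/eqP/eqP => [/Normc.eq0_normc //|->]; exact: Normc.normc0.
Qed.

Lemma normcE x : `|x| = (nc x)%:C.
Proof. by case: x. Qed.

Lemma normc_i : nc (- 'i) = 1.
Proof. by rewrite /= oppr0 sqrrN expr0n expr1n add0r sqrtr1. Qed.

Lemma normc_geRe x : `|complex.Re x| <= nc x.
Proof. by rewrite -lecR -normcE; exact: normc_ge_Re. Qed.

Lemma normc_geIm x : `|complex.Im x| <= nc x.
Proof.
case: x => a b /=; rewrite -[leLHS]sqrtr_sqr ler_wsqrtr //.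
by rewrite lerDr sqr_ge0.
Qed.

Lemma normc_leReIm x : nc x <= `|complex.Re x| + `|complex.Im x|.
Proof.
case: x => a b /=; rewrite -[leRHS]ger0_norm ?addr_ge0 //.
rewrite -[leRHS]sqrtr_sqr ler_wsqrtr //.
rewrite sqrrD !real_normK ?num_real //.
by rewrite -addrA lerD2l lerDr mulrn_wge0 // mulr_ge0.
Qed.

End Normc.

Lemma sum_shift (M : nmodType) (b : nat -> M) (N j : nat) :
  \sum_(i < N | (j <= i)%N) b (i - j)%N = \sum_(i < N - j) b i.
Proof.
rewrite -(big_mkord (fun i => (j <= i)%N) (fun i => b (i - j)%N)).
rewrite -(big_mkord predT b) /=.
have [Nj|jN] := leqP N j.
  move: (Nj); rewrite -subn_eq0 => /eqP ->; rewrite [RHS]big_geq //.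
  rewrite big_nat_cond big_pred0 // => i.
  by apply/negP => /andP[/andP[_ iN] ji]; move: (leq_ltn_trans ji iN); rewrite ltnNge Nj.
rewrite (big_cat_nat (n := j)) //=; last exact: ltnW.
rewrite big_nat_cond big_pred0 ?add0r; last first.
  by move=> i; apply/negP => /andP[/andP[_ ij]]; rewrite leqNgt ij.
rewrite -{1}[j]add0n big_addn (eq_bigl predT) => [|i]; last by rewrite leq_addl.
by apply: eq_bigr => i _; rewrite addnK.
Qed.

Section TruncatedPolynomials.
Variable R : realType.
Variables (N : nat) (r : R).
Hypothesis r_ge0 : 0 <= r.
Local Notation nc := (@Normc.normc R).
Implicit Types p q : {poly R[i]}.

Definition teq p q := forall i, (i < N)%N -> p`_i = q`_i.

Definition tnorm p : R := \sum_(i < N) nc p`_i * r ^+ i.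

Lemma teq_refl p : teq p p. Proof. by []. Qed.

Lemma teq_sym p q : teq p q -> teq q p.
Proof. by move=> pq i iN; rewrite pq. Qed.

Lemma teq_trans q p s : teq p q -> teq q s -> teq p s.
Proof. by move=> pq qs i iN; rewrite pq // qs. Qed.

Lemma teqD p q p' q' : teq p q -> teq p' q' -> teq (p + p') (q + q').
Proof. by move=> pq pq' i iN; rewrite !coefD pq // pq'. Qed.

Lemma teqM p q p' q' : teq p q -> teq p' q' -> teq (p * p') (q * q').
Proof.
move=> pq pq' i iN; rewrite !coefM; apply: eq_bigr => j _.
have ji : (j <= i)%N by rewrite -ltnS.
by rewrite pq ?(leq_ltn_trans ji) // pq' // (leq_ltn_trans (leq_subr _ _)).
Qed.

Lemma teq_sum (I : Type) (s : seq I) (P : pred I) (F G : I -> {poly R[i]}) :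
  (forall i, P i -> teq (F i) (G i)) ->
  teq (\sum_(i <- s | P i) F i) (\sum_(i <- s | P i) G i).
Proof.
move=> FG; elim/big_rec2: _ => [|i u v Pi IH]; first exact: teq_refl.
by apply: teqD => //; exact: FG.
Qed.

(** The Euler operator: unlike the plain derivative it loses no order, so it respects congruence
    modulo ['X^N]. *)
Definition theta p : {poly R[i]} := 'X * p^`().

Lemma coef_theta p i : (theta p)`_i = p`_i *+ i.
Proof. by rewrite /theta coefXM; case: i => [|i] /=; rewrite ?coef_deriv. Qed.

Lemma teq_theta p q : teq p q -> teq (theta p) (theta q).
Proof. by move=> pq i iN; rewrite !coef_theta pq. Qed.

Lemma thetaD p q : theta (p + q) = theta p + theta q.
Proof. by rewrite /theta derivD mulrDr. Qed.

Lemma thetaM p q : theta (p * q) = theta p * q + p * theta q.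
Proof. by rewrite /theta derivM; ring. Qed.

Lemma theta1 : theta 1 = 0.
Proof. by rewrite /theta -polyC1 derivC mulr0. Qed.

Lemma tnorm_ge0 p : 0 <= tnorm p.
Proof.
by apply: sumr_ge0 => i _; rewrite mulr_ge0 ?normc_ge0 // exprn_ge0.
Qed.

Lemma tnormD p q : tnorm (p + q) <= tnorm p + tnorm q.
Proof.
rewrite -big_split /=; apply: ler_sum => i _.
by rewrite coefD -mulrDl ler_wpM2r ?exprn_ge0 // normcD.
Qed.

Lemma tnorm0 : tnorm 0 = 0.
Proof. by rewrite /tnorm big1 // => i _; rewrite coef0 Normc.normc0 mul0r. Qed.

Lemma tnorm_sum (I : Type) (s : seq I) (P : pred I) (F : I -> {poly R[i]}) :
  tnorm (\sum_(i <- s | P i) F i) <= \sum_(i <- s | P i) tnorm (F i).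
Proof.
elim/big_rec2: _ => [|i u v _ IH]; first by rewrite tnorm0.
by apply: le_trans (tnormD _ _) _; rewrite lerD2l.
Qed.

Lemma tnormZ a p : tnorm (a *: p) = nc a * tnorm p.
Proof.
by rewrite /tnorm mulr_sumr; apply: eq_bigr => i _; rewrite coefZ normcM mulrA.
Qed.

Lemma tnormN p : tnorm (- p) = tnorm p.
Proof. by rewrite -scaleN1r tnormZ normcN Normc.normc1 mul1r. Qed.

Lemma tnorm1 : tnorm 1 <= 1.
Proof.
rewrite /tnorm; case: N => [|m]; first by rewrite big_ord0.
rewrite big_ord_recl /= coef1 Normc.normc1 expr0 mulr1 big1 ?addr0 // => i _.
by rewrite coef1 mulr0n Normc.normc0 mul0r.
Qed.

Lemma sum_shift_le (b : nat -> R) (j : nat) : (forall k, 0 <= b k) ->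
  \sum_(i < N | (j <= i)%N) b (i - j)%N <= \sum_(i < N) b i.
Proof.
move=> b0; rewrite sum_shift -!(big_mkord predT b).
by rewrite [leRHS](big_cat_nat (n := (N - j)%N)) ?leq_subr //= lerDl sumr_ge0.
Qed.

(** The truncated product is part of the full double sum of nonnegative terms, and the weights
    multiply: [r ^+ j * r ^+ (i - j) = r ^+ i]. *)
Lemma tnormM p q : tnorm (p * q) <= tnorm p * tnorm q.
Proof.
pose a i := nc p`_i * r ^+ i; pose b i := nc q`_i * r ^+ i.
have a0 i : 0 <= a i by rewrite mulr_ge0 ?normc_ge0 ?exprn_ge0.
have b0 i : 0 <= b i by rewrite mulr_ge0 ?normc_ge0 ?exprn_ge0.
apply: (@le_trans _ _ (\sum_(i < N) \sum_(j < N | (j <= i)%N) a j * b (i - j)%N)).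
  apply: ler_sum => i _; rewrite coefM.
  rewrite (big_ord_widen_cond N predT (fun j => p`_j * q`_(i - j))) //=.
  apply: le_trans (ler_wpM2r (exprn_ge0 _ r_ge0) (normc_sum _ _ _)) _.
  rewrite mulr_suml; apply: ler_sum => j; rewrite ltnS => ji.
  by rewrite normcM /a /b mulrACA -exprD subnKC.
rewrite /tnorm mulr_suml (exchange_big_dep predT) //=.
apply: ler_sum => j _; rewrite -mulr_sumr ler_wpM2l //.
exact: sum_shift_le.
Qed.

Lemma tnormX p n : tnorm (p ^+ n) <= tnorm p ^+ n.
Proof.
elim: n => [|n IH]; first by rewrite !expr0 tnorm1.
rewrite !exprS; apply: le_trans (tnormM _ _) _.
by rewrite ler_wpM2l ?tnorm_ge0.
Qed.

Lemma coef_exp_small p n i : p`_0 = 0 -> (i < n)%N -> (p ^+ n)`_i = 0.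
Proof.
move=> p0 iltn; have -> : p = (\poly_(j < (size p).-1) p`_j.+1) * 'X.
  apply/polyP => j; rewrite coefMX coef_poly; case: j => [|j] //=.
  by case: ltnP => // sj; rewrite nth_default // -add1n -leq_subLR subn1.
by rewrite exprMn coefMXn iltn.
Qed.

Section Logarithm.
Variables (E : {poly R[i]}) (delta : R).
Hypotheses (E0 : E`_0 = 0) (delta_lt1 : delta < 1) (E_le : tnorm E <= delta).

Let delta_ge0 : 0 <= delta.
Proof. exact: le_trans (tnorm_ge0 E) E_le. Qed.

Definition tinv1D : {poly R[i]} := \sum_(k < N) (- E) ^+ k.

Definition tlog1D : {poly R[i]} :=
  \sum_(k < N) ((-1) ^+ k / k.+1%:R) *: E ^+ k.+1.

(** The geometric sum leaves the remainder [(- E) ^+ N], which is divisible by ['X^N] because [E]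
    has no constant term. *)
Lemma tinv1DP : teq ((1 + E) * tinv1D) 1.
Proof.
move=> i iN; have -> : (1 + E) * tinv1D = 1 - (- E) ^+ N.
  by rewrite -[RHS]opprB subrX1 -mulNr; congr (_ * _); ring.
by rewrite coefB coef_exp_small ?subr0 // coefN E0 oppr0.
Qed.

Lemma geometric_le : \sum_(k < N) delta ^+ k <= (1 - delta)^-1.
Proof.
have d1 : 0 < 1 - delta by rewrite subr_gt0.
rewrite -[leRHS]mul1r ler_pdivlMr //.
have -> : (\sum_(k < N) delta ^+ k) * (1 - delta) = 1 - delta ^+ N.
  by rewrite mulrC -[RHS]opprB subrX1 -mulNr opprB.
by rewrite gerBl exprn_ge0.
Qed.

Lemma tnorm_tinv1D : tnorm tinv1D <= (1 - delta)^-1.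
Proof.
apply: le_trans (tnorm_sum _ _ _) _; apply: le_trans geometric_le.
apply: ler_sum => k _; apply: le_trans (tnormX _ _) _.
by rewrite tnormN lerXn2r // nnegrE ?tnorm_ge0.
Qed.

Lemma tnorm_tlog1D : tnorm tlog1D <= delta / (1 - delta).
Proof.
apply: le_trans (tnorm_sum _ _ _) _.
apply: le_trans (ler_wpM2l delta_ge0 geometric_le).
rewrite mulr_sumr; apply: ler_sum => k _; rewrite tnormZ -exprS.
apply: (@le_trans _ _ (1 * tnorm (E ^+ k.+1))).
  rewrite ler_wpM2r ?tnorm_ge0 // normcM normcX normcN Normc.normc1 expr1n mul1r.
  by rewrite normcV normc_natr invf_le1 ?ltr0n // ler1n.
rewrite mul1r; apply: le_trans (tnormX _ _) _.
by rewrite lerXn2r // nnegrE ?tnorm_ge0.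
Qed.

(** An identity of polynomials, not only modulo ['X^N]: logarithm and inverse are cut at the same
    number of terms, and their terms of index [k] correspond. *)
Lemma theta_tlog1D : theta tlog1D = theta E * tinv1D.
Proof.
rewrite /theta /tlog1D /tinv1D raddf_sum /= -mulrA; congr (_ * _).
rewrite mulr_sumr; apply: eq_bigr => k _.
rewrite derivZ deriv_exp /= -[X in _ *: X](@scaler_nat R[i]) scalerA.
rewrite divfK ?pnatr_eq0 // [in RHS]exprNn mulrCA -mul_polyC.
by rewrite rmorphXn rmorphN1.
Qed.

End Logarithm.
End TruncatedPolynomials.

(** * The cluster recursion *)

Section BigSubsets.
(* classical_sets and finmap shadow many lemmas on finite sets. *)
Import fintype boot.finset.
Variables (I : finType) (M : nmodType).
Implicit Types (A T : {set I}).

Lemma big_subset_setU1 (F : {set I} -> M) (Y : I) A : Y \notin A ->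
  \sum_(U : {set I} | U \subset Y |: A) F U =
  \sum_(U : {set I} | U \subset A) F U +
  \sum_(U : {set I} | U \subset A) F (Y |: U).
Proof.
move=> YA; rewrite (bigID (fun U : {set I} => Y \in U)) /= addrC; congr (_ + _).
  apply: eq_bigl => U; apply/andP/idP => [[sUA YU]|sUA].
    apply/subsetP => Z ZU; have := subsetP sUA _ ZU; rewrite !inE.
    by case: eqP => [ZY|//]; rewrite -ZY ZU in YU.
  split; first exact: subset_trans sUA (subsetU1 _ _).
  by apply: contra YA; exact: (subsetP sUA).
rewrite (reindex_onto (fun U => Y |: U) (fun U => U :\ Y)) /=; last first.
  by move=> U /andP[_ YU]; rewrite setD1K.
apply: eq_bigl => U; rewrite setU11 andbT.
apply/andP/idP => [[sUA /eqP eU]|sUA].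
  apply/subsetP => Z ZU; have : Z \in Y |: U by rewrite inE ZU orbT.
  move/(subsetP sUA); rewrite !inE; case: eqP => [ZY|//].
  by move: ZU; rewrite -eU ZY !inE eqxx.
split; first exact: setUS.
by rewrite setU1K //; apply: contra YA; exact: (subsetP sUA).
Qed.

Lemma big_subset_setU (F : {set I} -> M) A T : [disjoint T & A] ->
  \sum_(U : {set I} | U \subset T :|: A) F U =
  \sum_(T' : {set I} | T' \subset T) \sum_(U : {set I} | U \subset A) F (T' :|: U).
Proof.
move=> dTA; rewrite (partition_big (fun U => U :&: T) (fun T' => T' \subset T)) /=; last first.
  by move=> U _; exact: subsetIr.
apply: eq_bigr => T' sT'.
rewrite (reindex_onto (fun U => T' :|: U) (fun U => U :\: T)) /=; last first.
  by move=> U /andP[_ /eqP <-]; rewrite setID.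
apply: eq_bigl => U; apply/andP/idP => [[/andP[sUA /eqP eT'] /eqP eU]|sUA].
  apply/subsetP => Z ZU; have : Z \in T' :|: U by rewrite inE ZU orbT.
  move/(subsetP sUA); rewrite !inE; case: (boolP (Z \in T)) => //= ZT _.
  by move: ZU; rewrite -eU !inE ZT.
have dTU : T :&: U = set0.
  by apply/eqP; rewrite setI_eq0; apply: disjointWr sUA dTA.
have T'T : T' :\: T = set0 by apply/eqP; rewrite setD_eq0.
rewrite setUSS //= setIUl (setIidPl sT') [U :&: T]setIC dTU setU0 eqxx.
by split=> //; rewrite setDUl T'T set0U; apply/eqP/setDidPl; rewrite disjoint_sym -setI_eq0 dTU.
Qed.

End BigSubsets.

Section ClusterRecursion.
Import fintype boot.finset.
Variables (R : realType) (I : finType) (adj : rel I) (S : {set I}).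
Variables (N : nat) (r : R) (xi : {set I} -> {poly R[i]}) (x b : R) (deg : nat).
Implicit Types (A T U : {set I}) (X Y : I).
Local Notation nc := (@Normc.normc R).
Local Notation teq := (@teq R N).
Local Notation tnorm := (tnorm N r).

Definition partition_fn A : {poly R[i]} := \sum_(U : {set I} | U \subset A) xi U.

(** The quotient of [rooted T A] by [partition_fn A] is what the induction controls. For [T =
    [set Y]] with [Y \notin A] it is the [E] such that [partition_fn (Y |: A) = (1 + E) *
    partition_fn A]. *)
Definition rooted T A : {poly R[i]} := \sum_(U : {set I} | U \subset A) xi (T :|: U).

Definition touching T A : {set I} := [set Y in A | [exists X in T, adj X Y]].

Hypothesis r_ge0 : 0 <= r.
Hypothesis xi_le : forall T, T \subset S -> tnorm (xi T) <= x ^+ #|T|.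
Hypothesis xi0 : xi set0 = 1.
Hypothesis xi_coef0 : forall T, T != set0 -> (xi T)`_0 = 0.
Hypothesis partition_fnU : forall T A, T \subset S -> A \subset S ->
  [disjoint T & A] -> touching T A = set0 ->
  teq (partition_fn (T :|: A)) (partition_fn T * partition_fn A).
Hypothesis degP : forall Y, Y \in S ->
  (#|[set Z in S | (Z != Y) && adj Y Z]| <= deg)%N.
Hypotheses (x_ge0 : 0 <= x) (b_ge1 : 1 <= b).
Let delta : R := x * b ^+ deg.
Hypotheses (delta_lt1 : delta < 1) (delta_b : 1 + delta <= b * (1 - delta)).

Lemma rooted_recursion T A Y : Y \in A -> Y \notin T ->
  rooted T A = rooted T (A :\ Y) + rooted (Y |: T) (A :\ Y).
Proof.
move=> YA YT; rewrite /rooted -{1}(setD1K YA) big_subset_setU1 ?setD11 //.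
congr (_ + _); apply: eq_bigr => U _; congr xi.
by rewrite setUCA setUA.
Qed.

Lemma rooted0 A : rooted set0 A = partition_fn A.
Proof. by apply: eq_bigr => U _; rewrite set0U. Qed.

Lemma partition_fn0 : partition_fn set0 = 1.
Proof.
rewrite /partition_fn (big_pred1 set0) ?xi0 // => U.
by rewrite subset0.
Qed.

Lemma touchingS T T' A : T' \subset T -> touching T' A \subset touching T A.
Proof.
move=> sT; apply/subsetP => Y; rewrite !inE => /andP[-> /existsP[X /andP[XT aXY]]] /=.
by apply/existsP; exists X; rewrite aXY (subsetP sT).
Qed.

(** The hypothesis [partition_fnU] factorizes partition functions, not single weights. Summing
    [rooted T' A] over all [T' \subset T] gives [partition_fn (T :|: A)], and induction on [#|T|]
    cancels the proper subsets, as in Moebius inversion. *)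
Lemma rooted_factor T A : T \subset S -> A \subset S -> [disjoint T & A] ->
  touching T A = set0 -> teq (rooted T A) (xi T * partition_fn A).
Proof.
have [n] := ubnP #|T|; elim: n T => // n IH T Tn sTS sAS dTA tTA.
have sumE : teq (\sum_(T' : {set I} | T' \subset T) rooted T' A)
              (\sum_(T' : {set I} | T' \subset T) xi T' * partition_fn A).
  rewrite -mulr_suml -big_subset_setU //; exact: partition_fnU.
move: sumE; rewrite (bigD1 T) //= [X in teq _ X](bigD1 T) //=.
set Sl := (X in teq (_ + X)); set Sr := (X in teq _ (_ + X)) => sumE.
have sS : teq Sl Sr.
  apply: teq_sum => T' /andP[sT' nT'].
  have pT' : T' \proper T by rewrite properEneq nT'.
  apply: IH => //.
  - by rewrite -ltnS (leq_trans _ Tn) // ltnS proper_card.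
  - exact: subset_trans sT' sTS.
  - exact: disjointWl sT' dTA.
  - by apply/eqP; rewrite -subset0 -tTA touchingS.
by move=> i iN; have := sumE i iN; rewrite !coefD sS // => /addIr.
Qed.

Lemma partition_fn_coef0 A : (partition_fn A)`_0 = 1.
Proof.
rewrite coef_sum (bigD1 set0) ?sub0set //= xi0 coef1 eqxx.
by rewrite big1 ?addr0 // => U /andP[_ /xi_coef0].
Qed.

Lemma rooted_coef0 T A : T != set0 -> (rooted T A)`_0 = 0.
Proof.
move=> T0; rewrite coef_sum big1 // => U _; apply: xi_coef0.
by rewrite setU_eq0 negb_and T0.
Qed.

(** Revealing [Y] uses up one touched element and exposes at most [deg] new ones; hence the factor
    [b ^+ deg] in [delta]. *)
Lemma card_touching_cons T A Y : Y \in touching T A ->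
  Y \in S -> A \subset S ->
  (#|touching (Y |: T) (A :\ Y)| <= #|touching T A|.-1 + deg)%N.
Proof.
move=> tY YS sAS; rewrite (cardsD1 Y (touching T A)) tY /=.
apply: (@leq_trans #|(touching T A :\ Y) :|: [set Z in S | (Z != Y) && adj Y Z]|).
  apply: subset_leq_card; apply/subsetP => Z.
  rewrite !inE => /andP[/andP[ZY ZA] /existsP[X /andP[]]].
  rewrite !inE => /predU1P[->|XT] aXZ; first by rewrite (subsetP sAS) // ZY aXZ orbT.
  by rewrite ZY ZA /=; apply/orP; left; apply/existsP; exists X; rewrite XT.
apply: leq_trans (leq_card_setU _ _) _.
by rewrite leq_add2l degP.
Qed.

Lemma card_touching_single A Y : Y \in S -> A \subset S ->
  (#|touching [set Y] (A :\ Y)| <= deg)%N.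
Proof.
move=> YS sAS; apply: leq_trans (degP YS).
apply: subset_leq_card; apply/subsetP => Z.
rewrite !inE => /andP[/andP[ZY ZA] /existsP[X /andP[]]].
by rewrite !inE => /eqP -> aYZ; rewrite (subsetP sAS) // ZY.
Qed.

Lemma touchingD1 T A Y : touching T (A :\ Y) = touching T A :\ Y.
Proof. by apply/setP => Z; rewrite !inE andbA. Qed.

(** The quotient for [[set Y]] is a hypothesis so that the step serves both inside the proof of
    [rooted_quotient], where the induction hypothesis supplies it, and afterwards. That [E] has no
    constant term follows by comparing degree 0, which takes [0 < N]. *)
Lemma partition_fn_step A Y : (0 < N)%N -> Y \in A -> A \subset S ->
  (exists Q, teq (rooted [set Y] (A :\ Y)) (Q * partition_fn (A :\ Y)) /\
    tnorm Q <= x ^+ #|[set Y]| * b ^+ #|touching [set Y] (A :\ Y)|) ->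
  exists E, [/\ teq (partition_fn A) ((1 + E) * partition_fn (A :\ Y)),
    E`_0 = 0 & tnorm E <= delta].
Proof.
move=> N_gt0 YA sAS [E [EE Ele]]; exists E; split.
- rewrite -rooted0 (rooted_recursion YA) ?inE // setU0 rooted0 mulrDl mul1r.
  by apply: teqD.
- have := EE 0%N N_gt0; rewrite coef0M partition_fn_coef0 mulr1 rooted_coef0 //.
  by apply/set0Pn; exists Y; rewrite inE.
- apply: le_trans Ele _; rewrite cards1 expr1 ler_wpM2l //.
  by rewrite ler_weXn2l // card_touching_single // (subsetP sAS).
Qed.

(* Reveal the elements of A that touch T one at a time: each step costs a
   factor b, and once none is left the sum factorizes. *)
Lemma rooted_quotient T A : A \subset S -> T \subset S -> [disjoint T & A] ->
  exists Q, teq (rooted T A) (Q * partition_fn A) /\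
    tnorm Q <= x ^+ #|T| * b ^+ #|touching T A|.
Proof.
have b_ge0 : 0 <= b by exact: le_trans ler01 b_ge1.
have [N0 _ _ _|N_gt0] := posnP N.
  exists 0; split; first by move=> i; rewrite N0.
  by rewrite tnorm0 mulr_ge0 ?exprn_ge0.
have [n] := ubnP #|A|; elim: n T A => // n IH T A An sAS sTS dTA.
have [t0|[Y tY]] := set_0Vmem (touching T A).
  exists (xi T); split; first exact: rooted_factor.
  by rewrite t0 cards0 expr0 mulr1 xi_le.
have YA : Y \in A by move: tY; rewrite inE => /andP[].
have YT : Y \notin T by rewrite (disjointFl dTA YA).
have YS : Y \in S by exact: (subsetP sAS).
set B := A :\ Y.
have sBS : B \subset S by exact: subset_trans (subD1set _ _) sAS.
have Bn : (#|B| < n)%N by move: An; rewrite (cardsD1 Y) YA add1n ltnS.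
have dTB : [disjoint T & B] by apply: disjointWr (subD1set _ _) dTA.
have YB : Y \notin B by rewrite setD11.
have [Q1 [Q1E Q1le]] := IH T B Bn sBS sTS dTB.
have sYS : [set Y] \subset S by rewrite sub1set.
have dYB : [disjoint [set Y] & B] by rewrite disjoints1.
have sYT : Y |: T \subset S by rewrite subUset sYS.
have dYTB : [disjoint Y |: T & B].
  rewrite -setI_eq0 setIUl setU_eq0 !setI_eq0 dYB.
  exact: dTB.
have [Q2 [Q2E Q2le]] := IH (Y |: T) B Bn sBS sYT dYTB.
have [E [EE E0 Ele]] := partition_fn_step N_gt0 YA sAS (IH [set Y] B Bn sBS sYS dYB).
(* The numerator is [(Q1 + Q2) * partition_fn B], and the denominator [partition_fn A] is
   [(1 + E) * partition_fn B]. *)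
exists ((Q1 + Q2) * tinv1D N E); split.
  apply: (@teq_trans _ _ ((Q1 + Q2) * partition_fn B)).
    by rewrite (rooted_recursion YA YT) mulrDl; apply: teqD.
  apply: (@teq_trans _ _ ((Q1 + Q2) * ((1 + E) * tinv1D N E * partition_fn B))).
    apply: teqM => //; rewrite -[X in teq X _]mul1r.
    by apply: teqM => //; apply/teq_sym/tinv1DP.
  have -> : (1 + E) * tinv1D N E * partition_fn B =
            tinv1D N E * ((1 + E) * partition_fn B) by ring.
  by rewrite -[X in teq _ X]mulrA; do 2 apply: teqM => //; apply: teq_sym.
apply: le_trans (tnormM _ r_ge0 _ _) _.
have d1 : 0 < 1 - delta by rewrite subr_gt0.
apply: le_trans (ler_wpM2l (tnorm_ge0 _ r_ge0 _) (tnorm_tinv1D r_ge0 delta_lt1 Ele)) _.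
rewrite ler_pdivrMr //; set t := #|touching T A|.
have t_gt0 : (0 < t)%N by apply/card_gt0P; exists Y.
have tB : #|touching T B| = t.-1.
  by rewrite touchingD1 /t (cardsD1 Y (touching T A)) tY.
(* [Q1] contributes the 1. In [Q2] the new root element costs [x] and its neighbours [b ^+ deg],
   together [delta]. The remaining factor [(1 + delta) / (1 - delta)] is at most [b], the price of
   the touched element [Y]. *)
apply: (@le_trans _ _ (x ^+ #|T| * b ^+ t.-1 * (1 + delta))).
  apply: le_trans (tnormD _ _ _ _) _ => //; rewrite mulrDr mulr1 lerD //.
    by rewrite -tB.
  apply: le_trans Q2le _; rewrite cardsU1 YT add1n exprS.
  have -> : x ^+ #|T| * b ^+ t.-1 * delta =
            x * x ^+ #|T| * (b ^+ t.-1 * b ^+ deg) by rewrite /delta; ring.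
  rewrite ler_wpM2l ?mulr_ge0 ?exprn_ge0 // -exprD ler_weXn2l //.
  exact: card_touching_cons.
rewrite -[in leRHS](prednK t_gt0) exprS -!mulrA ler_wpM2l ?exprn_ge0 //.
by rewrite [leRHS]mulrCA ler_wpM2l ?exprn_ge0.
Qed.

(** Removing the elements of [A] one by one telescopes: each step adds one [tlog1D N E], of norm at
    most [delta / (1 - delta)]. Being a logarithm is expressed by the logarithmic derivative, so no
    exponential of polynomials is involved. *)
Lemma partition_fn_log A : A \subset S -> exists l : {poly R[i]},
  [/\ l`_0 = 0, teq (theta (partition_fn A)) (theta l * partition_fn A)
    & tnorm l <= #|A|%:R * (delta / (1 - delta))].
Proof.
have [N0 _|N_gt0] := posnP N.
  exists 0; rewrite coef0 tnorm0; split=> //; first by move=> i; rewrite N0.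
  have d0 : 0 <= delta by rewrite mulr_ge0 ?exprn_ge0 // (le_trans ler01).
  by rewrite mulr_ge0 // divr_ge0 // subr_ge0 ltW.
have [n] := ubnP #|A|; elim: n A => // n IH A An sAS.
have [->|[Y YA]] := set_0Vmem A.
  exists 0; rewrite coef0 tnorm0 cards0 mul0r; split=> //.
  by rewrite partition_fn0 theta1 /theta derivC mulr0 mul0r.
set B := A :\ Y.
have sBS : B \subset S by exact: subset_trans (subD1set _ _) sAS.
have Bn : (#|B| < n)%N by move: An; rewrite (cardsD1 Y) YA add1n ltnS.
have [l [l0 lE lle]] := IH B Bn sBS.
have sYS : [set Y] \subset S by rewrite sub1set (subsetP sAS).
have dYB : [disjoint [set Y] & B] by rewrite disjoints1 setD11.
have [E [EE E0 Ele]] := partition_fn_step N_gt0 YA sAS (rooted_quotient sBS sYS dYB).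
exists (l + tlog1D N E); split.
- rewrite coefD l0 add0r coef_sum big1 // => k _.
  by rewrite coefZ coef_exp_small ?mulr0.
- apply: teq_trans (teq_theta EE) _; rewrite thetaM !thetaD theta1 add0r.
  apply: (@teq_trans _ _ ((theta l + theta E * tinv1D N E) * ((1 + E) * partition_fn B))).
    rewrite [X in teq X _]addrC [X in teq _ X](_ : _ =
      (1 + E) * (theta l * partition_fn B) +
      theta E * ((1 + E) * tinv1D N E * partition_fn B)); last by ring.
    apply: teqD; first exact: teqM.
    apply: teqM => //; rewrite -[X in teq X _]mul1r.
    by apply: teqM => //; apply/teq_sym/tinv1DP.
  by rewrite theta_tlog1D; apply: teqM => //; apply: teq_sym.
- apply: le_trans (tnormD _ r_ge0 _ _) _; rewrite (cardsD1 Y A) YA addrC.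
  by rewrite natrD mulrDl mul1r lerD // tnorm_tlog1D.
Qed.

End ClusterRecursion.

(** * Product operators and operators with a given support *)

Section ProductOperators.
Import fintype boot.finset.
Variables (R : realType) (V : finType) (d : nat).
Local Notation op := (operator R V d).
Implicit Types (b c : V -> 'M[R[i]]_d) (X Y : {set V}) (A B : op).

Definition tens b : op :=
  \matrix_(i, j) \prod_v b v ((enum_val i : config V d) v) ((enum_val j : config V d) v).

Lemma big_config (F : config V d -> R[i]) :
  \sum_(i < #|{: config V d}|) F (enum_val i) = \sum_(s : config V d) F s.
Proof.
rewrite (reindex (@enum_rank {: config V d})) /=; last first.
  by apply: onW_bij; exact: enum_rank_bij.
by apply: eq_bigr => s _; rewrite enum_rankK.
Qed.

Lemma tensM b c : tens b *m tens c = tens (fun v => b v *m c v).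
Proof.
apply/matrixP => i j; rewrite [LHS]mxE [RHS]mxE.
pose F (s : config V d) := \prod_v (b v ((enum_val i : config V d) v) (s v) *
   c v (s v) ((enum_val j : config V d) v)).
transitivity (\sum_(k < #|{: config V d}|) F (enum_val k)).
  by apply: eq_bigr => k _; rewrite !mxE -big_split.
rewrite big_config /F.
rewrite -(bigA_distr_bigA (fun v k => b v ((enum_val i : config V d) v) k *
   c v k ((enum_val j : config V d) v))).
by apply: eq_bigr => v _; rewrite mxE.
Qed.

Lemma tens1 : tens (fun=> 1%:M) = 1%:M.
Proof.
apply/matrixP => i j; rewrite !mxE.
have [->|ij] := eqVneq i j.
  by rewrite big1 // => v _; rewrite mxE eqxx.
have [v vij] : exists v, (enum_val i : config V d) v != (enum_val j : config V d) v.
  apply/existsP; apply: contraR ij => /existsPn h; apply/eqP/enum_val_inj/ffunP => v.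
  by have := h v; rewrite negbK => /eqP.
by rewrite (bigD1 v) //= mxE (negPf vij) mul0r.
Qed.

Lemma trace_tens b : \tr (tens b) = \prod_v \tr (b v).
Proof.
transitivity (\sum_(k < #|{: config V d}|)
    (fun s : config V d => \prod_v b v (s v) (s v)) (enum_val k)).
  by apply: eq_bigr => k _; rewrite mxE.
rewrite (big_config (fun s : config V d => \prod_v b v (s v) (s v))).
by rewrite -(bigA_distr_bigA (fun v k => b v k k)).
Qed.

Lemma eq_tens b c : (forall v, b v = c v) -> tens b = tens c.
Proof.
by move=> bc; apply/matrixP => i j; rewrite !mxE; apply: eq_bigr => v _; rewrite bc.
Qed.

(** The span of the product operators that are trivial outside [X]. As an inductive predicate it
    reduces bilinear statements about local operators to product operators, where they hold spin by
    spin. *)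
Inductive local_op X : op -> Prop :=
| local_tens b of (forall v, v \notin X -> b v = 1%:M) : local_op X (tens b)
| local_0 : local_op X 0
| local_D A B of local_op X A & local_op X B : local_op X (A + B)
| local_Z (a : R[i]) A of local_op X A : local_op X (a *: A).

Lemma local_sum (I : Type) (s : seq I) (P : pred I) (F : I -> op) X :
  (forall i, P i -> local_op X (F i)) -> local_op X (\sum_(i <- s | P i) F i).
Proof.
move=> FX; elim/big_rec: _ => [|i B Pi IH]; first exact: local_0.
by apply: local_D => //; exact: FX.
Qed.

Lemma local_1 X : local_op X 1%:M.
Proof. by rewrite -tens1; apply: local_tens. Qed.

Lemma local_M X A B : local_op X A -> local_op X B -> local_op X (A *m B).
Proof.
elim=> [b bX|XB|A1 A2 _ IH1 _ IH2 XB|a A1 _ IH1 XB].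
- elim=> [c cX||B1 B2 _ IH1 _ IH2|a B1 _ IH1].
  + by rewrite tensM; apply: local_tens => v vX; rewrite bX // cX // mulmx1.
  + by rewrite mulmx0; exact: local_0.
  + by rewrite mulmxDr; exact: local_D.
  + by rewrite -scalemxAr; exact: local_Z.
- by rewrite mul0mx; exact: local_0.
- by rewrite mulmxDl; apply: local_D; [exact: IH1|exact: IH2].
- by rewrite -scalemxAl; apply: local_Z; exact: IH1.
Qed.

Lemma local_X X A n : local_op X A -> local_op X (A ^+ n).
Proof.
by move=> XA; elim: n => [|n IH]; rewrite ?expr0 ?exprS; [exact: local_1|exact: local_M].
Qed.

Lemma localS X Y A : X \subset Y -> local_op X A -> local_op Y A.
Proof.
move=> sXY; elim=> [b bX||A1 A2 _ IH1 _ IH2|a A1 _ IH1].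
- by apply: local_tens => v vY; apply: bX; apply: contra vY; exact: (subsetP sXY).
- exact: local_0.
- exact: local_D.
- exact: local_Z.
Qed.

Lemma prod_delta (I : finType) (P Q : pred I) :
  \prod_(v | P v) (Q v)%:R = [forall v, P v ==> Q v]%:R :> R[i].
Proof.
case: forallP => [h|h].
  by rewrite big1 // => v Pv; have := h v; rewrite Pv /= => ->.
have /existsP[v] : [exists v, ~~ (P v ==> Q v)].
  by rewrite -negb_forall; apply/negP => /forallP.
by rewrite negb_imply => /andP[Pv /negPf nQ]; rewrite (bigD1 v) //= nQ mul0r.
Qed.

(** The matrix on [X] is expanded in matrix units; a matrix unit between configurations is the
    product of the one-spin units [delta_mx], and [extend] fills in identities. *)
Lemma acts_within_local A X : acts_within A X -> local_op X A.
Proof.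
case=> A0 ->.
pose cX := config {v : V | v \in X} d.
pose e (p q : cX) (v : V) : 'M[R[i]]_d :=
  if insub v is Some w then delta_mx (p w) (q w) else 1%:M.
suff -> : extend A0 = \sum_(p : cX) \sum_(q : cX)
    A0 (enum_rank p) (enum_rank q) *: tens (e p q).
  apply: local_sum => p _; apply: local_sum => q _; apply: local_Z.
  by apply: local_tens => v vX; rewrite /e insubN.
apply/matrixP => i j; rewrite mxE summxE.
set s : config V d := enum_val i; set s' : config V d := enum_val j.
have tE (p q : cX) : tens (e p q) i j =
    (restrict_config X s == p)%:R * (restrict_config X s' == q)%:R *
    [forall v in ~: X, s v == s' v]%:R.
  rewrite mxE (bigID (mem X)) /=; congr (_ * _); last first.
    rewrite -/s -/s' -prod_delta big_mkcond [RHS]big_mkcond; apply: eq_bigr => v _.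
    rewrite inE; case: (boolP (v \in X)) => //= vX.
    by rewrite /e insubN // mxE.
  rewrite (reindex_omap (val : {v : V | v \in X} -> V) insub) /=; last first.
    by move=> v vX; rewrite insubT.
  have ffE (f g : cX) : (f == g)%:R = \prod_w (f w == g w)%:R :> R[i].
    rewrite prod_delta; congr (_ %:R); congr nat_of_bool.
    apply/eqP/forallP => [-> w|h]; first by rewrite /= eqxx.
    by apply/ffunP => w; have /eqP := h w.
  rewrite !ffE -big_split /=; apply: eq_big => w.
    by rewrite valK eqxx (valP w).
  by move=> _; rewrite /e valK mxE /restrict_config !ffunE -natrM mulnb.
rewrite /= -/s -/s' (bigD1 (restrict_config X s)) //= [X in X + _]summxE.
rewrite (bigD1 (restrict_config X s')) //= mxE tE !eqxx !mul1r.
rewrite big1 ?addr0 => [|q /negPf q'].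
  rewrite big1 ?addr0 // => p /negPf p'; rewrite summxE big1 // => q _.
  by rewrite mxE tE eq_sym p' !mul0r mulr0.
by rewrite mxE tE [_ == q]eq_sym q' mulr0 !mul0r mulr0.
Qed.

Section ProductState.
Variable r : V -> 'M[R[i]]_d.
Hypothesis tr_r : forall v, \tr (r v) = 1.

Definition expect A : R[i] := \tr (A *m tens r).

Lemma expectD A B : expect (A + B) = expect A + expect B.
Proof. by rewrite /expect mulmxDl mxtraceD. Qed.

Lemma expect0 : expect 0 = 0.
Proof. by rewrite /expect mul0mx mxtrace0. Qed.

Lemma expectZ (a : R[i]) A : expect (a *: A) = a * expect A.
Proof. by rewrite /expect -scalemxAl mxtraceZ. Qed.

Lemma expect_sum (I : Type) (s : seq I) (P : pred I) (F : I -> op) :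
  expect (\sum_(i <- s | P i) F i) = \sum_(i <- s | P i) expect (F i).
Proof. by apply: (big_morph expect expectD expect0). Qed.

Lemma expect_tens b : expect (tens b) = \prod_v \tr (b v *m r v).
Proof. by rewrite /expect tensM trace_tens. Qed.

Lemma expect1 : expect 1%:M = 1.
Proof. by rewrite -tens1 expect_tens big1 // => v _; rewrite mul1mx. Qed.

(** On each spin one of the two factors is the identity, and its trace against the state is 1 by
    [tr_r]. This is where the product form of the state enters. The case of two empty sets is
    included and serves for the empty subsystem. *)
Lemma local_disjoint X Y A B : [disjoint X & Y] -> local_op X A -> local_op Y B ->
  A *m B = B *m A /\ expect (A *m B) = expect A * expect B.
Proof.
move=> dXY; elim=> [b bX|YB|A1 A2 _ IH1 _ IH2 YB|a A1 _ IH1 YB].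
- elim=> [c cY||B1 B2 _ [IH1 E1] _ [IH2 E2]|a B1 _ [IH1 E1]].
  + rewrite !tensM !expect_tens -big_split /=; split.
      apply: eq_tens => v; case: (boolP (v \in X)) => vX.
        by rewrite cY ?mulmx1 ?mul1mx // (disjointFr dXY).
      by rewrite bX // mulmx1 mul1mx.
    apply: eq_bigr => v _; case: (boolP (v \in X)) => vX.
      by rewrite cY ?mulmx1 ?mul1mx ?tr_r ?mulr1 // (disjointFr dXY).
    by rewrite bX // !mul1mx tr_r mul1r.
  + by rewrite mulmx0 mul0mx expect0 mulr0.
  + by rewrite mulmxDr mulmxDl IH1 IH2; split=> //; rewrite -IH1 -IH2 !expectD E1 E2 mulrDr.
  + by rewrite -scalemxAr -scalemxAl IH1; split=> //; rewrite -IH1 !expectZ E1 mulrCA.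
- by rewrite mulmx0 mul0mx expect0 mul0r.
- have [C1 E1] := IH1 YB; have [C2 E2] := IH2 YB.
  by rewrite mulmxDr mulmxDl C1 C2; split=> //; rewrite -C1 -C2 !expectD E1 E2 mulrDl.
- have [C1 E1] := IH1 YB.
  by rewrite -scalemxAr -scalemxAl C1; split=> //; rewrite -C1 !expectZ E1 mulrA.
Qed.

End ProductState.
End ProductOperators.

(** * Density operators and bounds on expectations *)

Section OperatorBounds.
Variable R : realType.
Local Notation nc := (@Normc.normc R).
Implicit Types n m : nat.

Definition adj m n (A : 'M[R[i]]_(m, n)) : 'M[R[i]]_(n, m) := (map_mx conjc A)^T.

Lemma adjM m n p (A : 'M[R[i]]_(m, n)) (B : 'M[R[i]]_(n, p)) :
  adj (A *m B) = adj B *m adj A.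
Proof. by rewrite /adj map_mxM trmx_mul. Qed.

Lemma adjK m n (A : 'M[R[i]]_(m, n)) : adj (adj A) = A.
Proof. by apply/matrixP => i j; rewrite !mxE conjcK. Qed.

Lemma conjcE (x : R[i]) : Num.conj x = conjc x.
Proof. by []. Qed.

(** The square root of the spectral decomposition. The factor turns the trace against a state into a
    sum of quadratic forms, see [bounded_by_trace]. *)
Lemma density_factor n (A : 'M[R[i]]_n) : density_operator A ->
  exists B : 'M[R[i]]_n, A = adj B *m B.
Proof.
case=> Ah Apos _; have /hermitian_normalmx/orthomx_spectralP := Ah.
set P := spectralmx A; set sp := spectral_diag A.
have PU : P \is unitarymx by exact: spectral_unitarymx.
have invE : invmx P = adj P by rewrite invmx_unitary //; apply/matrixP => i j; rewrite !mxE.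
have PP : P *m adj P = 1%:M by rewrite -invE mulmxV ?spectral_unit.
rewrite invE => AE.
have sp_ge0 j : 0 <= sp 0 j.
  have := Apos (adj P *m delta_mx j 0).
  rewrite -/(adj (adj P *m _)) adjM adjK AE -!mulmxA (mulmxA P) PP mul1mx.
  rewrite (mulmxA P) PP mul1mx mul_diag_mx mxE (bigD1 j) //= big1 ?addr0.
    by rewrite !mxE !eqxx conjc1 mul1r mulr1.
  by move=> k /negPf kj; rewrite !mxE kj mulr0 mulr0.
exists (diag_mx (map_mx sqrtC sp) *m P).
rewrite AE adjM !mulmxA; congr (_ *m P); rewrite -mulmxA; congr (_ *m _).
apply/matrixP => i j; rewrite mul_mx_diag !mxE eq_sym.
have [->|ij] := eqVneq j i; last by rewrite !mulr0n conjc0 mul0r.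
rewrite !mulr1n -[conjc _]conjcE conj_Creal ?ger0_real ?sqrtC_ge0 //.
by rewrite -expr2 sqrtCK.
Qed.

Lemma vnorm_ge0 n (v : 'cV[R[i]]_n) : 0 <= vnorm v.
Proof. exact: sqrtr_ge0. Qed.

Lemma vnorm_sqr n (v : 'cV[R[i]]_n) : vnorm v ^+ 2 = \sum_i nc (v i 0) ^+ 2.
Proof. by rewrite sqr_sqrtr // sumr_ge0 // => i _; rewrite sqr_ge0. Qed.

Lemma vnorm_eq0 n (v : 'cV[R[i]]_n) : vnorm v = 0 -> v = 0.
Proof.
move=> v0; have := vnorm_sqr v; rewrite v0 expr0n /= => /esym/eqP.
rewrite psumr_eq0 => [/allP h|i _]; last by rewrite sqr_ge0.
apply/matrixP => i j; rewrite ord1 mxE; apply/eqP.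
by have := h i; rewrite mem_index_enum /= sqrf_eq0 normc_eq0 => ->.
Qed.

Lemma vnormZ n (a : R[i]) (v : 'cV[R[i]]_n) : vnorm (a *: v) = nc a * vnorm v.
Proof.
rewrite -[nc a]ger0_norm ?normc_ge0 // -sqrtr_sqr -sqrtrM ?sqr_ge0 //.
by rewrite mulr_sumr; congr Num.sqrt; apply: eq_bigr => i _; rewrite mxE normcM exprMn.
Qed.

Lemma op_norm1_contraction n (A : 'M[R[i]]_n) : op_norm A = 1 ->
  forall v, vnorm (A *m v) <= vnorm v.
Proof.
move=> A1 v; set E := [set vnorm (A *m v) | v in [set v | vnorm v = 1]]%classic.
(* A set without supremum has [sup] equal to 0, so the value 1 already guarantees that [E] is
   nonempty and bounded. *)
have supE : has_sup E.
  by apply: contrapT => /sup_out; rewrite -/(op_norm A) A1 => /eqP; rewrite oner_eq0.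
have [v0|v0] := eqVneq (vnorm v) 0.
  by rewrite (vnorm_eq0 v0) mulmx0.
have v_gt0 : 0 < vnorm v by rewrite lt_def v0 vnorm_ge0.
have : vnorm (A *m ((vnorm v)^-1%:C *: v)) <= 1.
  rewrite -A1; apply: sup_upper_bound => //.
  exists ((vnorm v)^-1%:C *: v) => //=.
  by rewrite vnormZ normcC ger0_norm ?invr_ge0 ?vnorm_ge0 // mulVf.
rewrite -scalemxAr vnormZ normcC ger0_norm ?invr_ge0 ?vnorm_ge0 //.
by rewrite mulrC ler_pdivrMr // mul1r.
Qed.

Lemma cauchy_schwarz (I : finType) (a b : I -> R) :
  (forall i, 0 <= a i) -> (forall i, 0 <= b i) ->
  \sum_i a i * b i <= Num.sqrt (\sum_i a i ^+ 2) * Num.sqrt (\sum_i b i ^+ 2).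
Proof.
move=> a0 b0.
have [A0 B0] : 0 <= \sum_i a i ^+ 2 /\ 0 <= \sum_i b i ^+ 2.
  by split; apply: sumr_ge0 => i _; rewrite sqr_ge0.
set x := Num.sqrt _; set y := Num.sqrt _.
have xE : x ^+ 2 = \sum_i a i ^+ 2 by rewrite sqr_sqrtr.
have yE : y ^+ 2 = \sum_i b i ^+ 2 by rewrite sqr_sqrtr.
have x_ge0 : 0 <= x by exact: sqrtr_ge0.
have y_ge0 : 0 <= y by exact: sqrtr_ge0.
have [x0|x0] := eqVneq x 0.
  rewrite x0 mul0r big1 // => i _.
  move: xE; rewrite x0 expr0n /= => /esym/eqP; rewrite psumr_eq0 => [/allP h|j _]; last by rewrite sqr_ge0.
  by have := h i; rewrite mem_index_enum /= sqrf_eq0 => /(_ isT)/eqP ->; rewrite mul0r.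
have [y0|y0] := eqVneq y 0.
  rewrite y0 mulr0 big1 // => i _.
  move: yE; rewrite y0 expr0n /= => /esym/eqP; rewrite psumr_eq0 => [/allP h|j _]; last by rewrite sqr_ge0.
  by have := h i; rewrite mem_index_enum /= sqrf_eq0 => /(_ isT)/eqP ->; rewrite mulr0.
have xy : 0 < 2 * (x * y) by rewrite !mulr_gt0 // lt_def ?x0 ?y0.
rewrite -(ler_pM2l xy).
have : 0 <= \sum_i (y * a i - x * b i) ^+ 2 by apply: sumr_ge0 => i _; rewrite sqr_ge0.
have -> : \sum_i (y * a i - x * b i) ^+ 2 =
    y ^+ 2 * x ^+ 2 + x ^+ 2 * y ^+ 2 - 2 * (x * y) * (\sum_i a i * b i).
  rewrite {1}xE {2}yE !mulr_sumr -big_split /= -sumrB; apply: eq_bigr => i _; ring.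
by rewrite subr_ge0 => /le_trans; apply; rewrite -subr_ge0 le_eqVlt; apply/orP; left; apply/eqP; ring.
Qed.

(** Through the sesquilinear form the operator norm is bounded by [K] without a supremum, and such
    bounds add up over sums of words. *)
Definition bounded_by n (A : 'M[R[i]]_n) (K : R) :=
  forall u v : 'cV[R[i]]_n, nc ((adj u *m A *m v) 0 0) <= K * (vnorm u * vnorm v).

Lemma bounded_by1 n : bounded_by (1%:M : 'M[R[i]]_n) 1.
Proof.
move=> u v; rewrite mulmx1 mul1r mxE; apply: le_trans (normc_sum _ _ _) _.
apply: le_trans (cauchy_schwarz (fun i => normc_ge0 (u i 0)) (fun i => normc_ge0 (v i 0))).
apply: ler_sum => i _; rewrite !mxE normcM ler_wpM2r ?normc_ge0 //.
by rewrite -lecR -!normcE normcJ.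
Qed.

Lemma bounded_by0 n : bounded_by (0 : 'M[R[i]]_n) 0.
Proof. by move=> u v; rewrite mulmx0 mul0mx mxE Normc.normc0 mul0r. Qed.

Lemma bounded_byD n (A B : 'M[R[i]]_n) K K' :
  bounded_by A K -> bounded_by B K' -> bounded_by (A + B) (K + K').
Proof.
move=> AK BK u v; rewrite mulmxDr mulmxDl mxE mulrDl.
by apply: le_trans (normcD _ _) _; rewrite lerD.
Qed.

Lemma bounded_by_sum (I : Type) (s : seq I) (P : pred I) n
    (F : I -> 'M[R[i]]_n) (K : I -> R) :
  (forall i, P i -> bounded_by (F i) (K i)) ->
  bounded_by (\sum_(i <- s | P i) F i) (\sum_(i <- s | P i) K i).
Proof.
move=> FK; elim/big_rec2: _ => [|i A L Pi IH]; first exact: bounded_by0.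
by apply: bounded_byD => //; exact: FK.
Qed.

Lemma bounded_by_contraction n (A B : 'M[R[i]]_n) K (a : R[i]) : 0 <= K ->
  bounded_by A K -> (forall v, vnorm (B *m v) <= vnorm v) -> nc a <= 1 ->
  bounded_by (A *m (a *: B)) K.
Proof.
move=> K0 AK BC a1 u v; rewrite -scalemxAr -scalemxAr -scalemxAl mxE normcM.
apply: (@le_trans _ _ (1 * nc ((adj u *m A *m (B *m v)) 0 0))).
  by rewrite !mulmxA ler_wpM2r ?normc_ge0.
rewrite mul1r; apply: le_trans (AK _ _) _.
by rewrite ler_wpM2l // ler_wpM2l ?vnorm_ge0.
Qed.

(** The trace is the sum of the form of [A] over the columns of [adj B], whose squared norms add up
    to [\tr (adj B *m B) = 1]. *)
Lemma bounded_by_trace n (A B : 'M[R[i]]_n) K : bounded_by A K ->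
  \tr (adj B *m B) = 1 -> nc (\tr (A *m (adj B *m B))) <= K.
Proof.
move=> AK trB; rewrite mulmxA mxtrace_mulC mulmxA.
have rowE i : (B *m A *m adj B) i i = (adj (col i (adj B)) *m A *m col i (adj B)) 0 0.
  have -> : adj (col i (adj B)) = row i B.
    by apply/matrixP => j k; rewrite !mxE conjcK.
  rewrite -row_mul [LHS]mxE [RHS]mxE; apply: eq_bigr => j _.
  by rewrite [row _ _ _ _]mxE [col _ _ _ _]mxE.
apply: le_trans (normc_sum _ _ _) _.
apply: (@le_trans _ _ (\sum_i K * vnorm (col i (adj B)) ^+ 2)).
  by apply: ler_sum => i _; rewrite rowE expr2; exact: AK.
rewrite -mulr_sumr (_ : \sum_i _ = 1) ?mulr1 //.
have sqrE (x : R[i]) : (nc x ^+ 2)%:C = x * conjc x.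
  by rewrite rmorphXn -sqr_normc normcE.
apply: complexI; rewrite rmorph_sum -[RHS]trB mxtrace_mulC.
apply: eq_bigr => i _; rewrite vnorm_sqr rmorph_sum mxE.
apply: eq_bigr => j _; apply: etrans (sqrE _) _; rewrite [col _ _ _ _]mxE mulrC.
by rewrite /adj [_^T j i]mxE mxE conjcK.
Qed.

End OperatorBounds.

(** * Logarithmic derivative of a power series and the trace series *)

Section FormalLog.
Variable F : fieldType.
Implicit Types z e : nat -> F.

(** Coefficient [m] needs all earlier ones, so stage [n] carries every coefficient below [n]:
    course-of-values recursion in structural form. *)
Fixpoint log_upto z n : nat -> F :=
  if n is m.+1 then fun k =>
    if k == m then z m *+ m - \sum_(j < m) log_upto z m j * z (m - j)%N
    else log_upto z m k
  else fun=> 0.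

(* The coefficients e of X * Z' / Z, where Z is the power series with
   coefficients z and z 0 = 1. *)
Definition dlog z n : F := log_upto z n.+1 n.

(** Dividing by the degree integrates X * Z' / Z to log Z. At [n = 0] the convention [0^-1 = 0]
    gives the right constant term, log 1 = 0. *)
Definition flog z n : F := dlog z n / n%:R.

Lemma log_uptoE z n k : (k < n)%N -> log_upto z n k = dlog z k.
Proof.
elim: n => // n IH; rewrite ltnS leq_eqVlt => /predU1P[->//|kn] /=.
by rewrite ltn_eqF // IH.
Qed.

Lemma dlogE z n : dlog z n = z n *+ n - \sum_(j < n) dlog z j * z (n - j)%N.
Proof.
rewrite {1}/dlog /= eqxx; congr (_ - _); apply: eq_bigr => j _.
by rewrite log_uptoE.
Qed.

Lemma dlog0 z : dlog z 0 = 0.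
Proof. by rewrite dlogE mulr0n big_ord0 subr0. Qed.

Lemma dlogP z n : z 0%N = 1 -> \sum_(j < n.+1) dlog z j * z (n - j)%N = z n *+ n.
Proof.
by move=> z0; rewrite big_ord_recr /= subnn z0 mulr1 [dlog z n]dlogE addrC subrK.
Qed.

(** The system is triangular with diagonal entry [z 0 = 1]. It identifies the logarithm found by the
    cluster recursion, that of a product and that of an exponential. *)
Lemma dlog_unique z e N : z 0%N = 1 ->
  (forall n, (n < N)%N -> \sum_(j < n.+1) e j * z (n - j)%N = z n *+ n) ->
  forall n, (n < N)%N -> e n = dlog z n.
Proof.
move=> z0 eP n; have [m] := ubnP n; elim: m n => // m IH n nm nN.
have := eP n nN; rewrite big_ord_recr /= subnn z0 mulr1 dlogE => <-.
rewrite addrAC (eq_bigr (fun j : 'I_n => dlog z j * z (n - j)%N)) ?subrr ?add0r //.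
move=> j _; rewrite IH //; first exact: leq_trans (ltn_ord j) _.
exact: ltn_trans (ltn_ord j) nN.
Qed.

End FormalLog.

(** * Counting words with a given set of letters *)

Section Surjections.
Variable R : realType.

(* The number of surjections from an n-set onto a k-set. *)
Fixpoint nsurj n k : nat :=
  if n is m.+1 then (k * (nsurj m k + nsurj m k.-1))%N else (k == 0%N).

(** Choose a preimage of every letter, in n! / (n - k)! ways, and map the remaining n - k points
    freely: every surjection arises. The division is multiplied out. *)
Lemma nsurj_le n k : if (n < k)%N then nsurj n k = 0%N
  else (nsurj n k * (n - k)`! <= n`! * k ^ (n - k))%N.
Proof.
elim: n k => [|n IH] [|k] //=.
case: ifP => nk.
  have := IH k.+1; rewrite ifT; last by lia.
  have := IH k; rewrite ifT; last by lia.
  by move=> -> ->; rewrite muln0.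
have [nk1|kn] := eqVneq n k.
  subst k; have := IH n.+1; rewrite ltnSn => ->.
  have := IH n; rewrite ltnn !subnn !expn0 !muln1 factS add0n => h.
  by rewrite leq_mul2l h orbT.
have kn' : (k < n)%N by lia.
have := IH k.+1; rewrite ifF; last by lia.
have := IH k; rewrite ifF; last by lia.
have -> : (n - k = (n - k.+1).+1)%N by lia.
have -> : (n.+1 - k.+1 = (n - k.+1).+1)%N by lia.
set m := (n - k.+1)%N => h1 h2.
rewrite !factS in h1 *.
have hk : (k ^ m.+1 <= k.+1 ^ m.+1)%N by rewrite leq_exp2r.
have nE : n.+1 = (m.+1 + k.+1)%N by rewrite /m; lia.
rewrite mulnDr mulnDl.
apply: (@leq_trans (m.+1 * (n`! * k.+1 ^ m.+1) + k.+1 * (n`! * k.+1 ^ m.+1))).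
  apply: leq_add.
    rewrite expnS [X in (_ <= _ * X)%N]mulnCA.
    have -> : (k.+1 * nsurj n k.+1 * (m.+1 * m`!) = m.+1 * (k.+1 * (nsurj n k.+1 * m`!)))%N by ring.
    by rewrite leq_mul2l /= leq_mul2l h2 orbT.
  rewrite -mulnA leq_mul2l /=; apply: leq_trans h1 _.
  by rewrite leq_mul2l hk orbT.
by rewrite nE -mulnDl mulnA.
Qed.

Lemma exp_partial_le (y : R) n : 0 <= y -> \sum_(i < n) y ^+ i / i`!%:R <= expR y.
Proof.
move=> y0; rewrite -(big_mkord predT (fun i => y ^+ i / i`!%:R)) /=.
apply: (@nondecreasing_cvgn_le _ (series (exp_coeff y))); last exact: is_cvg_series_exp_coeff.
by apply: nondecreasing_series => k _ _; exact: exp_coeff_ge0.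
Qed.

(** The full generating function is (e^r - 1)^k. With n = k + m, the bound on the coefficients sums
    to r^k times the series of e^(k r). *)
Lemma nsurj_egf_le (r : R) N k : 0 <= r ->
  \sum_(n < N) r ^+ n * ((nsurj n k)%:R / n`!%:R) <= (r * expR r) ^+ k.
Proof.
move=> r0; have fact_neq0 m : m`!%:R != 0 :> R by rewrite pnatr_eq0 -lt0n fact_gt0.
have -> : (r * expR r) ^+ k = r ^+ k * expR (k%:R * r).
  by rewrite exprMn -expRM_natl.
apply: le_trans (ler_wpM2l (exprn_ge0 k r0) (exp_partial_le N (mulr_ge0 (ler0n _ k) r0))).
rewrite mulr_sumr.
apply: (@le_trans _ _ (\sum_(n < N | (k <= n)%N)
   (fun m => r ^+ k * ((k%:R * r) ^+ m / m`!%:R)) (n - k)%N)).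
  rewrite (bigID (fun n : 'I_N => (k <= n)%N)) /= [X in _ + X]big1 ?addr0; last first.
    move=> n; rewrite -ltnNge => nk; have := nsurj_le n k; rewrite nk => ->.
    by rewrite mul0r mulr0.
  apply: ler_sum => n kn.
  have := nsurj_le n k; rewrite ltnNge kn /= => h.
  have -> : r ^+ k * ((k%:R * r) ^+ (n - k) / (n - k)`!%:R) =
    r ^+ n * (k%:R ^+ (n - k) / (n - k)`!%:R).
    by rewrite exprMn -[in r ^+ n](subnKC kn) exprD; ring.
  rewrite ler_wpM2l ?exprn_ge0 // ler_pdivrMr ?ltr0n ?fact_gt0 //.
  rewrite mulrAC ler_pdivlMr ?ltr0n ?fact_gt0 //.
  by rewrite -natrX -!natrM ler_nat [leqRHS]mulnC.
apply: (@sum_shift_le _ N (fun m => r ^+ k * ((k%:R * r) ^+ m / m`!%:R))) => m.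
rewrite mulr_ge0 ?exprn_ge0 //.
by rewrite mulr_ge0 ?exprn_ge0 ?mulr_ge0 // invr_ge0.
Qed.

End Surjections.

Section TraceSeries.
Import fintype boot.finset.
Variables (R : realType) (V : finType) (d : nat).
Local Notation op := (operator R V d).
Local Notation nc := (@Normc.normc R).
Variables (S : {set {set V}}) (h : {set V} -> op) (rv : V -> 'M[R[i]]_d).
Hypothesis h_local : forall X, X \in S -> local_op X (h X).
Hypothesis h_contr : forall X, X \in S -> forall v, vnorm (h X *m v) <= vnorm v.
Hypothesis rv_density : forall v, density_operator (rv v).
Implicit Types (A T U : {set {set V}}) (X Y : {set V}) (l : {set V} -> R).
Local Notation ham A l := (hamiltonian A l h).
Local Notation tau := (expect rv).

Let tr_rv v : \tr (rv v) = 1.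
Proof. by case: (rv_density v). Qed.

Lemma expect_le (B : op) K : bounded_by B K -> nc (tau B) <= K.
Proof.
move=> BK; have [a aE] : exists a : V -> 'M[R[i]]_d, forall v, rv v = adj (a v) *m a v.
  by have /choice[a aE] := fun v => density_factor (rv_density v); exists a.
have rE : tens rv = adj (tens a) *m tens a.
  have -> : adj (tens a) = tens (fun v => adj (a v)).
    apply/matrixP => i j; rewrite !mxE rmorph_prod; apply: eq_bigr => v _.
    by rewrite !mxE.
  by rewrite tensM; apply: eq_tens.
rewrite /expect rE; apply: bounded_by_trace => //.
by rewrite -rE trace_tens big1.
Qed.

(* The sum of the products l_w h_w over the words w of length n whose set of
   letters is exactly T. *)
Fixpoint word_sum l n T : op :=
  if n is m.+1 then
    \sum_(X in T) (word_sum l m T + word_sum l m (T :\ X)) *m ((l X)%:C *: h X)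
  else if T == set0 then 1%:M else 0.

Lemma word_sum_ham l n A : \sum_(U : {set {set V}} | U \subset A) word_sum l n U = ham A l ^+ n.
Proof.
elim: n => [|n IH].
  rewrite (bigD1 set0) ?sub0set //= eqxx big1 ?addr0 // => U /andP[_ /negPf ->] //.
rewrite /= exprSr -IH [RHS]mulr_sumr.
rewrite (exchange_big_dep (fun X => X \in A)) /=; last first.
  by move=> U X sUA XU; exact: (subsetP sUA).
apply: eq_bigr => X XA; rewrite -mulmx_suml; congr (_ *m _).
(* For a fixed last letter [X] the rest of the word has letter set [U] or [U :\ X]. Over all [U]
   containing [X] these run through every subset of [A] once. *)
pose F U := if X \in U then word_sum l n U + word_sum l n (U :\ X) else 0.
have -> : \sum_(U : {set {set V}} | (U \subset A) && (X \in U))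
    (word_sum l n U + word_sum l n (U :\ X)) = \sum_(U : {set {set V}} | U \subset A) F U.
  by rewrite big_mkcondr.
rewrite -{1 2}(setD1K XA) !big_subset_setU1 ?setD11 // [X in X + _]big1 ?add0r; last first.
  move=> U sU; rewrite /F ifF //; apply/negP => XU.
  by have := subsetP sU _ XU; rewrite setD11.
rewrite [in LHS]/F; under eq_bigr => U sU.
  rewrite setU11 setU1K; last by apply/negP => XU; have := subsetP sU _ XU; rewrite setD11.
  over.
by rewrite big_split addrC.
Qed.

(** Each of the [nsurj n #|T|] words is a product of contractions, and the recursion of [word_sum]
    is that of [nsurj]. *)
Lemma word_sum_bounded l n T : T \subset S -> (forall X, X \in S -> `|l X| <= 1) ->
  bounded_by (word_sum l n T) (nsurj n #|T|)%:R.
Proof.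
move=> + l1; elim: n T => [|n IH] T sTS /=.
  rewrite cards_eq0; case: eqP => _; [exact: bounded_by1|exact: bounded_by0].
have -> : (#|T| * (nsurj n #|T| + nsurj n #|T|.-1))%:R =
    \sum_(X in T) ((nsurj n #|T|)%:R + (nsurj n #|T|.-1)%:R) :> R.
  by rewrite sumr_const -natrD -mulrnA mulnC.
apply: bounded_by_sum => X XT.
have XS : X \in S by exact: (subsetP sTS).
apply: bounded_by_contraction; rewrite ?addr_ge0 ?ler0n //.
- apply: bounded_byD; first exact: IH.
  have -> : #|T|.-1 = #|T :\ X| by rewrite (cardsD1 X T) XT.
  by apply: IH; apply: subset_trans (subD1set _ _) sTS.
- exact: h_contr.
- by rewrite normcC l1.
Qed.

Definition trace_coef A l n : R[i] := (- 'i) ^+ n / n`!%:R * tau (ham A l ^+ n).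

Lemma trace_coef0 A l : trace_coef A l 0 = 1.
Proof. by rewrite /trace_coef expr0 expr0 fact0 invr1 !mul1r expect1. Qed.

Lemma ham_local A l : A \subset S -> local_op (cover A) (ham A l).
Proof.
move=> sAS; apply: local_sum => X XA; apply: local_Z.
by apply: localS (h_local (subsetP sAS _ XA)); apply: bigcup_sup.
Qed.

(** The two Hamiltonians act on disjoint sets of spins, hence commute: the binomial formula applies,
    the expectation factorizes, and ['C(n, j)] splits the factorial between the two factors. *)
Lemma trace_coefU T A l n : T \subset S -> A \subset S -> [disjoint T & A] ->
  (forall X Y, X \in T -> Y \in A -> X :&: Y = set0) ->
  trace_coef (T :|: A) l n =
  \sum_(j < n.+1) trace_coef T l j * trace_coef A l (n - j)%N.
Proof.
move=> sTS sAS dTA TA0.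
have dc : [disjoint cover T & cover A].
  rewrite -setI_eq0; apply/eqP/setP => v; rewrite !inE; apply/negP.
  move=> /andP[/bigcupP[X XT vX] /bigcupP[Y YA vY]].
  by have /setP/(_ v) := TA0 X Y XT YA; rewrite !inE vX vY.
have [C0 _] := local_disjoint tr_rv dc (ham_local l sTS) (ham_local l sAS).
rewrite /trace_coef.
have -> : ham (T :|: A) l = ham A l + ham T l.
  by rewrite addrC /hamiltonian -bigU //; apply: eq_bigl => X; rewrite inE.
rewrite exprDn_comm; last by rewrite /GRing.comm; exact: esym.
rewrite expect_sum mulr_sumr; apply: eq_bigr => j _.
have [C1 E1] := local_disjoint tr_rv dc (local_X j (ham_local l sTS)) (local_X (n - j) (ham_local l sAS)).
rewrite -[_ *+ 'C(n, j)](@scaler_nat R[i]) expectZ.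
have -> : tau (ham A l ^+ (n - j) * ham T l ^+ j) = tau (ham T l ^+ j) * tau (ham A l ^+ (n - j)).
  by rewrite -E1; congr tau; exact: esym.
have jn : (j <= n)%N by rewrite -ltnS.
have f0 m : m`!%:R != 0 :> R[i] by rewrite pnatr_eq0 -lt0n fact_gt0.
have -> : 'C(n, j)%:R = n`!%:R / (j`!%:R * (n - j)`!%:R) :> R[i].
  by rewrite -(bin_fact jn) natrM natrM mulfK // mulf_neq0.
by rewrite -[in (- 'i) ^+ n](subnKC jn) exprD; field; rewrite !f0.
Qed.

End TraceSeries.

(** * The radius of convergence *)

Section Radius.
Variable R : realType.

Definition cluster_radius (D : R) : R := 1 / (2 * expR 1 ^+ 2 * D * (D + 1)).

Lemma cluster_radius_gt0 (D : R) : 1 <= D -> 0 < cluster_radius D.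
Proof.
move=> D_ge1; have D_gt0 : 0 < D by exact: lt_le_trans D_ge1.
by rewrite divr_gt0 // !mulr_gt0 ?exprn_gt0 ?expR_gt0 // addr_gt0.
Qed.

(* b ^+ m <= e, so delta <= r e^2 = 1 / (2 m (m + 1)); this is where the
   constant of the theorem comes from. *)
Lemma cluster_radius_bounds (m : nat) : (1 <= m)%N ->
  let r : R := cluster_radius m%:R in
  let b : R := 1 + m%:R^-1 in
  let delta := r * expR r * b ^+ m in
  [/\ delta <= 1 / 2, 1 + delta <= b * (1 - delta) & 1 <= b].
Proof.
move=> m_ge1 r b; have : 1 <= m%:R :> R by rewrite ler1n.
have : b ^+ m <= expR 1.
  apply: (@le_trans _ _ (expR m%:R^-1 ^+ m)).
    apply: lerXn2r; last exact: expR_ge1Dx.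
      by rewrite nnegrE addr_ge0.
    by rewrite nnegrE expR_ge0.
  by rewrite -expRM_natl mulfV // pnatr_eq0 -lt0n.
rewrite /b /r; move: (m%:R : R) => D {r b} bX D_ge1; set b := 1 + D^-1 in bX *.
set r := cluster_radius D.
have D_gt0 : 0 < D by exact: lt_le_trans D_ge1.
have r_gt0 : 0 < r by exact: cluster_radius_gt0.
have e_gt0 : 0 < expR 1 :> R by exact: expR_gt0.
have b_ge1 : 1 <= b by rewrite lerDl invr_ge0 ltW.
pose q : R := 2 * D * (D + 1).
have q_ge4 : 4 <= q by rewrite /q; nra.
have q_gt0 : 0 < q by exact: lt_le_trans q_ge4.
have rE : r = (q * expR 1 ^+ 2)^-1.
  by rewrite /r /cluster_radius /q div1r; congr _^-1; ring.
have r_le1 : r <= 1.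
  have q1 : 1 <= q * expR 1 ^+ 2.
    rewrite mulr_ege1 ?exprn_ege1 //; first by apply: le_trans q_ge4; rewrite ler1n.
    by rewrite (le_trans _ (expR_ge1Dx 1)) // lerDl.
  by rewrite rE invf_le1 // (lt_le_trans _ q1).
have delta_le : r * expR r * b ^+ m <= q^-1.
  apply: (@le_trans _ _ (r * expR 1 * expR 1)).
    apply: ler_pM => //; first by rewrite mulr_ge0 ?expR_ge0 // ltW.
      by rewrite exprn_ge0 // (le_trans ler01).
    by apply: ler_wpM2l; [exact: ltW|rewrite ler_expR].
  by rewrite rE invfM -!mulrA -expr2 mulVf ?mulr1 // gt_eqF ?exprn_gt0.
have delta_ge0 : 0 <= r * expR r * b ^+ m.
  by rewrite mulr_ge0 ?exprn_ge0 ?(le_trans ler01 b_ge1) // mulr_ge0 ?expR_ge0 // ltW.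
move: (r * expR r * b ^+ m) delta_le delta_ge0 => delta delta_le delta_ge0.
have dq : delta * q <= 1 by rewrite -ler_pdivlMr // div1r.
split=> //.
  rewrite ler_pdivlMr //; apply: le_trans dq; rewrite ler_wpM2l //.
  by apply: le_trans q_ge4; rewrite ler_nat.
rewrite -(ler_pM2l D_gt0).
have -> : D * (b * (1 - delta)) = (D + 1) * (1 - delta).
  by rewrite /b mulrA; congr (_ * _); rewrite mulrDr mulr1 mulfV // gt_eqF.
(* Multiplied by [D], the claim is [delta * (2 * D + 1) <= 1]. It follows from [delta * q <= 1],
   because [q - (2 * D + 1) = 2 * D ^+ 2 - 1] is nonnegative. *)
apply: (@le_trans _ _ (D + 1 - delta * (D + 1) + (delta * q - 1))); last first.
  by rewrite -[leRHS]addr0 mulrBr mulr1 [(D + 1) * delta]mulrC lerD2l subr_le0.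
rewrite /q -subr_ge0 (_ : _ - _ = delta * (2 * D ^+ 2 - 1)); last by ring.
by rewrite mulr_ge0 // subr_ge0 mulr_ege1 ?exprn_ege1 // ler1n.
Qed.

End Radius.

(** * Bound on the Taylor coefficients of log L *)

Section Majorant.
Import fintype boot.finset.
Variables (R : realType) (V : finType) (d : nat).
Local Notation op := (operator R V d).
Local Notation nc := (@Normc.normc R).
Variables (S : {set {set V}}) (h : {set V} -> op) (rv : V -> 'M[R[i]]_d).
Hypothesis h_local : forall X, X \in S -> local_op X (h X).
Hypothesis h_contr : forall X, X \in S -> forall v, vnorm (h X *m v) <= vnorm v.
Hypothesis rv_density : forall v, density_operator (rv v).
Variable l : {set V} -> R.
Hypothesis l_le1 : forall X, X \in S -> `|l X| <= 1.

Let overlap : rel {set V} := fun X Y => X :&: Y != set0.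

Definition weight N (T : {set {set V}}) : {poly R[i]} :=
  \poly_(n < N) ((- 'i) ^+ n / n`!%:R * expect rv (word_sum h l n T)).

Lemma partition_weightE N A :
  partition_fn (weight N) A = \poly_(n < N) trace_coef h rv A l n.
Proof.
apply/polyP => n; rewrite coef_sum coef_poly; case: ifP => nN; last first.
  by apply: big1 => U _; rewrite coef_poly nN.
rewrite /trace_coef -word_sum_ham expect_sum mulr_sumr; apply: eq_bigr => U _.
by rewrite coef_poly nN.
Qed.

Lemma partition_weight_coef N A n : (n < N)%N ->
  (partition_fn (weight N) A)`_n = trace_coef h rv A l n.
Proof. by move=> nN; rewrite partition_weightE coef_poly nN. Qed.

Lemma word_sum_set0 n : word_sum h l n set0 = if n is 0%N then 1%:M else 0.
Proof. by case: n => [|n] /=; rewrite ?eqxx // big_set0. Qed.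

Lemma weight0 N : weight N.+1 set0 = 1.
Proof.
apply/polyP => n; rewrite coef_poly word_sum_set0 coef1; case: n => [|n] /=.
  by rewrite expr0 fact0 invr1 !mul1r expect1 // => v; case: (rv_density v).
by rewrite expect0 mulr0 if_same.
Qed.

Lemma weight_coef0 N (T : {set {set V}}) : T != set0 -> (weight N T)`_0 = 0.
Proof.
move=> /negPf T0; rewrite coef_poly /= T0 expect0 mulr0 if_same //.
Qed.

Lemma weight_le N (r : R) (T : {set {set V}}) : 0 <= r -> T \subset S ->
  tnorm N r (weight N T) <= (r * expR r) ^+ #|T|.
Proof.
move=> r0 sTS; apply: le_trans (nsurj_egf_le N #|T| r0).
apply: ler_sum => n _; rewrite coef_poly ltn_ord mulrC.
rewrite ler_wpM2l ?exprn_ge0 // !normcM normcX normc_i expr1n mul1r normcV normc_natr.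
rewrite mulrC ler_wpM2r ?invr_ge0 ?ler0n //.
by apply: expect_le => //; exact: (word_sum_bounded h_contr).
Qed.

(** The right-hand side does not depend on [N]: this one estimate gives the convergence of log L,
    and with it the absence of zeros and the truncation error. *)
Lemma log_coef_sum_le N : (1 <= max_degree S)%N ->
  \sum_(n < N) nc (flog (trace_coef h rv S l) n) *
    cluster_radius (max_degree S)%:R ^+ n <= #|S|%:R.
Proof.
move=> deg_ge1; set r := cluster_radius _.
have r_gt0 : 0 < r by rewrite cluster_radius_gt0 // ler1n.
have [delta_half delta_b b_ge1] := cluster_radius_bounds R deg_ge1.
have x_ge0 : 0 <= r * expR r by rewrite mulr_ge0 ?expR_ge0 // ltW.
have delta_lt1 : r * expR r * (1 + (max_degree S)%:R^-1) ^+ max_degree S < 1.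
  by apply: le_lt_trans delta_half _; rewrite ltr_pdivrMr // mul1r ltr1n.
have degP Y : Y \in S ->
    (#|[set Z in S | (Z != Y) && overlap Y Z]| <= max_degree S)%N.
  move=> YS; exact: (@leq_bigmax_cond _ (mem S) (fun X =>
    #|[set Z in S | (Z != X) && (X :&: Z != set0)]|) Y YS).
have part_U (T A : {set {set V}}) : T \subset S -> A \subset S -> [disjoint T & A] ->
    touching overlap T A = set0 ->
    teq N.+1 (partition_fn (weight N.+1) (T :|: A))
      (partition_fn (weight N.+1) T * partition_fn (weight N.+1) A).
  move=> sTS sAS dTA tTA n nN; rewrite coefM (partition_weight_coef _ nN).
  rewrite (trace_coefU h_local rv_density) //; last first.
    move=> X Y XT YA; apply/eqP; apply: contraT => XY.
    have /setP/(_ Y) := tTA; rewrite !inE YA /= => /negbT/existsPn/(_ X).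
    by rewrite /overlap XT XY.
  apply: eq_bigr => j _; have jn : (j <= n)%N by rewrite -ltnS.
  by rewrite !partition_weight_coef // ?(leq_ltn_trans jn nN) // (leq_ltn_trans (leq_subr _ _) nN).
(* The order is [N.+1], since at order 0 the truncated weight of the empty set would be 0 instead of
   1. *)
have [e [e0 eE ele]] := partition_fn_log (ltW r_gt0)
  (fun T => weight_le N.+1 (ltW r_gt0)) (weight0 N)
  (@weight_coef0 N.+1) part_U degP x_ge0 b_ge1 delta_lt1 delta_b (subxx S).
have flogE n : (n < N.+1)%N -> flog (trace_coef h rv S l) n = e`_n.
  move=> nN; rewrite /flog -(@dlog_unique _ _ (fun j => e`_j *+ j) N.+1) //.
  - case: n nN => [|n] _; first by rewrite e0 mul0rn mul0r.
    by rewrite -[X in X / _]mulr_natr mulfK // pnatr_eq0.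
  - by apply: trace_coef0 => v; exact: rv_density.
  - move=> m mN; have := eE m mN.
    rewrite coef_theta coefM (partition_weight_coef _ mN) => ->.
    apply: eq_bigr => j _; have jm : (j <= m)%N by rewrite -ltnS.
    by rewrite coef_theta partition_weight_coef // (leq_ltn_trans (leq_subr _ _) mN).
apply: (@le_trans _ _ (tnorm N.+1 r e)).
  rewrite /tnorm big_ord_recr /= -[leLHS]addr0 lerD //.
    by apply: ler_sum => n _; rewrite flogE // ltnW // ltnS.
  by rewrite mulr_ge0 ?normc_ge0 ?exprn_ge0 // ltW.
(* [delta <= 1 / 2] makes [delta / (1 - delta)] at most 1, so each element of [S] contributes at
   most 1. *)
apply: le_trans ele _; rewrite -[leRHS]mulr1 ler_wpM2l //.
rewrite ler_pdivrMr ?subr_gt0 // mul1r; move: delta_half; rewrite -/r.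
move: (_ * _ ^+ _) => z zh.
by rewrite lerBrDr (le_trans (lerD zh zh)) // -splitr.
Qed.

End Majorant.

(** * Complex series and power series *)

Section ComplexSeries.
Local Open Scope classical_set_scope.
Variable R : realType.
Local Notation nc := (@Normc.normc R).
Implicit Types (u v : nat -> R[i]) (s : R[i]).

(** Convergence is stated through the modulus, a real sequence, so that series in [R[i]] only
    involve limits in [R]. *)
Definition csum u s : Prop := (fun n => nc (\sum_(i < n) u i - s)) @ \oo --> (0 : R).

Lemma csumP u s : csum u s <->
  forall eps : R, 0 < eps -> \forall n \near \oo, nc (\sum_(i < n) u i - s) <= eps.
Proof.
rewrite /csum cvgrPdist_le; split=> h eps e0; have := h eps e0.
  by apply: filterS => n; rewrite sub0r normrN ger0_norm ?normc_ge0.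
by apply: filterS => n; rewrite sub0r normrN ger0_norm ?normc_ge0.
Qed.

Lemma le_eps_mul (a c : R) : 0 <= c -> (forall eps : R, 0 < eps -> a <= c * eps) -> a <= 0.
Proof.
move=> c0 h; rewrite leNgt; apply/negP => a0.
have c1 : 0 < c + 1 by rewrite ltr_wpDl.
have := h (a / (c + 1)) (divr_gt0 a0 c1).
rewrite mulrA ler_pdivlMr // mulrDr mulr1 [c * a]mulrC gerDl leNgt.
by rewrite a0.
Qed.

Lemma csum_unique u s s' : csum u s -> csum u s' -> s = s'.
Proof.
move=> /csumP us /csumP us'; apply/eqP; rewrite -subr_eq0 -normc_eq0.
rewrite eq_le normc_ge0 andbT; apply: (@le_eps_mul _ 2) => // eps e0.
near \oo => n.
have -> : s - s' = (\sum_(i < n) u i - s') - (\sum_(i < n) u i - s) by ring.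
apply: le_trans (normcD _ _) _; rewrite normcN mulr_natl mulr2n lerD //.
  by near: n; exact: us'.
by near: n; exact: us.
Unshelve. all: by end_near. Qed.

Lemma csum_le u s (K : R) : csum u s -> (forall n, \sum_(i < n) nc (u i) <= K) -> nc s <= K.
Proof.
move=> /csumP us uK; rewrite -subr_le0; apply: (@le_eps_mul _ 1) => // eps e0.
near \oo => n; rewrite mul1r lerBlDl.
have -> : s = \sum_(i < n) u i - (\sum_(i < n) u i - s) by ring.
apply: le_trans (normcD _ _) _; rewrite normcN lerD //.
  exact: le_trans (normc_sum _ _ _) (uK n).
by near: n; exact: us.
Unshelve. all: by end_near. Qed.

Lemma csumD u v s s' : csum u s -> csum v s' -> csum (fun n => u n + v n) (s + s').
Proof.
move=> /csumP us /csumP vs; apply/csumP => eps e0.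
have e2 : 0 < eps / 2 by rewrite divr_gt0.
near=> n; rewrite big_split /=.
have -> : \sum_(i < n) u i + \sum_(i < n) v i - (s + s') =
  (\sum_(i < n) u i - s) + (\sum_(i < n) v i - s') by ring.
apply: le_trans (normcD _ _) _; rewrite [eps]splitr lerD //.
  by near: n; exact: us.
by near: n; exact: vs.
Unshelve. all: by end_near. Qed.

Lemma csumZ u s (a : R[i]) : csum u s -> csum (fun n => a * u n) (a * s).
Proof.
move=> /csumP us; apply/csumP => eps e0.
have a1 : 0 < nc a + 1 by rewrite ltr_wpDl ?normc_ge0.
near=> n; rewrite -mulr_sumr -mulrBr normcM.
apply: (@le_trans _ _ ((nc a + 1) * (eps / (nc a + 1)))); last first.
  by rewrite mulrC divfK // gt_eqF.
rewrite ler_pM ?normc_ge0 // ?lerDl //.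
by near: n; apply: us; rewrite divr_gt0.
Unshelve. all: by end_near. Qed.

Lemma csumB u v s s' : csum u s -> csum v s' -> csum (fun n => u n - v n) (s - s').
Proof.
move=> us /(@csumZ _ _ (-1)) vs; rewrite -mulN1r.
by have := csumD us vs; congr csum; apply/funext => n; rewrite mulN1r.
Qed.

Lemma csum_eventually u (N : nat) : (forall n, (N <= n)%N -> u n = 0) ->
  csum u (\sum_(i < N) u i).
Proof.
move=> u0; apply/csumP => eps e0; near=> n.
have Nn : (N <= n)%N by near: n; exact: nbhs_infty_ge.
have -> : \sum_(i < n) u i = \sum_(i < N) u i.
  rewrite -!(big_mkord predT u) (big_cat_nat (n := N)) //=.
  rewrite [X in _ + X]big_nat_cond [X in _ + X]big1 ?addr0 // => i.
  by move=> /andP[/andP[Ni _] _]; rewrite u0.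
by rewrite subrr Normc.normc0 ltW.
Unshelve. all: by end_near. Qed.

Lemma csum_shift u s : csum u s -> csum (fun n => u n.+1) (s - u 0%N).
Proof.
move=> /csumP us; apply/csumP => eps /us [N _ h].
near=> n.
have -> : \sum_(i < n) u i.+1 - (s - u 0%N) = \sum_(i < n.+1) u i - s.
  by rewrite big_ord_recl; ring.
apply: h => /=; apply: leqW; near: n; exact: nbhs_infty_ge.
Unshelve. all: by end_near. Qed.

Lemma csum_unshift u s : csum (fun n => u n.+1) s -> csum u (u 0%N + s).
Proof.
move=> /csumP us; apply/csumP => eps /us [N _ h].
near=> n; have n0 : (0 < n)%N by near: n; exact: nbhs_infty_gt.
have Nn : (N < n)%N by near: n; exact: nbhs_infty_gt.
rewrite -(prednK n0) big_ord_recl opprD addrACA subrr add0r.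
by apply: h => /=; rewrite -ltnS prednK.
Unshelve. all: by end_near. Qed.

Lemma csum_exists u (K : R) : (forall n, \sum_(i < n) nc (u i) <= K) ->
  exists s, csum u s.
Proof.
move=> uK.
have real_case (a : nat -> R) : (forall n, `|a n| <= nc (u n)) -> cvgn (series a).
  move=> au; apply: (@normed_cvg R R^o); apply: nondecreasing_is_cvgn.
    by apply: nondecreasing_series => n _ _; exact: normr_ge0.
  exists K => _ [n _ <-]; apply: le_trans (uK n).
  rewrite /= /series /= big_mkord; apply: ler_sum => i _; exact: au.
have /cvg_ex[x /= ux] := real_case _ (fun n => normc_geRe (u n)).
have /cvg_ex[y /= uy] := real_case _ (fun n => normc_geIm (u n)).
exists (x +i* y); apply/csumP => eps e0.
have e2 : 0 < eps / 2 by rewrite divr_gt0.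
have sumE n : \sum_(i < n) u i =
    (\sum_(0 <= i < n) complex.Re (u i)) +i* (\sum_(0 <= i < n) complex.Im (u i)).
  elim: n => [|n IH]; first by rewrite big_ord0 !big_geq.
  by rewrite big_ord_recr !big_nat_recr //= IH; case: (u n).
near=> n; apply: le_trans (normc_leReIm _) _; rewrite sumE /= [eps]splitr lerD //.
  rewrite distrC; near: n; move/cvgrPdist_le : ux; exact.
rewrite distrC; near: n; move/cvgrPdist_le : uy; exact.
Unshelve. all: by end_near. Qed.

Lemma weighted_sum_le u (w K : R) n : 1 < w ->
  (forall n, \sum_(i < n) nc (u i) * w ^+ i <= K) -> \sum_(i < n) nc (u i) <= K.
Proof.
move=> w1 uK; apply: le_trans (uK n); apply: ler_sum => i _.
by rewrite ler_peMr ?normc_ge0 // exprn_ege1 // ltW.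
Qed.

(* A factor w > 1 to spare in the absolute convergence makes the part of the
   double sum outside the triangle j + i < n at most K * K' / w ^ n. *)
Lemma csumM u v s s' (w K K' : R) : 1 < w ->
  (forall n, \sum_(i < n) nc (u i) * w ^+ i <= K) ->
  (forall n, \sum_(i < n) nc (v i) * w ^+ i <= K') ->
  csum u s -> csum v s' ->
  csum (fun n => \sum_(j < n.+1) u j * v (n - j)%N) (s * s').
Proof.
move=> w1 uK vK us vs; have w0 : 0 < w by exact: lt_trans ltr01 w1.
have K0 : 0 <= K by have := uK 0%N; rewrite big_ord0.
have K'0 : 0 <= K' by have := vK 0%N; rewrite big_ord0.
have nw0 (a : nat -> R[i]) (i : nat) : 0 <= nc (a i) * w ^+ i.
  by rewrite mulr_ge0 ?normc_ge0 ?exprn_ge0 // ltW.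
have tri n : \sum_(k < n) \sum_(j < k.+1) u j * v (k - j)%N =
    \sum_(j < n) u j * \sum_(i < n - j) v i.
  transitivity (\sum_(k < n) \sum_(j < n | (j <= k)%N) u j * v (k - j)%N).
    by apply: eq_bigr => k _; rewrite (big_ord_widen_cond n predT (fun j => u j * v (k - j)%N)).
  rewrite (exchange_big_dep predT) //=; apply: eq_bigr => j _.
  by rewrite -mulr_sumr sum_shift.
(* Outside the triangle [i >= n - j], hence [w ^+ n <= w ^+ j * w ^+ i], and the two weighted sums
   bound the rest. *)
have rest n : nc ((\sum_(j < n) u j) * (\sum_(i < n) v i) -
    \sum_(j < n) u j * \sum_(i < n - j) v i) * w ^+ n <= K * K'.
  rewrite mulr_suml -sumrB; apply: le_trans (ler_wpM2r (exprn_ge0 _ (ltW w0)) (normc_sum _ _ _)) _.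
  rewrite mulr_suml; apply: le_trans (ler_wpM2r K'0 (uK n)); rewrite mulr_suml.
  apply: ler_sum => j _; rewrite -mulrBr normcM -mulrA -[leRHS]mulrA ler_wpM2l ?normc_ge0 //.
  have jn : (j <= n)%N by exact: ltnW.
  rewrite -[in w ^+ n](subnKC jn) exprD mulrCA ler_wpM2l ?exprn_ge0 ?(ltW w0) //.
  apply: le_trans (vK n).
  rewrite -!(big_mkord predT v).
  rewrite [X in nc (X - _)](big_cat_nat (n := (n - j)%N)) ?leq_subr //= addrAC subrr add0r.
  apply: le_trans (ler_wpM2r (exprn_ge0 _ (ltW w0)) (normc_sum _ _ _)) _.
  rewrite mulr_suml -(big_mkord predT (fun i => nc (v i) * w ^+ i)).
  rewrite [leRHS](big_cat_nat (n := (n - j)%N)) ?leq_subr //=.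
  rewrite -[leLHS]add0r lerD ?sumr_ge0 //.
  rewrite big_nat_cond [leRHS]big_nat_cond; apply: ler_sum => i /andP[/andP[ni _] _].
  by rewrite ler_wpM2l ?normc_ge0 // ler_weXn2l // ltW.
have w_cvg : (fun n => w^-1 ^+ n) @ \oo --> (0 : R).
  by apply: cvg_expr; rewrite ger0_norm ?invr_ge0 ?(ltW w0) // invf_lt1.
have v_le n : nc (\sum_(i < n) v i) <= K'.
  by apply: le_trans (normc_sum _ _ _) _; exact: weighted_sum_le w1 vK.
apply/csumP => eps e0.
(* The errors are [K * K' * e] outside the triangle, and [e * K'] and [nc s * e] from the two
   factors; the 1 keeps [c] positive. *)
pose c : R := K * K' + K' + nc s + 1.
have c0 : 0 < c by rewrite ltr_wpDl // !addr_ge0 ?mulr_ge0 ?normc_ge0.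
pose e := eps / c; have e_gt0 : 0 < e by rewrite divr_gt0.
have w_le : \forall n \near \oo, w^-1 ^+ n <= e.
  move/cvgrPdist_le : w_cvg => /(_ e e_gt0); apply: filterS => n.
  by rewrite sub0r normrN ger0_norm // exprn_ge0 // invr_ge0 ltW.
near=> n; rewrite tri.
have hA : nc (\sum_(j < n) u j - s) <= e by near: n; move/csumP : us; apply.
have hB : nc (\sum_(j < n) v j - s') <= e by near: n; move/csumP : vs; apply.
have hw : w^-1 ^+ n <= e by near: n.
move: hA hB (v_le n) (rest n).
set A := \sum_(j < n) u j; set B := \sum_(i < n) v i.
set C := \sum_(j < n) _ => hA hB hK' hr.
have hC : nc (A * B - C) <= K * K' * e.
  apply: (@le_trans _ _ (K * K' * w^-1 ^+ n)); last by rewrite ler_wpM2l ?mulr_ge0.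
  by rewrite exprVn ler_pdivlMr ?exprn_gt0.
have -> : C - s * s' = - (A * B - C) + ((A - s) * B + s * (B - s')) by ring.
apply: le_trans (normcD _ _) _; rewrite normcN.
apply: (@le_trans _ _ (K * K' * e + (e * K' + nc s * e))).
  rewrite lerD //; apply: le_trans (normcD _ _) _; rewrite !normcM lerD //.
    by rewrite ler_pM ?normc_ge0.
  by rewrite ler_wpM2l ?normc_ge0.
have -> : eps = e * c by rewrite /e divfK // gt_eqF.
rewrite [e * K']mulrC -!mulrDl mulrC ler_wpM2l ?(ltW e_gt0) //.
by rewrite /c !addrA lerDl.
Unshelve. all: by end_near. Qed.

End ComplexSeries.

Section QuadraticRemainder.
Local Open Scope classical_set_scope.

(** A quadratic Taylor remainder is all that a power series has to supply. The field is general
    because it is used over [R[i]] for analyticity in t and over [R] for components. *)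
Lemma is_derive_quadratic (K : numFieldType) (f : K^o -> K^o) (z D : K^o) (C eta : K) :
  0 < eta -> 0 <= C ->
  (forall h, `|h| <= eta -> `|f (z + h) - f z - h * D| <= C * `|h| ^+ 2) ->
  is_derive z (1 : K^o) f D.
Proof.
move=> eta0 C0 fD.
have cv : (fun h : K^o => h^-1 *: (f (h *: (1 : K^o) + z) - f z)) @ 0^' --> D.
  apply/cvgrPdist_le => e e0; near=> h.
  have h0 : h != 0 by near: h; exact: nbhs_dnbhs_neq.
  have h_gt0 : 0 < `|h| by rewrite normr_gt0.
  have -> : D - h^-1 *: (f (h *: (1 : K^o) + z) - f z) =
    - (h^-1 * (f (z + h) - f z - h * D)).
    rewrite /GRing.scale /= mulr1 [h + z]addrC [in RHS]mulrBr mulKf //.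
    by rewrite opprB.
  rewrite normrN normrM normfV ler_pdivrMl //.
  have hC : `|h| <= e / (C + 1).
    near: h; apply: dnbhs0_le; rewrite divr_gt0 // ltr_wpDl //.
  have hh : `|h| <= eta by near: h; exact: dnbhs0_le.
  have hh' : C * `|h| ^+ 2 <= `|h| * e.
    rewrite expr2 mulrA mulrC ler_wpM2l ?(ltW h_gt0) //.
    have C1 : 0 < C + 1 by rewrite ltr_wpDl.
    rewrite ler_pdivlMr // in hC; apply: le_trans hC.
    by rewrite mulrC ler_wpM2l ?(ltW h_gt0) // lerDl.
  exact: le_trans (fD h hh) hh'.
by split; [apply: cvgP cv|apply: cvg_lim cv => //; exact: norm_hausdorff].
Unshelve. all: by end_near. Qed.

End QuadraticRemainder.

Section PowerSeries.
Local Open Scope classical_set_scope.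
Variable R : realType.
Local Notation nc := (@Normc.normc R).
Implicit Types (a : nat -> R[i]) (rho eta K : R).

Definition psbound a rho K := forall n, \sum_(i < n) nc (a i) * rho ^+ i <= K.

Definition psum a (z : R[i]) : R[i] := xget 0 [set s | csum (fun n => a n * z ^+ n) s].

Definition psderiv a : nat -> R[i] := fun n => a n.+1 *+ n.+1.

Lemma psbound_ge0 a rho K : psbound a rho K -> 0 <= K.
Proof. by move=> /(_ 0%N); rewrite big_ord0. Qed.

Lemma psboundS a rho rho' K : 0 <= rho' -> rho' <= rho -> psbound a rho K -> psbound a rho' K.
Proof.
move=> r0 rr aK n; apply: le_trans (aK n); apply: ler_sum => i _.
by rewrite ler_wpM2l ?normc_ge0 // lerXn2r // nnegrE // (le_trans r0).
Qed.

Lemma psum_csum a rho K z : psbound a rho K -> nc z <= rho ->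
  csum (fun n => a n * z ^+ n) (psum a z).
Proof.
move=> aK zr; apply: xgetPex; apply: (@csum_exists _ _ K) => n.
apply: le_trans (aK n); apply: ler_sum => i _; rewrite normcM normcX.
by rewrite ler_wpM2l ?normc_ge0 // lerXn2r // nnegrE ?normc_ge0 // (le_trans (normc_ge0 z)).
Qed.

Lemma psumE a z s : csum (fun n => a n * z ^+ n) s -> psum a z = s.
Proof. by move=> zs; apply: (xget_unique _ zs) => y /csum_unique; apply. Qed.

Lemma psum_0 a : psum a 0 = a 0%N.
Proof.
apply: psumE; rewrite -[X in csum _ X](_ : \sum_(i < 1) a i * 0 ^+ i = _).
  by apply: csum_eventually => -[|n] // _; rewrite expr0n mulr0.
by rewrite big_ord1 expr0 mulr1.
Qed.

(** The term linear in [y] of the binomial expansion. It pays for the factor [n.+1] of a derivative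
    with a radius larger by [y], in place of a Cauchy estimate. *)
Lemma bernoulli_le (x y : R) n : 0 <= x -> 0 <= y -> x ^+ n *+ n.+1 * y <= (x + y) ^+ n.+1.
Proof.
move=> x0 y0; suff : x ^+ n.+1 + x ^+ n *+ n.+1 * y <= (x + y) ^+ n.+1.
  by apply: le_trans; rewrite lerDr exprn_ge0.
elim: n => [|n IH]; first by rewrite expr0 mul1r expr1.
rewrite [leRHS]exprS; apply: le_trans (ler_wpM2l (addr_ge0 x0 y0) IH).
have -> : (x + y) * (x ^+ n.+1 + x ^+ n *+ n.+1 * y) =
  x ^+ n.+2 + x ^+ n.+1 *+ n.+2 * y + x ^+ n *+ n.+1 * y ^+ 2.
  rewrite [x ^+ n.+1 *+ n.+2]mulrSr (_ : x ^+ n.+1 *+ n.+1 = x * (x ^+ n *+ n.+1)); last by rewrite exprS mulrnAr.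
  rewrite [x ^+ n.+2]exprS.
  by move: (x ^+ n.+1) (x ^+ n *+ n.+1) => c b; ring.
by rewrite lerDl mulr_ge0 ?mulrn_wge0 ?exprn_ge0.
Qed.

Lemma psbound_deriv a rho eta K : 0 <= rho -> 0 < eta -> psbound a (rho + eta) K ->
  psbound (psderiv a) rho (K / eta).
Proof.
move=> r0 e0 aK n; rewrite ler_pdivlMr // mulr_suml; apply: le_trans (aK n.+1).
rewrite big_ord_recl expr0 mulr1 -[leLHS]add0r; apply: lerD; first exact: normc_ge0.
apply: ler_sum => i _; rewrite /psderiv -mulr_natr normcM normc_natr -!mulrA ler_wpM2l ?normc_ge0 //.
by rewrite mulrA mulr_natl bernoulli_le // ltW.
Qed.

(** The remainder consists of the binomial terms of order at least 2 in [h]. In each of them [h] may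
    be replaced by [eta] at the gain of [(nc h / eta) ^+ 2], and what results is part of the
    expansion of [(rho + eta) ^+ k]. *)
Lemma expr_quadratic (x h : R[i]) rho eta k : 0 < eta -> nc x <= rho -> nc h <= eta ->
  nc ((x + h) ^+ k - x ^+ k - h * (x ^+ k.-1 *+ k)) <= (nc h / eta) ^+ 2 * (rho + eta) ^+ k.
Proof.
move=> e0 xr he.
have r0 : 0 <= rho by exact: le_trans (normc_ge0 x) xr.
have rhs0 j : 0 <= (nc h / eta) ^+ 2 * (rho + eta) ^+ j.
  by rewrite mulr_ge0 ?exprn_ge0 ?divr_ge0 ?normc_ge0 ?addr_ge0 // ltW.
case: k => [|[|k]].
- rewrite [X in nc X](_ : _ = 0) ?Normc.normc0 ?rhs0 //.
  by rewrite !expr0 mulr0n mulr0 subrr subr0.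
- rewrite [X in nc X](_ : _ = 0) ?Normc.normc0 ?rhs0 //.
  by rewrite !expr1 expr0 mulr1 [x + h]addrC addrK subrr.
have bin_split (A : comNzRingType) (y z : A) : (y + z) ^+ k.+2 =
    y ^+ k.+2 + z * (y ^+ k.+1 *+ k.+2) +
    \sum_(i < k.+1) y ^+ (k - i) * z ^+ i.+2 *+ 'C(k.+2, i.+2).
  rewrite exprDn 2!big_ord_recl addrA; congr (_ + _ + _).
  - by rewrite subn0 expr0 mulr1 bin0.
  - by rewrite bin1 expr1 subSS subn0 mulrnAr mulrC.
have cancel (p q s : R[i]) : p + q + s - p - q = s by ring.
rewrite bin_split cancel.
apply: le_trans (normc_sum _ _ _) _.
rewrite bin_split mulrDr -[leLHS]add0r; apply: lerD.
  rewrite mulr_ge0 ?addr_ge0 ?exprn_ge0 ?divr_ge0 ?normc_ge0 ?(ltW e0) //.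
  by rewrite mulr_ge0 ?(ltW e0) // mulrn_wge0 // exprn_ge0.
rewrite mulr_sumr; apply: ler_sum => i _.
rewrite normcMn normcM !normcX mulrnAr lerMn2r; apply/orP; right.
have hx : nc x ^+ (k - i) <= rho ^+ (k - i) by rewrite lerXn2r // nnegrE normc_ge0.
have hh : nc h ^+ i.+2 <= (nc h / eta) ^+ 2 * eta ^+ i.+2.
  rewrite -[i.+2]addn2 !exprD expr_div_n [leRHS]mulrCA divfK ?expf_neq0 ?gt_eqF //.
  rewrite ler_wpM2r ?exprn_ge0 ?normc_ge0 // lerXn2r // nnegrE ?normc_ge0 //.
  exact: ltW.
by rewrite [leRHS]mulrCA; apply: ler_pM => //; apply: exprn_ge0; exact: normc_ge0.
Qed.

Lemma psum_quadratic a rho eta K x h : 0 < eta -> psbound a (rho + eta) K ->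
  nc x <= rho -> nc h <= eta ->
  nc (psum a (x + h) - psum a x - h * psum (psderiv a) x) <= (nc h / eta) ^+ 2 * K.
Proof.
move=> e0 aK xr he; have r0 : 0 <= rho by exact: le_trans (normc_ge0 x) xr.
have xh : nc (x + h) <= rho + eta by apply: le_trans (normcD _ _) _; rewrite lerD.
have xr' : nc x <= rho + eta by rewrite (le_trans xr) // lerDl ltW.
have sh := psum_csum aK xh; have s0 := psum_csum aK xr'.
have sd := psum_csum (psbound_deriv r0 e0 aK) xr.
(* The derived series is moved by one index, so that the three series can be subtracted term by
   term. *)
have sd' : csum (fun n => a n * (x ^+ n.-1 *+ n)) (psum (psderiv a) x).
  have := @csum_unshift _ (fun n => a n * (x ^+ n.-1 *+ n)) (psum (psderiv a) x).
  rewrite mulr0n mulr0 add0r; apply; move: sd; congr csum; apply/funext => n /=.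
  by rewrite /psderiv mulrnAr mulrnAl.
have := csumB (csumB sh s0) (csumZ h sd'); move/csum_le; apply => n.
apply: (@le_trans _ _ ((nc h / eta) ^+ 2 * (\sum_(i < n) nc (a i) * (rho + eta) ^+ i))).
  rewrite mulr_sumr; apply: ler_sum => i _.
  rewrite mulrCA -!mulrBr normcM mulrCA ler_wpM2l ?normc_ge0 //.
  exact: expr_quadratic.
by rewrite ler_wpM2l ?exprn_ge0 ?divr_ge0 ?normc_ge0 ?(ltW e0).
Qed.

Lemma psum_derivable a eta K z : 0 < eta -> psbound a (nc z + eta) K ->
  derivable (psum a : R[i]^o -> R[i]^o) z 1.
Proof.
move=> e0 aK; have K0 := psbound_ge0 aK.
suff [] : is_derive (z : R[i]^o) (1 : R[i]^o) (psum a : R[i]^o -> R[i]^o) (psum (psderiv a) z) by [].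
apply: (@is_derive_quadratic _ _ _ _ (K / eta ^+ 2)%:C eta%:C).
- by rewrite ltcR.
- by rewrite lecR divr_ge0 ?exprn_ge0 // ltW.
- move=> h; rewrite !normcE lecR => he; rewrite -rmorphXn -rmorphM lecR.
  apply: le_trans (psum_quadratic e0 aK (lexx _) he) _.
  by rewrite expr_div_n; move: (eta ^+ 2)^-1 => y; rewrite (_ : _ * K = K * y * nc h ^+ 2) //; ring.
Qed.

(** Derivatives by components are the form in which [partial] is defined and to which the mean value
    theorem applies. *)
Definition rderiv (g : R -> R[i]) (s : R) (D : R[i]) : Prop :=
  is_derive s (1 : R) (fun s => complex.Re (g s)) (complex.Re D) /\
  is_derive s (1 : R) (fun s => complex.Im (g s)) (complex.Im D).

Lemma rderiv_quadratic (g : R -> R[i]) (s : R) D (C eta : R) : 0 < eta -> 0 <= C ->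
  (forall h : R, `|h| <= eta -> nc (g (s + h) - g s - h%:C * D) <= C * `|h| ^+ 2) ->
  rderiv g s D.
Proof.
move=> e0 C0 gD.
have ReE (h : R) (x y : R[i]) : complex.Re (x - y - h%:C * D) = complex.Re x - complex.Re y - h * complex.Re D.
  by case: x y D {gD} => [? ?] [? ?] [? ?]; rewrite /= mul0r subr0.
have ImE (h : R) (x y : R[i]) : complex.Im (x - y - h%:C * D) = complex.Im x - complex.Im y - h * complex.Im D.
  by case: x y D {gD ReE} => [? ?] [? ?] [? ?]; rewrite /= mul0r addr0.
split; apply: (@is_derive_quadratic R _ _ _ C eta) => // h he.
  by rewrite -ReE; apply: le_trans (gD h he); exact: normc_geRe.
by rewrite -ImE; apply: le_trans (gD h he); exact: normc_geIm.
Qed.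

Lemma psum_ray a (t : R[i]) (s : R) eta K : 0 < eta -> psbound a (`|s| * nc t + eta) K ->
  rderiv (fun s => psum a (s%:C * t)) s (t * psum (psderiv a) (s%:C * t)).
Proof.
move=> e0 aK; have K0 := psbound_ge0 aK.
have t1 : 0 < nc t + 1 by rewrite ltr_wpDl ?normc_ge0.
apply: (@rderiv_quadratic _ _ _ ((nc t / eta) ^+ 2 * K) (eta / (nc t + 1))).
- by rewrite divr_gt0.
- by rewrite mulr_ge0 // exprn_ge0 // divr_ge0 ?normc_ge0 // ltW.
- move=> h he; rewrite mulrA rmorphD mulrDl.
  have xs : nc (s%:C * t) <= `|s| * nc t by rewrite normcM normcC.
  have hs : nc (h%:C * t) <= eta.
    rewrite normcM normcC; rewrite ler_pdivlMr // in he; apply: le_trans he.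
    by rewrite ler_wpM2l // lerDl.
  apply: le_trans (psum_quadratic e0 aK xs hs) _.
  rewrite normcM normcC (_ : _ * K = (nc t / eta) ^+ 2 * K * `|h| ^+ 2) //.
  by rewrite !expr_div_n exprMn; move: (eta ^+ 2)^-1 => z; ring.
Qed.

Lemma rderivM (g1 g2 : R -> R[i]) s D1 D2 : rderiv g1 s D1 -> rderiv g2 s D2 ->
  rderiv (fun s => g1 s * g2 s) s (D1 * g2 s + g1 s * D2).
Proof.
move=> [R1 I1] [R2 I2].
have ReM (x y : R[i]) : complex.Re (x * y) =
    complex.Re x * complex.Re y - complex.Im x * complex.Im y by case: x y => [? ?] [? ?].
have ImM (x y : R[i]) : complex.Im (x * y) =
    complex.Re x * complex.Im y + complex.Im x * complex.Re y by case: x y => [? ?] [? ?].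
have ReD (x y : R[i]) : complex.Re (x + y) = complex.Re x + complex.Re y by case: x y => [? ?] [? ?].
have ImD (x y : R[i]) : complex.Im (x + y) = complex.Im x + complex.Im y by case: x y => [? ?] [? ?].
split.
  rewrite (_ : (fun s => complex.Re _) = (fun s => complex.Re (g1 s)) * (fun s => complex.Re (g2 s)) -
     (fun s => complex.Im (g1 s)) * (fun s => complex.Im (g2 s))); last by apply/funext => x; rewrite ReM.
  apply: (is_derive_eq (is_deriveB (is_deriveM R1 R2) (is_deriveM I1 I2))); rewrite ReD !ReM /GRing.scale /=.
  clear; move: (complex.Re (g1 s)) (complex.Im (g1 s)) (complex.Re (g2 s)) (complex.Im (g2 s))
  (complex.Re D1) (complex.Im D1) (complex.Re D2) (complex.Im D2) => a b c d' p q u v; ring.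
rewrite (_ : (fun s => complex.Im _) = (fun s => complex.Re (g1 s)) * (fun s => complex.Im (g2 s)) +
   (fun s => complex.Im (g1 s)) * (fun s => complex.Re (g2 s))); last by apply/funext => x; rewrite ImM.
apply: (is_derive_eq (is_deriveD (is_deriveM R1 I2) (is_deriveM I1 R2))); rewrite ImD !ImM /GRing.scale /=.
clear; move: (complex.Re (g1 s)) (complex.Im (g1 s)) (complex.Re (g2 s)) (complex.Im (g2 s))
  (complex.Re D1) (complex.Im D1) (complex.Re D2) (complex.Im D2) => a b c d' p q u v; ring.
Qed.

Lemma rderivN (g : R -> R[i]) s D : rderiv g s D -> rderiv (fun s => - g s) s (- D).
Proof.
move=> [R1 I1]; split.
  rewrite (_ : (fun s => complex.Re _) = - (fun s => complex.Re (g s))); last first.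
    by apply/funext => x /=; rewrite opprfctE; case: (g x).
  by apply: is_derive_eq; case: D {R1 I1}.
rewrite (_ : (fun s => complex.Im _) = - (fun s => complex.Im (g s))); last first.
  by apply/funext => x /=; rewrite opprfctE; case: (g x).
by apply: is_derive_eq; case: D {R1 I1}.
Qed.

Lemma is_derive_chain (f g : R -> R) (x a b : R) :
  is_derive x (1 : R) g b -> is_derive (g x) (1 : R) f a ->
  is_derive x (1 : R) (fun x => f (g x)) (a * b).
Proof.
move=> [dg gb] [df fa]; split.
  by apply/derivable1_diffP/differentiable_comp; apply/derivable1_diffP.
by rewrite -derive1E (derive1_comp dg df) !derive1E fa gb.
Qed.

Lemma rderiv_cexp (g : R -> R[i]) s D : rderiv g s D ->
  rderiv (fun s => cexp (g s)) s (cexp (g s) * D).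
Proof.
move=> [R1 I1].
have ReE (z : R[i]) : complex.Re (cexp z) = expR (complex.Re z) * cos (complex.Im z).
  by rewrite /cexp /= mul0r subr0.
have ImE (z : R[i]) : complex.Im (cexp z) = expR (complex.Re z) * sin (complex.Im z).
  by rewrite /cexp /= mul0r addr0.
have dE := is_derive_chain R1 (is_derive_expR _).
have dC := is_derive_chain I1 (is_derive_cos _).
have dS := is_derive_chain I1 (is_derive_sin _).
have gE : g s = complex.Re (g s) +i* complex.Im (g s) by case: (g s).
have DE : D = complex.Re D +i* complex.Im D by case: D {R1 I1 dE dC dS}.
split.
  rewrite (_ : (fun s => complex.Re _) = (fun s => expR (complex.Re (g s))) *
     (fun s => cos (complex.Im (g s)))); last by apply/funext => x; rewrite ReE.
  apply: is_derive_eq; rewrite /GRing.scale /=.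
  rewrite [in RHS]DE /= mul0r subr0 mul0r addr0.
  move: (expR _) (cos _) (sin _) (complex.Re D) (complex.Im D) => e c sn p q.
  ring.
rewrite (_ : (fun s => complex.Im _) = (fun s => expR (complex.Re (g s))) *
   (fun s => sin (complex.Im (g s)))); last by apply/funext => x; rewrite ImE.
apply: is_derive_eq; rewrite /GRing.scale /=.
rewrite [in RHS]DE /= mul0r subr0 mul0r addr0.
move: (expR _) (cos _) (sin _) (complex.Re D) (complex.Im D) => e c sn p q.
ring.
Qed.

Lemma rderiv0_const (g : R -> R[i]) :
  (forall s : R, 0 <= s <= 1 -> rderiv g s 0) -> g 1 = g 0.
Proof.
move=> dg.
have real_case (f : R -> R) : (forall s : R, 0 <= s <= 1 -> is_derive s (1 : R) f 0) -> f 1 = f 0.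
  move=> df; have [|||c _] := @MVT R f (fun=> 0) 0 1.
  - exact: ltr01.
  - by move=> x; rewrite in_itv /= => /andP[x0 x1]; apply: df; rewrite !ltW.
  - by apply: derivable_within_continuous => x; rewrite in_itv /= => /df[].
  by rewrite mul0r => /eqP; rewrite subr_eq0 => /eqP.
have h1 := real_case (fun s => complex.Re (g s)) (fun s sI => (dg s sI).1).
have h2 := real_case (fun s => complex.Im (g s)) (fun s sI => (dg s sI).2).
by move: h1 h2; case: (g 1) (g 0) => a b [c d'] /= -> ->.
Qed.

Lemma cexpD (x y : R[i]) : cexp (x + y) = cexp x * cexp y.
Proof.
case: x y => a b [c d']; rewrite /cexp /= expRD cosD sinD.
apply/eqP; rewrite eq_complex /=; apply/andP; split; apply/eqP;
move: (expR a) (expR c) (cos b) (sin b) (cos d') (sin d') => p q u v w z; ring.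
Qed.

Lemma cexp0 : cexp (0 : R[i]) = 1.
Proof. by rewrite /cexp /= expR0 cos0 sin0 mul1r. Qed.

Lemma cexp_neq0 (x : R[i]) : cexp x != 0.
Proof.
have : cexp x * cexp (- x) = 1 by rewrite -cexpD subrr cexp0.
by apply: contra_eq_neq => ->; rewrite mul0r eq_sym oner_eq0.
Qed.

Lemma psumM a b rho K K' x : nc x < rho -> psbound a rho K -> psbound b rho K' ->
  csum (fun n => (\sum_(j < n.+1) a j * b (n - j)%N) * x ^+ n) (psum a x * psum b x).
Proof.
move=> xr aK bK; have x0 := normc_ge0 x.
have m0 : 0 < nc x + rho by rewrite ltr_wpDl // (le_lt_trans x0).
(* A factor above 1 that still keeps [nc x * w] within [rho], as [csumM] demands. *)
pose w := 2 * rho / (nc x + rho).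
have w1 : 1 < w by rewrite /w ltr_pdivlMr // mul1r mulr_natl mulr2n ltrD2r.
have wx : nc x * w <= rho.
  rewrite /w mulrA ler_pdivrMr // (_ : _ * (2 * rho) = rho * (nc x + nc x)); last by ring.
  by rewrite ler_wpM2l ?(ltW (le_lt_trans x0 xr)) // lerD2l ltW.
have wb (c : nat -> R[i]) L : psbound c rho L ->
    forall n, \sum_(i < n) nc (c i * x ^+ i) * w ^+ i <= L.
  move=> cL n; apply: le_trans (cL n); apply: ler_sum => i _.
  rewrite normcM normcX -mulrA -exprMn ler_wpM2l ?normc_ge0 // lerXn2r // nnegrE.
    by rewrite mulr_ge0 // ltW // (lt_trans ltr01).
  by rewrite ltW // (le_lt_trans x0).
have := csumM w1 (wb _ _ aK) (wb _ _ bK) (psum_csum aK (ltW xr)) (psum_csum bK (ltW xr)).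
congr csum; apply/funext => n; rewrite mulr_suml; apply: eq_bigr => j _.
have jn : (j <= n)%N by rewrite -ltnS.
by rewrite mulrACA -exprD subnKC.
Qed.

(* Both L = psum z and exp F, with F = psum (flog z), solve y' = F' y along the
   ray through t, with y = 1 at the origin. *)
Lemma cexp_flog (z : nat -> R[i]) (t : R[i]) (rho K K' : R) : z 0%N = 1 ->
  nc t < rho -> psbound (flog z) rho K -> psbound z rho K' ->
  cexp (psum (flog z) t) = psum z t.
Proof.
move=> z0 tr cK zK.
(* Half the gap: the series of F' loses one [eta] to differentiation, and the other gives the strict
   inequality that [psumM] takes. *)
pose eta := (rho - nc t) / 2; have eta0 : 0 < eta by rewrite divr_gt0 // subr_gt0.
have rhoE : rho = nc t + eta + eta by rewrite /eta -addrA -splitr addrC subrK.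
have nt0 := normc_ge0 t.
(* The quotient of the two solutions; its derivative vanishes once Z' = F' Z is known for the
   series. *)
pose G (s : R) := psum z (s%:C * t) * cexp (- psum (flog z) (s%:C * t)).
have G_const : G 1 = G 0.
  apply: rderiv0_const => s /andP[s0 s1].
  have st : `|s| * nc t <= nc t by rewrite ger0_norm // ler_piMl.
  have str : `|s| * nc t + eta <= rho by rewrite rhoE -addrA lerD // lerDl ltW.
  have st0 : 0 <= `|s| * nc t + eta by apply: addr_ge0; [exact: mulr_ge0|exact: ltW].
  have dz := psum_ray eta0 (psboundS st0 str zK).
  have dc := psum_ray eta0 (psboundS st0 str cK).
  have := rderivM dz (rderiv_cexp (rderivN dc)).
  set x := s%:C * t.
  have xt : nc x <= nc t by rewrite normcM normcC.
  have bz : psbound z (nc t + eta) K'.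
    by apply: psboundS zK; rewrite ?addr_ge0 ?(ltW eta0) // rhoE lerDl ltW.
  suff -> : psum (psderiv z) x = psum (psderiv (flog z)) x * psum z x.
    have E (p q e : R[i]) : t * (p * q) * e + q * (e * - (t * p)) = 0 by ring.
    by rewrite E.
  have nt_eta : 0 <= nc t + eta by rewrite addr_ge0 // ltW.
  have cK' : psbound (flog z) (nc t + eta + eta) K by rewrite -rhoE.
  have zK' : psbound z (nc t + eta) K'.
    by apply: psboundS zK => //; rewrite rhoE lerDl ltW.
  have dcK := psbound_deriv nt_eta eta0 cK'.
  have xr : nc x < nc t + eta by rewrite (le_lt_trans xt) // ltrDl.
  apply: psumE; have := psumM xr dcK zK'; congr csum; apply/funext => n; congr (_ * _).
  (* Coefficientwise, Z' = F' Z is [dlogP] at [n.+1], whose term of index 0 vanishes. *)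
  have := dlogP n.+1 z0; rewrite big_ord_recl dlog0 mul0r add0r => E.
  apply: etrans E; apply: eq_bigr => j _; rewrite lift0 subSS; congr (_ * _).
  by rewrite /psderiv /flog -[LHS]mulr_natr divfK // pnatr_eq0.
have G0 : G 0 = 1 by rewrite /G mul0r !psum_0 z0 /flog invr0 mulr0 oppr0 cexp0 mulr1.
have : G 1 = 1 by rewrite G_const.
rewrite /G mul1r => /(congr1 ( *%R^~ (cexp (psum (flog z) t)))).
by rewrite -mulrA -cexpD addNr cexp0 mulr1 mul1r.
Qed.

End PowerSeries.

(** * The matrix exponential *)

Section MatrixExponential.
Local Open Scope classical_set_scope.
Variable R : realType.
Local Notation nc := (@Normc.normc R).

Definition entry_norm m n (A : 'M[R[i]]_(m, n)) : R := \sum_i \sum_j nc (A i j).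

Lemma entry_norm_ge0 m n (A : 'M[R[i]]_(m, n)) : 0 <= entry_norm A.
Proof. by apply: sumr_ge0 => i _; apply: sumr_ge0 => j _; exact: normc_ge0. Qed.

Lemma entry_norm_le m n (A : 'M[R[i]]_(m, n)) i j : nc (A i j) <= entry_norm A.
Proof.
rewrite /entry_norm (bigD1 i) //= (bigD1 j) //= -addrA lerDl addr_ge0 ?sumr_ge0 //.
  by move=> k _; exact: normc_ge0.
by move=> k _; apply: sumr_ge0 => l _; exact: normc_ge0.
Qed.

Lemma entry_normM m n p (A : 'M[R[i]]_(m, n)) (B : 'M[R[i]]_(n, p)) :
  entry_norm (A *m B) <= entry_norm A * entry_norm B.
Proof.
rewrite /entry_norm mulr_suml; apply: ler_sum => i _.
apply: (@le_trans _ _ (\sum_j \sum_k nc (A i k) * nc (B k j))).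
  apply: ler_sum => j _; rewrite mxE; apply: le_trans (normc_sum _ _ _) _.
  by apply: ler_sum => k _; rewrite normcM.
rewrite exchange_big /= mulr_suml; apply: ler_sum => k _; rewrite -mulr_sumr.
rewrite ler_wpM2l ?normc_ge0 // (bigD1 k) //= lerDl sumr_ge0 // => q _.
by apply: sumr_ge0 => j _; exact: normc_ge0.
Qed.

Lemma entry_normXM n p (A : 'M[R[i]]_n) (B : 'M[R[i]]_(n, p)) k :
  entry_norm (A ^+ k *m B) <= entry_norm A ^+ k * entry_norm B.
Proof.
elim: k => [|k IH]; first by rewrite !expr0 mul1r mul1mx.
rewrite !exprS -mulrA -[(_ * _) *m B](mulmxA A); apply: le_trans (entry_normM _ _) _.
by rewrite ler_wpM2l ?entry_norm_ge0.
Qed.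

Lemma entry_norm_trace n (A : 'M[R[i]]_n) : nc (\tr A) <= entry_norm A.
Proof.
apply: le_trans (normc_sum _ _ _) _; apply: ler_sum => i _.
by rewrite (bigD1 i) //= lerDl sumr_ge0 // => j _; exact: normc_ge0.
Qed.

Lemma mx_hausdorff n : hausdorff_space 'M[R[i]^o]_n.
Proof.
move=> p q pq; apply/matrixP => i j; apply: (@norm_hausdorff _ R[i]^o) => A B pA qB.
have [||M [MA MB]] := pq [set M : 'M[R[i]^o]_n | A (M i j)] [set M : 'M[R[i]^o]_n | B (M i j)].
- exists (fun i' j' => if (i' == i) && (j' == j) then A else setT).
    by move=> i' j'; case: ifP => [/andP[/eqP -> /eqP ->] //|_]; exact: filterT.
  by move=> M /(_ i j); rewrite !eqxx.
- exists (fun i' j' => if (i' == i) && (j' == j) then B else setT).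
    by move=> i' j'; case: ifP => [/andP[/eqP -> /eqP ->] //|_]; exact: filterT.
  by move=> M /(_ i j); rewrite !eqxx.
by exists (M i j).
Qed.

(** [mexp] is a limit in the matrix topology. The entries converge absolutely, finitely many
    entrywise neighbourhoods intersect, and the Hausdorff property identifies the limit. *)
Lemma mexp_csum n (A : 'M[R[i]]_n) i j :
  csum (fun k => (k`!%:R^-1 *: A ^+ k) i j) (mexp A i j).
Proof.
have ex i' j' : exists s, csum (fun k => (k`!%:R^-1 *: A ^+ k) i' j') s.
  apply: (@csum_exists _ _ (expR (entry_norm A) * entry_norm (1%:M : 'M[R[i]]_n))) => m.
  apply: le_trans (ler_wpM2r (entry_norm_ge0 _) (exp_partial_le m (entry_norm_ge0 A))).
  rewrite mulr_suml; apply: ler_sum => k _.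
  rewrite mxE normcM normcV normc_natr mulrC mulrAC ler_wpM2r ?invr_ge0 //.
  by apply: le_trans (entry_norm_le _ _ _) _; rewrite -{1}[A ^+ k]mulmx1; exact: entry_normXM.
have ex2 i' : exists f, forall j', csum (fun k => (k`!%:R^-1 *: A ^+ k) i' j') (f j').
  by have /choice[f fP] := ex i'; exists f.
have /choice[M' M'P] := ex2.
pose M : 'M[R[i]^o]_n := \matrix_(i', j') M' i' j'.
suff -> : mexp A = M by rewrite mxE.
suff cv : series (fun k => (k`!%:R^-1 *: A ^+ k : 'M[R[i]^o]_n)) @ \oo --> M.
  exact: (cvg_lim (@mx_hausdorff n) cv).
move=> P [Q MQ QP].
have near_entry i' j' : \forall m \near \oo,
    Q i' j' (series (fun k => (k`!%:R^-1 *: A ^+ k : 'M[R[i]^o]_n)) m i' j').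
  have := MQ i' j'; rewrite mxE -nbhs_ballE => -[e /= e0 eQ].
  have e_gt0 : 0 < complex.Re e by move: e0; rewrite ltcE => /andP[].
  have eE : e = (complex.Re e)%:C.
    by move: e0; rewrite ltcE => /andP[/eqP]; case: (e) => a b /= -> _.
  have e2 : 0 < complex.Re e / 2 by rewrite divr_gt0.
  have /csumP/(_ _ e2) := M'P i' j'; apply: filterS => m h; apply: eQ.
  rewrite /ball /= /ball_ /= normcE eE ltcR normcB.
  rewrite /series /= summxE big_mkord; apply: le_lt_trans h _.
  by rewrite ltr_pdivrMr // ltr_pMr // ltr1n.
have near_all : \forall m \near \oo, forall i' j',
    Q i' j' (series (fun k => (k`!%:R^-1 *: A ^+ k : 'M[R[i]^o]_n)) m i' j').
  by apply: filter_forall => i'; apply: filter_forall => j'; exact: near_entry.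
by apply: filterS near_all => m Qm; exact: (QP _ Qm).
Qed.

Lemma csum_bigsum (I : finType) (u : I -> nat -> R[i]) (s : I -> R[i]) :
  (forall i, csum (u i) (s i)) -> csum (fun n => \sum_i u i n) (\sum_i s i).
Proof.
move=> us.
elim: (index_enum I) => [|i r IH].
  rewrite big_nil (_ : (fun n => _) = fun=> 0); last by apply/funext => n; rewrite big_nil.
  by have := @csum_eventually R (fun=> 0) 0 (fun _ _ => erefl); rewrite big_ord0.
rewrite big_cons (_ : (fun n => _) = fun n => u i n + \sum_(j <- r) u j n).
  exact: csumD.
by apply/funext => n; rewrite big_cons.
Qed.

Lemma exprZmx n (a : R[i]) (A : 'M[R[i]]_n) k : (a *: A) ^+ k = a ^+ k *: A ^+ k.
Proof.
elim: k => [|k IH]; first by rewrite !expr0 scale1r.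
rewrite !exprS IH -[LHS]/((a *: A) *m (a ^+ k *: A ^+ k)).
by rewrite -scalemxAr -scalemxAl scalerA [a ^+ k * a]mulrC.
Qed.

End MatrixExponential.

(** * The Taylor series of L in t *)

Section Loschmidt.
Variables (R : realType) (V : finType) (d : nat).
Local Notation nc := (@Normc.normc R).
Variables (S : {set {set V}}) (h : {set V} -> operator R V d) (rv : V -> 'M[R[i]]_d).
Implicit Types (l : {set V} -> R).

(** L is entire in t, so any radius is allowed; the bound may depend on the dimension. *)
Lemma trace_coef_bound l rho : 0 <= rho ->
  exists K, psbound (trace_coef h rv S l) rho K.
Proof.
move=> r0; set H := hamiltonian S l h.
exists (expR (rho * entry_norm H) * entry_norm (tens rv)) => n.
have y0 : 0 <= rho * entry_norm H by rewrite mulr_ge0 ?entry_norm_ge0.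
apply: le_trans (ler_wpM2r (entry_norm_ge0 _) (exp_partial_le n y0)).
rewrite mulr_suml; apply: ler_sum => k _.
rewrite !normcM normcX normc_i expr1n mul1r normcV normc_natr.
rewrite exprMn mulrC -!mulrA ler_wpM2l ?exprn_ge0 // mulrCA ler_wpM2l ?invr_ge0 //.
by apply: le_trans (entry_norm_trace _) _; exact: entry_normXM.
Qed.

Lemma loschmidt_psum l t : loschmidt S h (tens rv) l t = psum (trace_coef h rv S l) t.
Proof.
apply/esym/psumE; rewrite /loschmidt; set A := (- 'i * t) *: hamiltonian S l h.
have trE (B : operator R V d) : \tr (B *m tens rv) = \sum_i \sum_j B i j * tens rv j i.
  by apply: eq_bigr => i _; rewrite mxE.
rewrite trE.
have ce i j : csum (fun k => (k`!%:R^-1 *: A ^+ k) i j * tens rv j i) (mexp A i j * tens rv j i).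
  have := csumZ (tens rv j i) (mexp_csum A i j).
  by rewrite mulrC; congr csum; apply/funext => k; rewrite mulrC.
have := csum_bigsum (fun i => csum_bigsum (ce i)); congr csum; apply/funext => k.
rewrite /trace_coef /expect -trE /A exprZmx -!scalemxAl !mxtraceZ exprMn.
by move: (\tr _) ((- 'i) ^+ k) (t ^+ k) (k`!%:R^-1) => x y z w; ring.
Qed.

End Loschmidt.

(** * Power series in the parameters and their iterated partial derivatives *)

Section Polynomials.
Variables (R : realType) (V : finType) (S : {set {set V}}).
Local Notation nc := (@Normc.normc R).
Local Notation expo := {ffun {set V} -> nat}.
Local Notation term := (R[i] * expo)%type.
Implicit Types (X Y : {set V}) (nu W : expo) (m : term) (p q : seq term)
  (l : {set V} -> R) (f : ({set V} -> R) -> R[i]).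

Definition monom nu l : R[i] := \prod_(X in S) (l X)%:C ^+ nu X.
Definition mdeg nu : nat := (\sum_(X in S) nu X)%N.
(** Polynomials are lists of terms in which a monomial may recur: sums are concatenations and
    derivatives are maps, and norms of lists are upper bounds, which is all that is used. *)
Definition peval p l : R[i] := \sum_(m <- p) m.1 * monom m.2 l.
Definition pnorm p : R := \sum_(m <- p) nc m.1.
Definition homogeneous n p := all (fun m => mdeg m.2 == n) p.

Definition homog_poly n (K : R) f := exists p,
  [/\ homogeneous n p, pnorm p <= K & forall l, f l = peval p l].

Lemma monomD nu nu' l : monom [ffun X => (nu X + nu' X)%N] l = monom nu l * monom nu' l.
Proof. by rewrite /monom -big_split; apply: eq_bigr => X _; rewrite ffunE exprD. Qed.

Lemma mdegD nu nu' : mdeg [ffun X => (nu X + nu' X)%N] = (mdeg nu + mdeg nu')%N.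
Proof. by rewrite /mdeg -big_split; apply: eq_bigr => X _; rewrite ffunE. Qed.

Lemma homog_polyW n K K' f : K <= K' -> homog_poly n K f -> homog_poly n K' f.
Proof. by move=> KK [p [hp pK pE]]; exists p; split=> //; exact: le_trans KK. Qed.

Lemma homog_poly0 n : homog_poly n 0 (fun=> 0).
Proof. by exists [::]; rewrite /pnorm /peval; split=> // [|l]; rewrite big_nil. Qed.

Lemma homog_polyD n K K' f g : homog_poly n K f -> homog_poly n K' g ->
  homog_poly n (K + K') (fun l => f l + g l).
Proof.
move=> [p [hp pK pE]] [q [hq qK qE]]; exists (p ++ q); split.
- by rewrite /homogeneous all_cat; apply/andP.
- by rewrite /pnorm big_cat lerD.
- by move=> l; rewrite pE qE /peval big_cat.
Qed.

Lemma homog_poly_sum (I : Type) (s : seq I) (P : pred I) n (K : I -> R)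
    (F : I -> ({set V} -> R) -> R[i]) :
  (forall i, P i -> homog_poly n (K i) (F i)) ->
  homog_poly n (\sum_(i <- s | P i) K i) (fun l => \sum_(i <- s | P i) F i l).
Proof.
move=> h; elim: s => [|i s IH].
  rewrite big_nil (_ : (fun l => _) = (fun=> 0)); first exact: homog_poly0.
  by apply/funext => l; rewrite big_nil.
rewrite big_cons; case: ifP => Pi.
  rewrite (_ : (fun l => _) = fun l => F i l + \sum_(j <- s | P j) F j l).
    by apply: homog_polyD => //; exact: h.
  by apply/funext => l; rewrite big_cons Pi.
rewrite (_ : (fun l => _) = fun l => \sum_(j <- s | P j) F j l) //.
by apply/funext => l; rewrite big_cons Pi.
Qed.

Lemma homog_polyM n n' K K' f g : homog_poly n K f -> homog_poly n' K' g ->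
  homog_poly (n + n') (K * K') (fun l => f l * g l).
Proof.
move=> [p [hp pK pE]] [q [hq qK qE]].
exists [seq (m.1 * m'.1, [ffun X => (m.2 X + m'.2 X)%N]) | m <- p, m' <- q]; split.
- apply/allP => _ /allpairsP[[m m'] /= [mp mq ->]] /=.
  by rewrite mdegD (eqP (allP hp _ mp)) (eqP (allP hq _ mq)).
- rewrite /pnorm big_allpairs_dep /=.
  apply: (@le_trans _ _ (pnorm p * pnorm q)); last first.
    by apply: ler_pM => //; apply: sumr_ge0 => m _; exact: normc_ge0.
  rewrite /pnorm mulr_suml le_eqVlt; apply/orP; left; apply/eqP; apply: eq_bigr => m _.
  by rewrite mulr_sumr; apply: eq_bigr => m' _; rewrite normcM.
- move=> l; rewrite pE qE /peval big_allpairs_dep /= mulr_suml; apply: eq_bigr => m _.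
  by rewrite mulr_sumr; apply: eq_bigr => m' _; rewrite monomD; ring.
Qed.

Lemma homog_poly_cst (a : R[i]) : homog_poly 0 (nc a) (fun=> a).
Proof.
exists [:: (a, [ffun=> 0%N])]; split.
- by rewrite /homogeneous /= andbT /mdeg big1 // => X _; rewrite ffunE.
- by rewrite /pnorm big_seq1.
- by move=> l; rewrite /peval big_seq1 /monom big1 ?mulr1 // => X _; rewrite ffunE.
Qed.

Lemma homog_polyZ n K (a : R[i]) f : homog_poly n K f ->
  homog_poly n (nc a * K) (fun l => a * f l).
Proof. by move=> hf; have := homog_polyM (homog_poly_cst a) hf. Qed.

Lemma homog_poly_var X : X \in S -> homog_poly 1 1 (fun l => (l X)%:C).
Proof.
move=> XS; exists [:: (1, [ffun Y => (Y == X) : nat])]; split.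
- rewrite /homogeneous /= andbT /mdeg (bigD1 X) //= ffunE eqxx big1 // => Y /andP[_ /negPf YX].
  by rewrite ffunE YX.
- by rewrite /pnorm big_seq1 Normc.normc1.
- move=> l; rewrite /peval big_seq1 mul1r /monom (bigD1 X) //= ffunE eqxx expr1.
  by rewrite big1 ?mulr1 // => Y /andP[_ /negPf YX]; rewrite ffunE YX.
Qed.

Lemma homog_poly_ext n K f g : (forall l, f l = g l) -> homog_poly n K f -> homog_poly n K g.
Proof. by move=> fg [p [hp pK pE]]; exists p; split=> // l; rewrite -fg. Qed.

Definition pweight (eps : R) p : R := \sum_(m <- p) nc m.1 * eps ^+ mdeg m.2.

Lemma pweight_homog eps n p : homogeneous n p -> pweight eps p = pnorm p * eps ^+ n.
Proof.
move=> /allP hp; rewrite /pweight /pnorm mulr_suml [LHS]big_seq [RHS]big_seq; apply: eq_bigr => m.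
by move=> /hp /eqP ->.
Qed.

Lemma monom_le nu l (eps : R) : 0 <= eps -> (forall X, X \in S -> `|l X| <= eps) ->
  nc (monom nu l) <= eps ^+ mdeg nu.
Proof.
move=> e0 le; rewrite /monom normc_prod /mdeg -prodrXr; apply: ler_prod => X XS.
by rewrite normc_ge0 /= normcX normcC lerXn2r ?le // nnegrE.
Qed.

Lemma peval_le p l (eps : R) : 0 <= eps -> (forall X, X \in S -> `|l X| <= eps) ->
  nc (peval p l) <= pweight eps p.
Proof.
move=> e0 le; apply: le_trans (normc_sum _ _ _) _; apply: ler_sum => m _.
by rewrite normcM ler_wpM2l ?normc_ge0 // monom_le.
Qed.

Definition dterm X m : term :=
  (m.1 * (m.2 X)%:R, [ffun Y => if Y == X then (m.2 X).-1 else m.2 Y]).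

Definition dpoly X p := map (dterm X) p.

Definition setp X (x : R) l : {set V} -> R := fun Y => if Y == X then x else l Y.

Lemma monom_setp X nu x l : X \in S ->
  monom nu (setp X x l) = x%:C ^+ nu X * \prod_(Y in S | Y != X) (l Y)%:C ^+ nu Y.
Proof.
move=> XS; rewrite /monom (bigD1 X) //= /setp eqxx; congr (_ * _).
by apply: eq_bigr => Y /andP[_ /negPf ->].
Qed.

Lemma monom_dterm X m l : X \in S -> monom (dterm X m).2 l =
  (l X)%:C ^+ (m.2 X).-1 * \prod_(Y in S | Y != X) (l Y)%:C ^+ m.2 Y.
Proof.
move=> XS; rewrite /monom (bigD1 X) //= ffunE eqxx; congr (_ * _).
by apply: eq_bigr => Y /andP[_ /negPf YX]; rewrite ffunE YX.
Qed.

Lemma mdegD1 X nu : X \in S -> mdeg nu = (nu X + \sum_(Y in S | Y != X) nu Y)%N.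
Proof. by move=> XS; rewrite /mdeg (bigD1 X). Qed.

Lemma mdeg_dterm X m : X \in S ->
  mdeg (dterm X m).2 = ((m.2 X).-1 + \sum_(Y in S | Y != X) m.2 Y)%N.
Proof.
move=> XS; rewrite (mdegD1 _ XS) /= ffunE eqxx; congr (_ + _)%N.
by apply: eq_bigr => Y /andP[_ /negPf YX]; rewrite ffunE YX.
Qed.

Lemma pweight_dpoly X p (eps : R) : 0 < eps -> X \in S ->
  pweight eps (dpoly X p) <= pweight (eps + eps) p / eps.
Proof.
move=> e0 XS; rewrite ler_pdivlMr // /pweight big_map mulr_suml; apply: ler_sum => m _.
rewrite normcM normc_natr -!mulrA ler_wpM2l ?normc_ge0 //.
rewrite mdeg_dterm // (mdegD1 _ XS) !exprD.
set d := (\sum_(Y in S | _) _)%N.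
have ee : 0 <= eps + eps by rewrite addr_ge0 // ltW.
case: (m.2 X) => [|k]; first by rewrite mul0r mulr_ge0 ?exprn_ge0.
have -> : k.+1%:R * (eps ^+ k.+1.-1 * eps ^+ d * eps) = eps ^+ k *+ k.+1 * eps * eps ^+ d.
  by rewrite -[eps ^+ k *+ k.+1]mulr_natl /=; move: (k.+1%:R : R) (eps ^+ k) (eps ^+ d) => a b c; ring.
apply: ler_pM; rewrite ?exprn_ge0 ?mulr_ge0 ?mulrn_wge0 ?(ltW e0) //.
- by rewrite exprn_ge0 // ltW.
- by apply: bernoulli_le; exact: ltW.
- by rewrite lerXn2r // ?nnegrE ?(ltW e0) // lerDl ltW.
Qed.

Lemma peval_quadratic X p l (h eps : R) : 0 < eps -> X \in S ->
  (forall Y, Y \in S -> `|l Y| <= eps) -> `|h| <= eps ->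
  nc (peval p (setp X (l X + h) l) - peval p l - h%:C * peval (dpoly X p) l) <=
  (`|h| / eps) ^+ 2 * pweight (eps + eps) p.
Proof.
move=> e0 XS le he; rewrite /peval /dpoly big_map mulr_sumr -!sumrB /pweight mulr_sumr.
apply: le_trans (normc_sum _ _ _) _; apply: ler_sum => m _.
have lE : monom m.2 l = (l X)%:C ^+ m.2 X * \prod_(Y in S | Y != X) (l Y)%:C ^+ m.2 Y.
  by rewrite /monom (bigD1 X).
rewrite monom_setp // monom_dterm // lE; set P := \prod_(Y in S | _) _.
have P_le : nc P <= (eps + eps) ^+ (\sum_(Y in S | Y != X) m.2 Y)%N.
  rewrite normc_prod -prodrXr; apply: ler_prod => Y /andP[YS _].
  rewrite normc_ge0 /= normcX normcC lerXn2r ?nnegrE ?addr_ge0 ?(ltW e0) //.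
  by rewrite (le_trans (le Y YS)) // lerDl ltW.
rewrite rmorphD /=.
have alg (a x k y dx z u : R[i]) : a * (y * z) - a * (x * z) - u * (a * k * (dx * z)) =
    a * z * (y - x - u * (dx * k)) by ring.
rewrite alg !normcM mulr_natr (mdegD1 _ XS) exprD.
have q := @expr_quadratic _ (l X)%:C h%:C eps eps (m.2 X) e0.
rewrite normcC normcC in q; have {}q := q (le X XS) he.
have alg2 (a b c e : R) : a * (b * (c * e)) = b * e * (a * c) by ring.
rewrite alg2.
apply: ler_pM => //; rewrite ?mulr_ge0 ?normc_ge0 //.
by rewrite ler_wpM2l ?normc_ge0.
Qed.

Definition expansion f (ps : nat -> seq term) (eps K : R) : Prop :=
  (forall n, \sum_(i < n) pweight eps (ps i) <= K) /\
  forall l, (forall X, X \in S -> `|l X| < eps) -> csum (fun n => peval (ps n) l) (f l).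

Lemma expansion_ge0 f ps eps K : expansion f ps eps K -> 0 <= K.
Proof. by move=> [/(_ 0%N)]; rewrite big_ord0. Qed.

(** Term-by-term differentiation. Iterated derivatives are taken of functions, so each one has to be
    known on a neighbourhood of 0 and not only at 0; the polyradius halves each time but stays
    positive. *)
Lemma expansion_partial f ps eps K X : 0 < eps -> X \in S -> expansion f ps (eps + eps) K ->
  expansion (partial X f) (fun n => dpoly X (ps n)) eps (K / eps).
Proof.
move=> e0 XS fp; have K0 := expansion_ge0 fp; have [pK fE] := fp.
have dK n : \sum_(i < n) pweight eps (dpoly X (ps i)) <= K / eps.
  apply: (@le_trans _ _ ((\sum_(i < n) pweight (eps + eps) (ps i)) / eps)).
    by rewrite mulr_suml; apply: ler_sum => i _; exact: pweight_dpoly.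
  by rewrite ler_wpM2r ?invr_ge0 ?(ltW e0).
split=> // l le; have lle Y (YS : Y \in S) := ltW (le Y YS).
have [D DE] : exists D, csum (fun n => peval (dpoly X (ps n)) l) D.
  apply: (@csum_exists _ _ (K / eps)) => n; apply: le_trans (dK n).
  by apply: ler_sum => i _; apply: peval_le => //; exact: ltW.
suff -> : partial X f l = D by [].
have setpX : setp X (l X) l = l.
  by apply/funext => Y; rewrite /setp; case: eqP => [->|].
have [dRe dIm] : rderiv (fun s => f (setp X s l)) (l X) D.
  apply: (@rderiv_quadratic _ _ _ _ (K / eps ^+ 2) eps) => //.
    by rewrite divr_ge0 // exprn_ge0 // ltW.
  move=> h he.
  have c1 : csum (fun n => peval (ps n) (setp X (l X + h) l)) (f (setp X (l X + h) l)).
    apply: fE => Y YS; rewrite /setp; case: eqP => _.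
      by apply: le_lt_trans (ler_normD _ _) _; rewrite ltr_leD // le.
    by rewrite (lt_trans (le Y YS)) // ltrDl.
  have c2 : csum (fun n => peval (ps n) (setp X (l X) l)) (f (setp X (l X) l)).
    by rewrite setpX; apply: fE => Y YS; rewrite (lt_trans (le Y YS)) // ltrDl.
  have := csumB (csumB c1 c2) (csumZ h%:C DE); rewrite setpX; move/csum_le; apply => n.
  apply: (@le_trans _ _ ((`|h| / eps) ^+ 2 * (\sum_(i < n) pweight (eps + eps) (ps i)))).
    by rewrite mulr_sumr; apply: ler_sum => i _; exact: peval_quadratic.
  rewrite expr_div_n (_ : K / _ * _ = `|h| ^+ 2 / eps ^+ 2 * K).
    by rewrite ler_wpM2l // divr_ge0 // exprn_ge0 // ltW.
  by rewrite mulrC mulrA mulrAC.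
have -> : D = complex.Re D +i* complex.Im D by case: D {DE dRe dIm}.
by rewrite /partial !derive1E; congr (_ +i* _); exact: derive_val.
Qed.

Definition diter (mu : {set V} -> nat) p := foldr (fun X => iter (mu X) (dpoly X)) p (enum S).

Lemma expansion_iter f ps eps K X k : 0 < eps -> X \in S -> expansion f ps eps K ->
  exists eps' K', 0 < eps' /\
    expansion (iter k (partial X) f) (fun n => iter k (dpoly X) (ps n)) eps' K'.
Proof.
move=> e0 XS fp; elim: k => [|k [eps' [K' [e'0 IH]]]]; first by exists eps, K.
exists (eps' / 2), (K' / (eps' / 2)); split; first by rewrite divr_gt0.
by apply: expansion_partial => //; rewrite ?divr_gt0 // -splitr.
Qed.

Lemma expansion_cluster f ps eps K (mu : {set V} -> nat) : 0 < eps -> expansion f ps eps K ->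
  exists eps' K', 0 < eps' /\
    expansion (foldr (fun X => iter (mu X) (partial X)) f (enum S))
      (fun n => diter mu (ps n)) eps' K'.
Proof.
move=> e0 fp; rewrite /diter.
have : all (fun X => X \in S) (enum S) by apply/allP => X; rewrite mem_enum.
elim: (enum S) => [|X s IH] /=; first by exists eps, K.
move=> /andP[XS /IH [eps' [K' [e'0 h]]]].
exact: expansion_iter e'0 XS h.
Qed.

Lemma iter_dterm k X m : iter k (dterm X) m =
  (m.1 * ((m.2 X) ^_ k)%:R, [ffun Y => if Y == X then (m.2 X - k)%N else m.2 Y]).
Proof.
elim: k => [|k IH].
  rewrite ffactn0 mulr1 subn0 [LHS]surjective_pairing; congr (_, _).
  by apply/ffunP => Y; rewrite ffunE; case: eqP => [->|].
rewrite iterS IH /dterm /= !ffunE eqxx; congr (_, _).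
  by rewrite -mulrA -natrM ffactnSr.
by apply/ffunP => Y; rewrite !ffunE; case: eqP => // _; rewrite subnS.
Qed.

Lemma diterE (mu : {set V} -> nat) p : diter mu p = [seq
  (m.1 * (\prod_(X in S) (m.2 X) ^_ (mu X))%:R,
   [ffun Y => if Y \in S then (m.2 Y - mu Y)%N else m.2 Y]) | m <- p].
Proof.
have iter_map k X q : iter k (dpoly X) q = map (iter k (dterm X)) q.
  elim: k => [|k IH]; first by rewrite map_id.
  by rewrite iterS IH /dpoly -map_comp.
rewrite /diter.
have -> : [seq (m.1 * (\prod_(X in S) (m.2 X) ^_ (mu X))%:R,
    [ffun Y => if Y \in S then (m.2 Y - mu Y)%N else m.2 Y]) | m <- p] =
  [seq (m.1 * (\prod_(X <- enum S) (m.2 X) ^_ (mu X))%:R,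
    [ffun Y => if Y \in enum S then (m.2 Y - mu Y)%N else m.2 Y]) | m <- p].
  apply: eq_map => m; rewrite big_enum; congr (_, _).
  by apply/ffunP => Y; rewrite !ffunE mem_enum.
elim: (enum S) (enum_uniq S) => [_|X s IH /= /andP[Xs us]].
  rewrite /= -[LHS]map_id; apply: eq_map => m; rewrite big_nil mulr1 [LHS]surjective_pairing.
  by congr (_, _); apply/ffunP => Y; rewrite ffunE.
rewrite IH // iter_map -map_comp; apply: eq_map => m /=.
rewrite iter_dterm /= !ffunE (negPf Xs); congr (_, _).
  by rewrite -mulrA -natrM big_cons mulnC.
apply/ffunP => Y; rewrite !ffunE inE; case: eqP => [->|] //=.
Qed.

Lemma peval_diter0 (mu : {set V} -> nat) p : peval (diter mu p) (fun=> 0) =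
  \sum_(m <- p) m.1 * (\prod_(X in S) ((m.2 X == mu X)%:R * (mu X)`!%:R)).
Proof.
rewrite /peval diterE big_map; apply: eq_bigr => m _.
rewrite -mulrA; congr (_ * _); rewrite natr_prod /monom -big_split.
apply: eq_bigr => X XS; rewrite ffunE XS.
(* Too small an exponent is killed by the falling factorial, too large a one by evaluation at 0. *)
have [lt|gt|<-] := ltngtP (m.2 X) (mu X).
- by rewrite ffact_small //= mulr0n !mul0r.
- by rewrite rmorph0 expr0n subn_eq0 leqNgt gt /= !mulr0n mulr0 mul0r.
- by rewrite subnn ffactnn mulrC.
Qed.

Lemma peval_diter0_eq0 (mu : {set V} -> nat) n p : homogeneous n p ->
  (\sum_(X in S) mu X)%N != n -> peval (diter mu p) (fun=> 0) = 0.
Proof.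
move=> /allP hp mun; rewrite peval_diter0 big_seq big1 // => m mp.
have [/forallP h|] := boolP [forall X, (X \in S) ==> (m.2 X == mu X)].
  case/eqP: mun; rewrite -(eqP (hp _ mp)); apply: eq_bigr => X XS.
  by have := h X; rewrite XS => /eqP ->.
rewrite negb_forall => /existsP[X]; rewrite negb_imply => /andP[XS /negPf Xm].
by rewrite (bigD1 X) //= Xm !mul0r mulr0.
Qed.

(** At 0 only monomials with exponents exactly [mu] survive, so the differentiated series has a
    single nonzero term, that of degree [\sum_(X in S) mu X]. *)
Lemma cluster_derivativeE f ps eps K (mu : {set V} -> nat) : 0 < eps ->
  expansion f ps eps K -> (forall n, homogeneous n (ps n)) ->
  cluster_derivative S mu f = peval (diter mu (ps (\sum_(X in S) mu X)%N)) (fun=> 0).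
Proof.
move=> e0 fp hp; have [eps' [K' [e'0 [_ h]]]] := expansion_cluster mu e0 fp.
have e0' X : X \in S -> `|(fun=> 0 : R) X| < eps' by rewrite normr0.
set n := (\sum_(X in S) mu X)%N; apply: (csum_unique (h _ e0')).
have zero i : i != n -> peval (diter mu (ps i)) (fun=> 0) = 0.
  by move=> ni; apply: (peval_diter0_eq0 (hp i)); rewrite eq_sym.
have -> : peval (diter mu (ps n)) (fun=> 0) =
    \sum_(i < n.+1) peval (diter mu (ps i)) (fun=> 0).
  rewrite big_ord_recr big1 => [|i _]; first by apply/esym; exact: add0r.
  by rewrite zero //= neq_ltn ltn_ord.
apply: (@csum_eventually R (fun i => peval (diter mu (ps i)) (fun=> 0))) => i ni.
by rewrite zero // neq_ltn ni orbT.
Qed.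

Lemma taylor_homogeneous n p (lam : {set V} -> R) : homogeneous n p ->
  \sum_(W : {ffun {set V} -> 'I_n.+1} |
      [forall X, (X \notin S) ==> (W X == 0 :> nat)] && ((\sum_(X in S) W X)%N == n))
    (cluster_monomial S (fun X => W X) lam / (cluster_factorial S (fun X => W X))%:R)%:C *
      peval (diter (fun X => W X) p) (fun=> 0) = peval p lam.
Proof.
move=> /allP hp; under eq_bigr do rewrite peval_diter0 mulr_sumr.
rewrite exchange_big /peval /= [LHS]big_seq [RHS]big_seq; apply: eq_bigr => m mp.
have mn : mdeg m.2 = n by apply/eqP; exact: hp.
have m_le X : X \in S -> (m.2 X < n.+1)%N.
  by move=> XS; rewrite ltnS -mn (mdegD1 _ XS) leq_addr.
(* The only cluster that sees the monomial [m]. Exponents outside [S] do not enter [monom] and are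
   set to 0, as the index set of the sum requires. *)
pose W0 : {ffun {set V} -> 'I_n.+1} := [ffun X => if X \in S then inord (m.2 X) else ord0].
have W0E X : X \in S -> W0 X = m.2 X :> nat by move=> XS; rewrite ffunE XS inordK ?m_le.
rewrite (bigD1 W0) /=; last first.
  apply/andP; split.
    by apply/forallP => X; apply/implyP => /negPf XS; rewrite ffunE XS.
  by rewrite -[X in _ == X]mn; apply/eqP; apply: eq_bigr => X XS; rewrite W0E.
rewrite [X in _ + X]big1 => [|W /=]; last first.
  move=> /andP[/andP[/forallP W_S _] WW0].
  have [/forallP h|] := boolP [forall X, (X \in S) ==> (m.2 X == W X)].
    case/eqP: WW0; apply/ffunP => X; apply: val_inj; rewrite /=.
    case: (boolP (X \in S)) => XS; first by rewrite W0E //; have := h X; rewrite XS => /eqP.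
    by have := W_S X; rewrite XS ffunE (negPf XS) => /eqP.
  rewrite negb_forall => /existsP[X]; rewrite negb_imply => /andP[XS /negPf Xm].
  by rewrite (bigD1 X) //= Xm !mul0r !mulr0.
rewrite addr0 mulrCA; congr (_ * _).
have -> : \prod_(X in S) ((m.2 X == W0 X)%:R * (W0 X)`!%:R) =
    (cluster_factorial S (fun X => W0 X))%:R :> R[i].
  rewrite /cluster_factorial natr_prod; apply: eq_bigr => X XS.
  by rewrite -W0E // eqxx mul1r.
rewrite -[(cluster_factorial _ _)%:R in X in _ * X](rmorph_nat (real_complex R)) -rmorphM.
rewrite divfK; last first.
  by rewrite pnatr_eq0 -lt0n prodn_gt0 // => X; rewrite fact_gt0.
rewrite /cluster_monomial /monom rmorph_prod; apply: eq_bigr => X XS.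
by rewrite rmorphXn W0E.
Qed.

End Polynomials.

(** * The principal logarithm, and log L as a power series in the couplings *)

Section ComplexLog.
Variable R : realType.
Local Notation nc := (@Normc.normc R).

Lemma cos_eq1 (x : R) : `|x| < 2 * pi -> cos x = 1 -> x = 0.
Proof.
move=> x2pi; rewrite -cos_norm => c1; apply/eqP; rewrite -normr_eq0.
apply: contraT => x0; have x_gt0 : 0 < `|x| by rewrite lt_def x0 normr_ge0.
have s0 : 0 < sin (`|x| / 2).
  by apply: sin_gt0_pi; rewrite divr_gt0 //= ltr_pdivrMr // mulrC.
have := cosD (`|x| / 2) (`|x| / 2); rewrite -splitr c1.
have := cos2Dsin2 (`|x| / 2); have := mulr_gt0 s0 s0.
by rewrite !expr2 => *; lra.
Qed.

(** [nc w < pi] puts [w] in the principal strip. Two logarithms of one number in that strip differ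
    by an imaginary number of modulus below 2 pi with cosine 1, hence by 0. *)
Lemma clog_cexp (w : R[i]) : nc w < pi -> clog (cexp w) = w.
Proof.
move=> wpi; have Iw : `|complex.Im w| < pi by apply: le_lt_trans (normc_geIm w) wpi.
apply: xget_unique.
  by split=> //; move: Iw; rewrite ltr_norml => /andP[-> /ltW ->].
move=> w' [ww' /andP[w'1 w'2]].
have E : cexp (w' - w) = 1 by rewrite cexpD ww' -cexpD subrr cexp0.
move: E; case: w w' wpi Iw ww' w'1 w'2 => a b [a' b'] /= _ Ib _ b1 b2.
rewrite /cexp /= => /eqP; rewrite eq_complex /= !mul0r subr0 addr0 => /andP[/eqP E1 /eqP E2].
have e0 := expR_gt0 (a' - a).
have s0 : sin (b' - b) = 0 by move/eqP: E2; rewrite mulf_eq0 gt_eqF //= => /eqP.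
have cc : cos (b' - b) ^+ 2 = 1 by have := cos2Dsin2 (b' - b); rewrite s0 expr0n addr0.
have c1 : cos (b' - b) = 1.
  have /eqP := cc; rewrite sqrf_eq1 => /orP[/eqP //|/eqP cN].
  by move: E1 (ltr01 : 0 < (1 : R)); rewrite cN mulrN1 => <-; rewrite oppr_gt0 ltNge ltW.
have eab : expR (a' - a) = 1 by rewrite c1 mulr1 in E1.
have aa : a' - a = 0 by apply: expR_inj; rewrite eab expR0.
have bb : b' - b = 0.
  apply: cos_eq1 => //; rewrite mulr_natl mulr2n.
  apply: le_lt_trans (ler_normB _ _) _; rewrite ler_ltD // ler_norml b2 andbT.
  exact: ltW.
by move/eqP: aa; move/eqP: bb; rewrite !subr_eq0 => /eqP -> /eqP ->.
Qed.

End ComplexLog.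

Section LogExpansion.
Variables (R : realType) (V : finType) (d : nat).
Local Notation nc := (@Normc.normc R).
Variables (S : {set {set V}}) (h : {set V} -> operator R V d) (rv : V -> 'M[R[i]]_d).
Implicit Types (l : {set V} -> R).

Let K0 : R := \sum_(X in S) entry_norm (h X).

Let K0_ge0 : 0 <= K0.
Proof. by apply: sumr_ge0 => X _; exact: entry_norm_ge0. Qed.

(** [B] is arbitrary so that the induction can absorb the last letter [h X] of a word into it. *)
Lemma trace_homog n (B : operator R V d) :
  homog_poly S n (K0 ^+ n * entry_norm B) (fun l => \tr (hamiltonian S l h ^+ n *m B)).
Proof.
elim: n B => [|n IH] B.
  rewrite expr0 mul1r; apply: homog_polyW (entry_norm_trace B) _.
  apply: homog_poly_ext (homog_poly_cst S (\tr B)) => l.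
  by rewrite expr0 mul1mx.
apply: (@homog_polyW _ _ _ _ (\sum_(X in S) 1 * (K0 ^+ n * entry_norm (h X *m B)))).
  under eq_bigr do rewrite mul1r.
  rewrite -mulr_sumr exprSr -mulrA ler_wpM2l ?exprn_ge0 // /K0 mulr_suml.
  by apply: ler_sum => X _; exact: entry_normM.
apply: (@homog_poly_ext _ _ _ _ _ (fun l => \sum_(X in S)
    (l X)%:C * \tr (hamiltonian S l h ^+ n *m (h X *m B)))).
  move=> l; rewrite exprSr -[hamiltonian S l h ^+ n * _]/(_ *m _) -mulmxA.
  rewrite [X in _ = \tr (_ *m X)]mulmx_suml mulmx_sumr raddf_sum; apply: eq_bigr => X _.
  by rewrite /= -scalemxAl -scalemxAr mxtraceZ.
apply: homog_poly_sum => X XS; rewrite -[n.+1]add1n.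
exact: homog_polyM (homog_poly_var R XS) (IH (h X *m B)).
Qed.

Lemma trace_coef_homog n : (0 < n)%N ->
  homog_poly S n ((K0 * (entry_norm (tens rv) + 1)) ^+ n) (fun l => trace_coef h rv S l n).
Proof.
move=> n0; apply: homog_polyW (homog_polyZ ((- 'i) ^+ n / n`!%:R) (trace_homog n (tens rv))).
rewrite normcM normcX normc_i expr1n mul1r normcV normc_natr.
have E1 : 1 <= entry_norm (tens rv) + 1 by rewrite lerDr entry_norm_ge0.
apply: (@le_trans _ _ (1 * (K0 ^+ n * entry_norm (tens rv)))).
  by rewrite ler_wpM2r ?mulr_ge0 ?exprn_ge0 ?entry_norm_ge0 // invf_le1 ?ltr0n ?ler1n fact_gt0.
rewrite mul1r exprMn ler_wpM2l ?exprn_ge0 //.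
(* The added 1 makes the base at least 1, so for [0 < n] the [n]-th power absorbs the single factor
   [entry_norm (tens rv)]. *)
apply: (@le_trans _ _ (entry_norm (tens rv) + 1)); first by rewrite lerDl.
by rewrite -[leLHS]expr1 ler_weXn2l.
Qed.

(** Geometric growth is enough, since only small couplings matter here. The recursion for [dlog]
    raises the rate by the factor 4 because n + sum_(j < n) 4^j <= 4^n. *)
Lemma homog_dlog (z : ({set V} -> R) -> nat -> R[i]) (b : R) : 0 <= b ->
  (forall n, (0 < n)%N -> homog_poly S n (b ^+ n) (fun l => z l n)) ->
  forall n, homog_poly S n ((4 * b) ^+ n) (fun l => dlog (z l) n).
Proof.
move=> b0 zb n; have [m] := ubnP n; elim: m n => // m IH n nm.
case: n nm => [|n] nm.
  apply: homog_polyW ler01 _; apply: homog_poly_ext (homog_poly0 R S 0) => l.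
  by rewrite dlog0.
have sum_homog : homog_poly S n.+1 (\sum_(j < n.+1) (4 * b) ^+ j * b ^+ (n.+1 - j))
    (fun l => \sum_(j < n.+1) dlog (z l) j * z l (n.+1 - j)%N).
  apply: homog_poly_sum => j _; rewrite -[X in homog_poly S X](subnKC (ltnW (ltn_ord j))).
  have jn : (0 < n.+1 - j)%N by rewrite subn_gt0.
  by apply: homog_polyM (IH j _) (zb _ jn); exact: leq_trans (ltn_ord j) _.
have := homog_polyD (homog_polyZ n.+1%:R (zb n.+1 isT)) (homog_polyZ (-1) sum_homog).
move=> /(homog_poly_ext (g := fun l => dlog (z l) n.+1)) dh.
apply: homog_polyW (dh _) => [|l]; last by rewrite [RHS]dlogE mulr_natl mulN1r.
rewrite normc_natr normcN Normc.normc1 mul1r exprMn.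
have four : (n.+1 + \sum_(j < n.+1) 4 ^ j <= 4 ^ n.+1)%N.
  elim: (n.+1) => [|k IHk]; first by rewrite big_ord0.
  have : (0 < 4 ^ k)%N by rewrite expn_gt0.
  by rewrite big_ord_recr /= expnS; move: (4 ^ k)%N (\sum_(i < k) 4 ^ i)%N IHk => a c; lia.
have -> : \sum_(j < n.+1) (4 * b) ^+ j * b ^+ (n.+1 - j) =
    (\sum_(j < n.+1) 4 ^+ j) * b ^+ n.+1.
  rewrite mulr_suml; apply: eq_bigr => j _.
  by rewrite exprMn -mulrA -exprD subnKC // ltnW.
rewrite -mulrDl ler_wpM2r ?exprn_ge0 //.
by move: four; rewrite -(ler_nat R) natrD natr_sum natrX; under eq_bigr do rewrite natrX.
Qed.

Lemma flog_expansion (t : R[i]) : exists2 q : R, 0 < q & exists ps : nat -> seq _,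
  [/\ forall n, homogeneous S n (ps n),
      forall n, pnorm (ps n) <= q ^+ n &
      forall n l, flog (trace_coef h rv S l) n * t ^+ n = peval S (ps n) l].
Proof.
pose b := K0 * (entry_norm (tens rv) + 1).
have b0 : 0 <= b by rewrite mulr_ge0 // addr_ge0 // entry_norm_ge0.
have b4 : 0 <= 4 * b by exact: mulr_ge0.
have bt0 : 0 <= 4 * b * nc t by apply: mulr_ge0 => //; exact: normc_ge0.
exists (4 * b * nc t + 1); first exact: ltr_wpDl.
have ex n : exists p, [/\ homogeneous S n p, pnorm p <= (4 * b * nc t + 1) ^+ n &
    forall l, flog (trace_coef h rv S l) n * t ^+ n = peval S p l].
  have [p [hp pK pE]] := homog_polyZ (t ^+ n / n%:R) (homog_dlog b0 trace_coef_homog n).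
  exists p; split=> // [|l]; last by rewrite -pE /flog; ring.
  apply: le_trans pK _; rewrite normcM normcX normcV normc_natr.
  apply: (@le_trans _ _ ((4 * b * nc t) ^+ n)).
    rewrite [leRHS]exprMn [leLHS]mulrC ler_wpM2l ?exprn_ge0 //.
    rewrite ler_piMr ?exprn_ge0 ?normc_ge0 //.
    by case: n {hp pE p} => [|n]; rewrite ?invr0 // invf_le1 ?ltr0n ?ler1n.
  by rewrite lerXn2r ?lerDl // nnegrE // addr_ge0.
have /choice[ps psP] := ex; exists ps.
by split=> n; have [] := psP n.
Qed.

Hypothesis h_local : forall X, X \in S -> local_op X (h X).
Hypothesis h_contr : forall X, X \in S -> forall v, vnorm (h X *m v) <= vnorm v.
Hypothesis rv_density : forall v, density_operator (rv v).
Hypothesis deg_ge1 : (1 <= max_degree S)%N.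
Local Notation tL := (cluster_radius ((max_degree S)%:R : R)).
Local Notation c l := (flog (trace_coef h rv S l)).

Lemma flog_psbound l : (forall X, X \in S -> `|l X| <= 1) -> psbound (c l) tL #|S|%:R.
Proof. by move=> l1 n; exact: log_coef_sum_le. Qed.

Lemma cexp_loschmidt l t : (forall X, X \in S -> `|l X| <= 1) -> nc t < tL ->
  cexp (psum (c l) t) = loschmidt S h (tens rv) l t.
Proof.
move=> l1 tr; have r0 : 0 <= tL by exact: le_trans (normc_ge0 t) (ltW tr).
have [K zK] := trace_coef_bound S h rv l r0.
rewrite loschmidt_psum; apply: (cexp_flog _ tr (flog_psbound l1) zK).
by apply: trace_coef0 => v; exact: rv_density.
Qed.

(** Cluster derivatives see [clog] only near zero couplings, where log L is small and the principal
    branch is the analytic one. The time [t] may still be anywhere in the disc. *)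
Lemma clog_expansion t : nc t < tL -> exists ps : nat -> seq _, exists eps K : R,
  [/\ 0 < eps, expansion S (fun l => clog (loschmidt S h (tens rv) l t)) ps eps K,
    forall n, homogeneous S n (ps n) &
    forall n l, c l n * t ^+ n = peval S (ps n) l].
Proof.
move=> tr; have [q q0 [ps [ps_hom ps_le psE]]] := flog_expansion t.
(* Chosen so that [q * eps <= 1 / 2], which makes the homogeneous parts decay geometrically, and
   [eps <= 1], which keeps the couplings in the range of [flog_psbound]. *)
pose eps := (2 * q + 1)^-1.
have q1 : 0 < 2 * q + 1 by rewrite addr_gt0 // mulr_gt0.
have eps0 : 0 < eps by rewrite invr_gt0.
have eps1 : eps <= 1 by rewrite invf_le1 // lerDr mulr_ge0 // ltW.
have qe : q * eps <= 2^-1.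
  rewrite ler_pdivrMr // mulrDr mulrA mulVf // mul1r mulr1 lerDl invr_ge0 //.
have weight_le n : pweight S eps (ps n) <= 2^-1 ^+ n.
  rewrite (pweight_homog _ (ps_hom n)).
  apply: (@le_trans _ _ (q ^+ n * eps ^+ n)).
    by rewrite ler_wpM2r ?exprn_ge0 // ltW.
  rewrite -exprMn lerXn2r // nnegrE ?invr_ge0 //.
  by rewrite mulr_ge0 // ltW.
have geo n : \sum_(i < n) (2^-1 : R) ^+ i.+1 <= 1.
  suff -> : \sum_(i < n) (2^-1 : R) ^+ i.+1 = 1 - 2^-1 ^+ n by rewrite gerBl exprn_ge0.
  elim: n => [|n IH]; first by rewrite big_ord0 expr0 subrr.
  rewrite big_ord_recr /= IH exprS; move: (2^-1 ^+ n) => a.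
  by rewrite -addrA; congr (_ + _); rewrite {1}[a]splitr opprD mulrC -addrA addNr addr0.
exists ps, eps, 2; split=> //; split=> [n|l le].
  apply: (@le_trans _ _ (\sum_(i < n.+1) 2^-1 ^+ i)).
    rewrite big_ord_recr /=; apply: (@le_trans _ _ (\sum_(i < n) 2^-1 ^+ i)); last first.
      by rewrite lerDl exprn_ge0.
    by apply: ler_sum => i _.
  by rewrite big_ord_recl expr0 -[leRHS]/(1 + 1) lerD2l.
have l1 X : X \in S -> `|l X| <= 1.
  by move=> XS; apply: le_trans (ltW (le X XS)) eps1.
have cl := psum_csum (flog_psbound l1) (ltW tr).
have sE : (fun n => peval S (ps n) l) = (fun n => c l n * t ^+ n).
  by apply/funext => n; rewrite psE.
rewrite sE -cexp_loschmidt // clog_cexp //.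
(* The part of degree 0 vanishes, so the sum is at most 1/2 + 1/4 + ... = 1 < pi. *)
apply: (@le_lt_trans _ _ 1); last by apply: lt_le_trans (pi_ge2 R); rewrite ltr1n.
apply: (csum_le cl) => -[|n]; first by rewrite big_ord0.
rewrite big_ord_recl /flog invr0 mulr0 mul0r Normc.normc0 add0r; apply: le_trans (geo n).
apply: ler_sum => i _; apply: le_trans (weight_le i.+1); rewrite -/(c l _) psE.
by apply: peval_le => [|X XS]; [exact: ltW|exact: ltW (le X XS)].
Qed.

End LogExpansion.

(** * Disconnected clusters *)

Section SeparatedVariables.
Variables (R : realType) (V : finType) (T1 T2 : {set {set V}}).
Hypothesis T12 : [disjoint T1 & T2].
Implicit Types (X Y : {set V}) (l : {set V} -> R) (f g : ({set V} -> R) -> R[i]).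

(** Other subsystems may overlap both sides, so the splitting only holds where their couplings
    vanish. Derivatives along [T1] and [T2] do not leave this subspace. *)
Definition supported l := forall X, X \notin T1 :|: T2 -> l X = 0.

Definition ignores (T : {set {set V}}) g :=
  forall l l', (forall X, X \notin T -> l X = l' X) -> g l = g l'.

(* b1 (b2) records that a derivative along T1 (along T2) has been taken. *)
Definition separated (b1 b2 : bool) f := exists g1 g2,
  [/\ ignores T2 g1, ignores T1 g2, (b2 -> forall l, g1 l = 0),
      (b1 -> forall l, g2 l = 0) & forall l, supported l -> f l = g1 l + g2 l].

Definition cderive1 (u : R -> R[i]) (x : R) : R[i] :=
  derive1 (fun s => complex.Re (u s)) x +i* derive1 (fun s => complex.Im (u s)) x.

Lemma partialE X f l : partial X f l = cderive1 (fun s => f (setp X s l)) (l X).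
Proof. by []. Qed.

Lemma partial_ext X f g l : (forall s, f (setp X s l) = g (setp X s l)) ->
  partial X f l = partial X g l.
Proof. by move=> fg; rewrite !partialE (funext fg). Qed.

Lemma partial_cst X (a : R[i]) l : partial X (fun=> a) l = 0.
Proof. by rewrite /partial !derive1_cst. Qed.

(** The difference quotients coincide, so the values agree whether or not the derivative exists. *)
Lemma cderive1D_cst (u : R -> R[i]) (a : R[i]) x :
  cderive1 (fun s => u s + a) x = cderive1 u x.
Proof.
have dc (v : R -> R) (b : R) : derive1 (fun s => v s + b) x = derive1 v x.
  rewrite /derive1 (_ : (fun k => _) = (fun k => k^-1 *: (v (k + x) - v x))) //.
  by apply/funext => k; rewrite opprD addrACA subrr addr0.
have ReE : (fun s => complex.Re (u s + a)) = (fun s => complex.Re (u s) + complex.Re a).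
  by apply/funext => s; case: (u s) a => ? ? [? ?].
have ImE : (fun s => complex.Im (u s + a)) = (fun s => complex.Im (u s) + complex.Im a).
  by apply/funext => s; case: (u s) a {ReE} => ? ? [? ?].
by rewrite /cderive1 ReE ImE !dc.
Qed.

Lemma partialD_cst X g (a : R[i]) l : partial X (fun l => g l + a) l = partial X g l.
Proof. by rewrite !partialE cderive1D_cst. Qed.

Lemma supported_setp X s l : X \in T1 :|: T2 -> supported l -> supported (setp X s l).
Proof.
move=> XT sl Y YT; rewrite /setp; case: eqP => [YX|_]; last exact: sl.
by rewrite YX XT in YT.
Qed.

Lemma ignores_partial T X g : ignores T g -> ignores T (partial X g).
Proof.
move=> ig l l' ll'; have [XT|XT] := boolP (X \in T).
  have cst k : partial X g k = 0.
    rewrite -(partial_cst X (g k) k); apply: partial_ext => s; apply: ig => Y YT.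
    by rewrite /setp; case: eqP => // YX; rewrite YX XT in YT.
  by rewrite !cst.
have e : (fun s => g (setp X s l)) = (fun s => g (setp X s l')).
  apply/funext => s; apply: ig => Y YT; rewrite /setp; case: eqP => // _.
  exact: ll'.
by rewrite !partialE e ll'.
Qed.

End SeparatedVariables.

Lemma ignores_setp (R : realType) (V : finType) (T : {set {set V}}) X s
  (g : ({set V} -> R) -> R[i]) l : X \in T -> ignores T g -> g (setp X s l) = g l.
Proof.
move=> XT; apply => Y YT; rewrite /setp; case: eqP => // YX.
by rewrite YX XT in YT.
Qed.

Section SeparatedDerivatives.
Variables (R : realType) (V : finType).
Implicit Types (X Y : {set V}) (l : {set V} -> R) (f g : ({set V} -> R) -> R[i]).

Lemma separatedC (T1 T2 : {set {set V}}) b1 b2 f : separated T1 T2 b1 b2 f -> separated T2 T1 b2 b1 f.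
Proof.
move=> [g1 [g2 [i1 i2 z1 z2 fE]]]; exists g2, g1; split=> // l sl.
by rewrite fE 1?addrC // => X; rewrite finset.setUC; exact: sl.
Qed.

(** [g2] is constant in the coupling of [X] and drops out, and a vanishing [g1] stays vanishing. *)
Lemma separated_partial1 (T1 T2 : {set {set V}}) b1 b2 f X : X \in T1 ->
  separated T1 T2 b1 b2 f -> separated T1 T2 true b2 (partial X f).
Proof.
move=> XT1 [g1 [g2 [i1 i2 z1 z2 fE]]].
exists (partial X g1), (fun=> 0); split=> //.
- exact: ignores_partial.
- move=> /z1 g10 l; rewrite -[RHS](partial_cst X 0 l); apply: partial_ext => s.
  by rewrite g10.
- move=> l sl; rewrite addr0 -[RHS](partialD_cst X g1 (g2 l)).
  apply: partial_ext => s; rewrite fE; last by apply: supported_setp; rewrite // inE XT1.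
  by rewrite (ignores_setp _ _ XT1 i2).
Qed.

Lemma separated_partial2 (T1 T2 : {set {set V}}) b1 b2 f X : X \in T2 ->
  separated T1 T2 b1 b2 f -> separated T1 T2 b1 true (partial X f).
Proof. by move=> XT2 /separatedC /(separated_partial1 XT2) /separatedC. Qed.

Lemma separated_foldr (T1 T2 : {set {set V}}) (mu : {set V} -> nat) f s : [disjoint T1 & T2] ->
  (forall X, (0 < mu X)%N -> X \in T1 :|: T2) -> separated T1 T2 false false f ->
  separated T1 T2 (has (fun X => (0 < mu X)%N && (X \in T1)) s)
    (has (fun X => (0 < mu X)%N && (X \in T2)) s)
    (foldr (fun X => iter (mu X) (partial X)) f s).
Proof.
move=> dT muT sf; elim: s => //= X s.
set b1 := has _ s; set b2 := has _ s; set g := foldr _ _ _ => sg.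
case E : (mu X) => [|k] //=.
have := muT X; rewrite E => /(_ isT); rewrite inE => /orP[XT|XT].
  rewrite XT (disjointFr dT XT) /=; elim: k {E} => [|k IH] /=.
    exact: separated_partial1 sg.
  exact: separated_partial1 IH.
rewrite XT (disjointFl dT XT) /=; elim: k {E} => [|k IH] /=.
  exact: separated_partial2 sg.
exact: separated_partial2 IH.
Qed.

(** The derivative along [A] removes the summand that ignores [T1], the one along [B] the summand
    that ignores [T2]. *)
Lemma cluster_derivative_separated (S T1 T2 : {set {set V}}) (mu : {set V} -> nat) f A B :
  [disjoint T1 & T2] -> (forall X, (0 < mu X)%N -> X \in T1 :|: T2) ->
  A \in S -> A \in T1 -> (0 < mu A)%N -> B \in S -> B \in T2 -> (0 < mu B)%N ->
  separated T1 T2 false false f -> cluster_derivative S mu f = 0.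
Proof.
move=> dT muT AS AT Amu BS BT Bmu sf.
have [g1 [g2 [_ _ z1 z2 fE]]] := separated_foldr (enum S) dT muT sf.
rewrite /cluster_derivative fE // z1 ?z2 ?addr0 //; apply/hasP.
- by exists A; rewrite ?mem_enum // Amu.
- by exists B; rewrite ?mem_enum // Bmu.
Qed.

Lemma cluster_derivative_null (S T : {set {set V}}) (mu : {set V} -> nat) f :
  (forall X, (0 < mu X)%N -> X \in T) ->
  (forall l, (forall X, X \notin T -> l X = 0) -> f l = 0) -> cluster_derivative S mu f = 0.
Proof.
move=> muT f0; rewrite /cluster_derivative.
suff : forall l, (forall X, X \notin T -> l X = 0) ->
    foldr (fun X => iter (mu X) (partial X)) f (enum S) l = 0 by apply.
elim: (enum S) => [//|X s /=]; set g := foldr _ _ _ => g0.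
case E : (mu X) => [|k] //.
have XT : X \in T by apply: muT; rewrite E.
elim: k.+1 => [//|j IH] l sl /=; rewrite -[RHS](partial_cst X 0 l).
apply: partial_ext => x; apply: IH => Y YT; rewrite /setp; case: eqP => [YX|_].
  by rewrite YX XT in YT.
exact: sl.
Qed.

End SeparatedDerivatives.

Section AdditiveLog.
Variable R : realType.
Implicit Types a b : nat -> R[i].

(** [theta] is a derivation, so logarithmic derivatives of products add up; truncating at [n.+1]
    allows the computation to take place in polynomials. *)
Lemma dlog_conv a b n : a 0%N = 1 -> b 0%N = 1 ->
  dlog (fun n => \sum_(j < n.+1) a j * b (n - j)%N) n = dlog a n + dlog b n.
Proof.
move=> a0 b0; apply/esym; set ab := fun n => _.
have ab0 : ab 0%N = 1 by rewrite /ab big_ord1 a0 b0 mulr1.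
apply: (@dlog_unique _ ab (fun n => dlog a n + dlog b n) n.+1) => // m mn.
pose N := n.+1; pose P (u : nat -> R[i]) : {poly R[i]} := \poly_(i < N) u i.
have PE u i : (i < N)%N -> (P u)`_i = u i by move=> iN; rewrite coef_poly iN.
have conv u v i : (i < N)%N -> (P u * P v)`_i = \sum_(j < i.+1) u j * v (i - j)%N.
  move=> iN; rewrite coefM; apply: eq_bigr => j _; have ji : (j <= i)%N by rewrite -ltnS.
  by rewrite !PE // ?(leq_ltn_trans ji) // (leq_ltn_trans (leq_subr _ _)).
have thP u : u 0%N = 1 -> teq N (theta (P u)) (P (dlog u) * P u).
  by move=> u0 i iN; rewrite coef_theta conv // PE // dlogP.
have abE : teq N (P ab) (P a * P b) by move=> i iN; rewrite PE // conv.
have := teq_theta abE mn; rewrite coef_theta PE // => ->.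
transitivity ((P (fun n => dlog a n + dlog b n) * P ab)`_m).
  by apply: esym; exact: conv.
have H : teq N (P (fun n => dlog a n + dlog b n) * P ab) (theta (P a * P b)).
  have E1 : teq N (P (fun n => dlog a n + dlog b n)) (P (dlog a) + P (dlog b)).
    by move=> i iN; rewrite coefD !PE.
  apply: teq_trans (teqM E1 abE) _; rewrite thetaM.
  have -> : (P (dlog a) + P (dlog b)) * (P a * P b) =
    P (dlog a) * P a * P b + P a * (P (dlog b) * P b) by ring.
  by apply: teqD; apply: teqM => //; apply: teq_sym; exact: thP.
exact: H.
Qed.

Lemma dlog_exp (w : R[i]) n : (1 < n)%N -> dlog (fun n => w ^+ n / n`!%:R) n = 0.
Proof.
move=> n1; set z := fun n => _; have z0 : z 0%N = 1 by rewrite /z expr0 fact0 invr1 mulr1.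
rewrite -(@dlog_unique _ z (fun n => if n == 1%N then w else 0) n.+1) //.
  by rewrite gtn_eqF.
move=> [|m] mn; first by rewrite big_ord1 mul0r mulr0n.
rewrite 2!big_ord_recl /= mul0r add0r big1 => [|i _]; last by rewrite mul0r.
rewrite addr0 /bump /= subSS subn0 /z exprS factS natrM.
have m0 : (m.+1)%:R != 0 :> R[i] by rewrite pnatr_eq0.
have mf : (m`!)%:R != 0 :> R[i] by rewrite pnatr_eq0 -lt0n fact_gt0.
have alg (x y p q : R[i]) : p != 0 -> q != 0 -> x * (y / q) = x * y / (p * q) * p.
  by move=> p0 q0; field; rewrite p0 q0.
by rewrite -[RHS]mulr_natr; exact: alg.
Qed.

End AdditiveLog.

Section Disconnected.
Import fintype boot.finset.
Variables (R : realType) (V : finType) (d : nat).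
Local Notation nc := (@Normc.normc R).
Variables (S : {set {set V}}) (h : {set V} -> operator R V d) (rv : V -> 'M[R[i]]_d).
Hypothesis h_local : forall X, X \in S -> local_op X (h X).
Hypothesis rv_density : forall v, density_operator (rv v).
Implicit Types (l : {set V} -> R) (X Y : {set V}).
Local Notation c l := (flog (trace_coef h rv S l)).

Definition restrict (T : {set {set V}}) l : {set V} -> R := fun X => if X \in T then l X else 0.

Lemma trace_coef_eq (A T : {set {set V}}) l l' n : T \subset A ->
  (forall X, X \in T -> l X = l' X) -> (forall X, X \in A -> X \notin T -> l X = 0) ->
  trace_coef h rv A l n = trace_coef h rv T l' n.
Proof.
move=> sTA ll' l0; suff E : hamiltonian A l h = hamiltonian T l' h by rewrite /trace_coef E.
rewrite /hamiltonian (big_setID T) /= (setIidPr sTA) [X in _ + X]big1 ?addr0.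
  by apply: eq_bigr => X XT; rewrite ll'.
by move=> X; rewrite inE => /andP[XT XA]; rewrite l0 // scale0r.
Qed.

Lemma flogU (T1 T2 : {set {set V}}) l n : T1 \subset S -> T2 \subset S -> [disjoint T1 & T2] ->
  (forall X Y, X \in T1 -> Y \in T2 -> X :&: Y = set0) -> supported T1 T2 l ->
  c l n = c (restrict T1 l) n + c (restrict T2 l) n.
Proof.
move=> s1 s2 d12 T12 sl.
have sU : T1 :|: T2 \subset S by rewrite subUset s1.
have E0 : trace_coef h rv S l = fun n => \sum_(j < n.+1)
    trace_coef h rv T1 l j * trace_coef h rv T2 l (n - j)%N.
  apply/funext => m; have <- := trace_coefU h_local rv_density l m s1 s2 d12 T12.
  exact: (trace_coef_eq m sU (fun _ _ => erefl) (fun X _ => sl X)).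
have E (T : {set {set V}}) : T \subset S ->
    trace_coef h rv S (restrict T l) = trace_coef h rv T l.
  move=> sT; apply/funext => m; rewrite (@trace_coef_eq S T (restrict T l) l m sT) // => X.
    by rewrite /restrict => ->.
  by rewrite /restrict => _ /negPf ->.
have tr1 v : \tr (rv v) = 1 by case: (rv_density v).
rewrite !E // E0 /flog dlog_conv ?mulrDl //; exact: trace_coef0.
Qed.

(** With the empty subsystem alone, [h set0] is local to no spin at all, the expectation is
    multiplicative on its powers, and L(t) = exp (w t) has a linear logarithm. *)
Lemma flog_set0 l n : (1 < n)%N -> set0 \in S -> (forall X, X != set0 -> l X = 0) -> c l n = 0.
Proof.
move=> n1 S0 l0; set w := - 'i * ((l set0)%:C * expect rv (h set0)).
have tr1 v : \tr (rv v) = 1 by case: (rv_density v).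
suff -> : trace_coef h rv S l = fun n => w ^+ n / n`!%:R by rewrite /flog dlog_exp // mul0r.
have sS0 : [set set0] \subset S by rewrite sub1set.
have l0' X : X \in S -> X \notin [set set0] -> l X = 0 by rewrite inE => _ /l0.
apply/funext => m; rewrite (trace_coef_eq m sS0 (fun _ _ => erefl) l0').
have -> : trace_coef h rv [set set0] l m =
    (- 'i) ^+ m / m`!%:R * expect rv (((l set0)%:C *: h set0) ^+ m).
  by rewrite /trace_coef /hamiltonian big_set1.
have d0 : [disjoint (set0 : {set V}) & (set0 : {set V})] by rewrite -setI_eq0 setI0.
have expectX k : expect rv (h set0 ^+ k) = expect rv (h set0) ^+ k.
  elim: k => [|k IH]; first by rewrite !expr0 expect1.
  have [_ E] := local_disjoint tr1 d0 (h_local S0) (local_X k (h_local S0)).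
  by rewrite !exprS -IH -E.
by rewrite exprZmx expectZ expectX /w !exprMn; move: (m`!%:R^-1) => x; ring.
Qed.

(** Copies of a nonempty subsystem are adjacent, while copies of the empty one are isolated
    vertices. [T1] collects the subsystems reachable from [u]. If it exhausts [T], some reachable
    [w] is another copy of the subsystem of [v]; this subsystem is then empty, so [u = w] is
    isolated and nothing else occurs. *)
Lemma disconnected_cluster (mu : {set V} -> nat) (T := [set X | (0 < mu X)%N]) :
  ~~ connected_cluster mu ->
  (exists T1 T2 A B, [/\ T1 :|: T2 = T, [disjoint T1 & T2], A \in T1, B \in T2 &
    forall X Y, X \in T1 -> Y \in T2 -> X :&: Y = set0]) \/
  (T = [set set0] /\ (1 < mu set0)%N).
Proof.
rewrite negb_forall => /existsP[u]; rewrite negb_forall => /existsP[v nuv].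
have vertex (X : {set V}) : (0 < mu X)%N -> exists w : cluster_vertex mu, tag w = X.
  by move=> mX; exists (Tagged (fun X => 'I_(mu X)) (Ordinal mX)).
have tag_T (w : cluster_vertex mu) : tag w \in T.
  by rewrite inE; case: w => X [i i_lt] /=; exact: leq_ltn_trans i_lt.
pose T1 := [set X in T | [exists w : cluster_vertex mu, (tag w == X) && connect (@cluster_edge V mu) u w]].
have uT1 : tag u \in T1.
  by rewrite inE tag_T; apply/existsP; exists u; rewrite eqxx connect0.
have sT1 : T1 \subset T by apply/subsetP => X; rewrite inE => /andP[].
have sep X Y : X \in T1 -> Y \in T :\: T1 -> X :&: Y = set0.
  rewrite inE => /andP[_ /existsP[w /andP[/eqP <- uw]]].
  rewrite inE => /andP[YT1 YT]; apply/eqP; apply: contraR YT1 => wY.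
  have [w' w'Y] : exists w' : cluster_vertex mu, tag w' = Y.
    by apply: vertex; move: YT; rewrite inE.
  rewrite inE YT; apply/existsP; exists w'; rewrite w'Y eqxx /=.
  have [<- //|ww'] := eqVneq w w'; apply: connect_trans uw (connect1 _).
  by rewrite /cluster_edge /= w'Y wY andbT.
have TE : T1 :|: (T :\: T1) = T by rewrite -[RHS](setID T T1) (setIidPr sT1).
have [T20|[B BT2]] := set_0Vmem (T :\: T1); last first.
  left; exists T1, (T :\: T1), (tag u), B; split=> //.
  by rewrite -setI_eq0 setIDA setDIl setDv set0I.
right.
have T1E : T1 = T by rewrite -TE T20 setU0.
have isolated (w w' : cluster_vertex mu) : tag w = set0 -> connect (@cluster_edge V mu) w' w -> w' = w.
  move=> w0 /connectP[p]; elim/last_ind: p => [|p x _] /=; first by move=> _ ->.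
  rewrite rcons_path last_rcons => /andP[_ e] xw; move: e.
  by rewrite -xw /cluster_edge /= w0 setI0 eqxx andbF.
have /existsP[w /andP[/eqP wv uw]] : [exists w : cluster_vertex mu,
    (tag w == tag v) && connect (@cluster_edge V mu) u w].
  by have := tag_T v; rewrite -T1E inE => /andP[].
have wv_neq : w != v by apply: contraNneq nuv => <-.
have v0 : tag v = set0.
  apply/eqP; apply: contraR nuv => v0; apply: connect_trans uw (connect1 _).
  by rewrite /cluster_edge /= wv_neq wv setIid v0.
have uE : u = w by apply: isolated uw; rewrite wv.
split.
  rewrite -T1E; apply/setP => X; rewrite !inE; apply/andP/eqP => [[_ /existsP[x /andP[/eqP <- ux]]]|->].
    have uniso (p : seq (cluster_vertex mu)) (y : cluster_vertex mu) : tag y = set0 ->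
        path (@cluster_edge V mu) y p -> p = [::].
      by case: p => //= a p y0; rewrite /cluster_edge /= y0 set0I eqxx andbF.
    have u0 : tag u = set0 by rewrite uE wv.
    by have /connectP[p /(uniso _ _ u0) -> ->] := ux.
  split; first by have := tag_T v; rewrite v0 inE.
  by apply/existsP; exists w; rewrite wv v0 eqxx uw.
move: wv_neq; case: w wv {uw uE} => X i; case: v v0 {nuv} => Y j /= Y0 XY ij.
have YX : X = Y by [].
subst X; move: i ij => i; rewrite -tag_eqE /tag_eq /= eqxx /= tagged_asE /= => ij.
rewrite -Y0 ltnNge; apply: contra ij => mu1; apply/eqP/val_inj.
have i0 := leq_trans (ltn_ord i) mu1; have j0 := leq_trans (ltn_ord j) mu1.
by move: i0 j0; rewrite !ltnS !leqn0 /= => /eqP -> /eqP ->.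
Qed.

Hypothesis h_contr : forall X, X \in S -> forall v, vnorm (h X *m v) <= vnorm v.
Hypothesis deg_ge1 : (1 <= max_degree S)%N.
Local Notation tL := (cluster_radius ((max_degree S)%:R : R)).

Lemma cluster_derivative_disconnected t (mu : {set V} -> nat) : nc t < tL ->
  (forall X, X \notin S -> mu X = 0%N) -> ~~ connected_cluster mu ->
  cluster_derivative S mu (fun l => clog (loschmidt S h (tens rv) l t)) = 0.
Proof.
move=> tr muS dmu.
have [ps [eps [K [eps0 fps ps_hom psE]]]] := clog_expansion h_local h_contr rv_density deg_ge1 tr.
rewrite (cluster_derivativeE mu eps0 fps ps_hom); set n := (\sum_(X in S) mu X)%N.
(* Only degree [n] contributes to the derivative. Its polynomial [F] is additive for all separated
   couplings, whereas away from 0 [clog] of a product need not be the sum of the two values. *)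
pose F l := c l n * t ^+ n.
pose ps' (i : nat) := if i == n then ps n else [::].
have F_expansion : expansion S F ps' 1 (pweight S 1 (ps n)).
  have w0 : 0 <= pweight S 1 (ps n).
    by apply: sumr_ge0 => m _; rewrite mulr_ge0 ?normc_ge0 ?exprn_ge0.
  have wE i : pweight S 1 (ps' i) = if i == n then pweight S 1 (ps n) else 0.
    by rewrite /ps'; case: eqP => // _; rewrite /pweight big_nil.
  split=> [m|l _].
    under eq_bigr do rewrite wE.
    rewrite -(big_mkord predT (fun i => if i == n then _ else _)) -big_mkcond big_nat1_eq /=.
    by case: ifP.
  have FE : F l = \sum_(i < n.+1) peval S (ps' i) l.
    rewrite big_ord_recr /ps' eqxx big1 => [|i _]; first by rewrite /F psE; apply/esym; exact: add0r.
    by rewrite ifN /peval ?big_nil //= neq_ltn ltn_ord.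
  rewrite FE; apply: (@csum_eventually R (fun i => peval S (ps' i) l)) => i ni.
  by rewrite /ps' ifN /peval ?big_nil // neq_ltn ni orbT.
have ps'_hom i : homogeneous S i (ps' i) by rewrite /ps'; case: eqP => [->|].
have := cluster_derivativeE mu ltr01 F_expansion ps'_hom; rewrite -/n /ps' eqxx => <-.
have supp_S X : (0 < mu X)%N -> X \in S.
  by move=> mX; apply: contraT => XS; rewrite muS in mX.
have [[T1 [T2 [A [B [TE d12 AT BT T12]]]]]|[TE mu1]] := disconnected_cluster dmu.
  have muT X : (0 < mu X)%N = (X \in T1 :|: T2) by rewrite TE inE.
  have s1 : T1 \subset S by apply/subsetP => X XT; apply: supp_S; rewrite muT inE XT.
  have s2 : T2 \subset S by apply/subsetP => X XT; apply: supp_S; rewrite muT inE XT orbT.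
  apply: (@cluster_derivative_separated _ _ S T1 T2 mu F A B) => //.
  - by move=> X; rewrite muT.
  - exact: (subsetP s1).
  - by rewrite muT inE AT.
  - exact: (subsetP s2).
  - by rewrite muT inE BT orbT.
  exists (fun l => c (restrict T1 l) n * t ^+ n), (fun l => c (restrict T2 l) n * t ^+ n).
  split; [move=> l l' ll'|move=> l l' ll'|move=> /notF []|move=> /notF []|move=> l sl].
  - have -> : restrict T1 l = restrict T1 l'; last by [].
    apply/funext => X; rewrite /restrict; case: ifP => // XT; apply: ll'.
    by rewrite (disjointFr d12 XT).
  - have -> : restrict T2 l = restrict T2 l'; last by [].
    apply/funext => X; rewrite /restrict; case: ifP => // XT; apply: ll'.
    by rewrite (disjointFl d12 XT).
  - apply: etrans (congr1 ( *%R^~ (t ^+ n)) (flogU n s1 s2 d12 T12 sl)) _.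
    exact: mulrDl.
have S0 : set0 \in S by apply: supp_S; exact: ltnW.
apply: (@cluster_derivative_null _ _ S [set set0]) => [X mX|l sl].
  by rewrite -TE inE.
rewrite /F flog_set0 ?mul0r // => [|X X0]; last by apply: sl; rewrite inE.
by rewrite /n (bigD1 set0) //= (leq_trans mu1) // leq_addr.
Qed.

Lemma cluster_expansionE t lam M : nc t < tL ->
  cluster_expansion S lam M (fun l => clog (loschmidt S h (tens rv) l t)) =
  \sum_(1 <= m < M.+1) c lam m * t ^+ m.
Proof.
move=> tr.
have [ps [eps [K [eps0 fps ps_hom psE]]]] := clog_expansion h_local h_contr rv_density deg_ge1 tr.
apply: eq_bigr => m _; rewrite psE -(taylor_homogeneous lam (ps_hom m)).
rewrite [RHS](bigID (fun W : {ffun {set V} -> 'I_m.+1} => connected_cluster (fun X => W X : nat))) /=.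
rewrite [X in _ + X]big1 ?addr0.
  apply: eq_big => W; first by rewrite inE /= andbA.
  rewrite inE /= => /and3P[_ /eqP Wm _].
  by rewrite (cluster_derivativeE _ eps0 fps ps_hom) Wm.
move=> W /andP[/andP[/forallP WS /eqP Wm] dW].
have W0 X : X \notin S -> W X = 0%N :> nat by move=> XS; have := WS X; rewrite XS => /eqP.
have := cluster_derivative_disconnected tr W0 dW.
by rewrite (cluster_derivativeE _ eps0 fps ps_hom) Wm => ->; rewrite mulr0.
Qed.

End Disconnected.

(** * The truncation error *)

Section Truncation.
Variable R : realType.
Local Notation nc := (@Normc.normc R).

Lemma csum_drop (u : nat -> R[i]) s N : csum u s ->
  csum (fun n => u (N + n)%N) (s - \sum_(i < N) u i).
Proof.
elim: N u s => [|N IH] u s us; first by rewrite big_ord0 subr0.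
have E : s - \sum_(i < N.+1) u i = s - u 0%N - \sum_(i < N) u i.+1.
  by rewrite big_ord_recl opprD addrA.
by rewrite E; exact: (IH (fun n => u n.+1) _ (csum_shift us)).
Qed.

(** In the tail, [nc t ^+ i] is at most [(nc t / r) ^+ N * r ^+ i], so the bound [K] on the weighted
    sum is reused and no geometric series is summed. *)
Lemma psum_truncation (a : nat -> R[i]) (t : R[i]) (r K : R) N : 0 < r -> nc t <= r ->
  psbound a r K -> nc (psum a t - \sum_(i < N) a i * t ^+ i) <= K * (nc t / r) ^+ N.
Proof.
move=> r0 tr aK; apply: (csum_le (csum_drop N (psum_csum aK tr))) => n.
have q0 : 0 <= nc t / r by rewrite divr_ge0 ?normc_ge0 // ltW.
have q1 : nc t / r <= 1 by rewrite ler_pdivrMr // mul1r.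
apply: le_trans (ler_wpM2r (exprn_ge0 N q0) (aK (N + n)%N)).
rewrite big_split_ord /= mulrDl -[leLHS]add0r lerD //.
  rewrite mulr_ge0 ?exprn_ge0 ?sumr_ge0 // => i _.
  by rewrite mulr_ge0 ?normc_ge0 ?exprn_ge0 // ltW.
rewrite mulr_suml; apply: ler_sum => i _; rewrite normcM normcX -mulrA ler_wpM2l ?normc_ge0 //.
have -> : nc t ^+ (N + i) = (nc t / r) ^+ (N + i) * r ^+ (N + i).
  by rewrite -exprMn divfK // gt_eqF.
rewrite mulrC ler_wpM2l ?exprn_ge0 ?(ltW r0) // exprD.
by rewrite ler_piMr ?exprn_ge0 // exprn_ile1.
Qed.

End Truncation.

Theorem theorem10 (R : realType) (V : finType) (d k : nat)
    (S : {set {set V}}) (lam : {set V} -> R)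
    (h : {set V} -> operator R V d) (rho : operator R V d)
    (lam_le1 : forall X, X \in S -> `|lam X| <= 1)
    (h_herm : forall X, X \in S -> h X \is hermsymmx)
    (h_supp : forall X, X \in S -> has_support (h X) X)
    (h_norm : forall X, X \in S -> op_norm (h X) = 1)
    (S_local : forall X, X \in S -> (#|X| <= k)%N)
    (deg_ge1 : (1 <= max_degree S)%N)
    (rho_prod : product_state rho) :
  let deg : R := (max_degree S)%:R in
  let tL : R := 1 / (2 * expR 1 ^+ 2 * deg * (deg + 1)) in
  let L : ({set V} -> R) -> R[i] -> R[i] := loschmidt S h rho in
  (forall t : R[i], Normc.normc t < tL -> L lam t != 0) /\
  exists logL : R[i] -> R[i],
    [/\ analytic_on_disc tL logL,
        logL 0 = 0,
        forall t : R[i], Normc.normc t < tL -> cexp (logL t) = L lam t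
      & forall (t : R[i]) (M : nat), Normc.normc t < tL ->
          Normc.normc
            (logL t - cluster_expansion S lam M (fun l => clog (L l t)))
          <= #|S|%:R * ((Normc.normc t / tL) ^+ M.+1
                         / (1 - Normc.normc t / tL))].
Proof.
move=> deg tL L; have [rv [rv_density rhoE]] := rho_prod.
have h_local X : X \in S -> local_op X (h X).
  by move=> XS; apply: acts_within_local; have [] := h_supp X XS.
have h_contr X : X \in S -> forall v, vnorm (h X *m v) <= vnorm v.
  by move=> XS; apply: op_norm1_contraction; exact: h_norm.
have rho_tens : rho = tens rv by [].
have tL0 : 0 < tL by apply: cluster_radius_gt0; rewrite ler1n.
have cK : psbound (flog (trace_coef h rv S lam)) tL #|S|%:R by exact: flog_psbound.
have expL t : Normc.normc t < tL -> cexp (psum (flog (trace_coef h rv S lam)) t) = L lam t.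
  by move=> tr; rewrite /L rho_tens; exact: cexp_loschmidt.
split; first by move=> t /expL <-; exact: cexp_neq0.
exists (psum (flog (trace_coef h rv S lam))); split=> //.
- move=> z zr; have e0 : 0 < tL - Normc.normc z by rewrite subr_gt0.
  by apply: (psum_derivable (K := #|S|%:R) e0); rewrite addrC subrK.
- by rewrite psum_0 /flog invr0 mulr0.
- move=> t M tr; rewrite /L rho_tens.
  have -> := cluster_expansionE h_local rv_density h_contr deg_ge1 lam M tr.
  have := psum_truncation M.+1 tL0 (ltW tr) cK.
  rewrite -(big_mkord predT (fun i => flog (trace_coef h rv S lam) i * t ^+ i)) big_ltn //.
  (* The constant term of log L is 0, which matches the start of the expansion at [m = 1]. *)
  rewrite [flog _ 0]/flog invr0 mulr0 mul0r add0r => /le_trans; apply.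
  have q0 : 0 <= Normc.normc t / tL by rewrite divr_ge0 ?normc_ge0 // ltW.
  have q1 : Normc.normc t / tL < 1 by rewrite ltr_pdivrMr // mul1r.
  (* What remains is that the factor [1 / (1 - |t| / tL)] is at least 1. *)
  rewrite ler_wpM2l // ler_peMr ?exprn_ge0 // invf_ge1 ?subr_gt0 //.
  by rewrite gerBl.
Qed.
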